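(* Let $n\ge 1$, let $p,q$ be integers, and let $u,v\in S_n$ be permutations such that $u$ is $p$-inverse Grassmannian and $v$ is $q$-inverse Grassmannian. Then the product $\sigma_u\cdot\sigma_v\in A(\mathsf{Flags}_n)$ is a multiplicity-free sum of Schubert cycles. Precisely, $$\sigma_u\cdot\sigma_v=\sum_{w\in S_n}c_{u,v}^w\,\sigma_w,$$ where, for $w\in S_n$, $$c_{u,v}^w=\begin{cases}1,&\text{if and only if } \ell(w)=\ell(u)+\ell(v)\text{ and }T_w\cdot\gamma_{u,v}=\Omega_{p,q};\\0,&\text{otherwise.}\end{cases}$$
   Context: **Permutations.** $S_{\mathbb Z}$ is the group of permutations of $\mathbb Z$ fixing all but finitely many integers; $s_i$ is the transposition of $i$ and $i+1$; $\ell(w)$ is the Coxeter length with respect to the generators $s_i$ ($i\in\mathbb Z$); $S_n$ is the subgroup generated by $s_1,\dots,s_{n-1}$. Permutations are composed as functions. A permutation $w\in S_{\mathbb Z}$ is $k$-Grassmannian if $w(i)<w(i+1)$ for all $i\ne k$ (so the identity is $k$-Grassmannian for every $k$), and $k$-inverse Grassmannian if $w^{-1}$ is $k$-Grassmannian. **Schubert cycles.** $\mathsf{Flags}_n$ is the variety of complete flags in $\mathbb C^n$, and $A(\mathsf{Flags}_n)$ is its Chow ring, with its basis of Schubert cycles $\sigma_u$, $u\in S_n$. The $c_{u,v}^w$ are the structure constants of this basis. For $u,v,w\in S_n$ they agree with the structure constants of Schubert polynomials, defined by $\mathfrak S_u\mathfrak S_v=\sum_w c_{u,v}^w\mathfrak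 S_w$, where $\mathfrak S_{w_0^{(n)}}=x_1^{n-1}x_2^{n-2}\cdots x_n^0$ for $w_0^{(n)}=n(n-1)\cdots 1$ and $\mathfrak S_{ws_i}=\dfrac{\mathfrak S_w-s_i\cdot\mathfrak S_w}{x_i-x_{i+1}}$ whenever $ws_i<w$ in Bruhat order, i.e. $w(i)>w(i+1)$ ($s_i$ acts on polynomials by swapping $x_i$ and $x_{i+1}$). Multiplicity-free means that all coefficients lie in $\{0,1\}$. **Backstable clans.** A backstable clan $\gamma$ is a partial matching of $\mathbb Z$ together with a label in $\{+,-\}$ on each unmatched integer, such that there exist $i,j\in\mathbb Z$ with $i-k$ matched to $j+k$ for all $k>0$; then $\gamma$ is said to be supported on $[i,j]$. Write $\gamma(a)=b$ if $a$ is matched with $b$, and $\gamma(a)=\pm$ if $a$ is unmatched with that label. A matched $a$ is initial if $\gamma(a)>a$ and final if $\gamma(a)<a$. Let $\zeta(\gamma)$ be the number of $+$ labels minus the number of $-$ labels. If $\gamma$ is supported on $[i,j]$, then $\gamma$ is a $(p,q)$-clan for $p=\frac12(i+j+\zeta(\gamma)-1)$, $q=\frac12(i+j-\zeta(\gamma)-1)$. $\gamma$ is noncrossing if there are no $a<b<c<d$ with $\gamma(a)=c$ and $\gamma(b)=d$. **Rainbow clan.** $\Omega_{p,q}$ is the $(p,q)$-clan with $\Omega_{p,q}(i)=+$ if $i\in[q+1,p]$; $\Omega_{p,q}(i)=-$ if $i\in[p+1,q]$; and $\Omega_{p,q}(i)=p+q+1-i$ otherwise. **The clan $\gamma_{u,v}$.**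 For $u$ $p$-inverse Grassmannian and $v$ $q$-inverse Grassmannian, put $\hat p=p+\frac12$, $\hat q=q+\frac12$. Then $\gamma_{u,v}$ is the unique noncrossing $(p,q)$-clan such that for every $i\in\mathbb Z$: if $u(i)<\hat p$ and $v(i)<\hat q$, then $i$ is initial; if $u(i)>\hat p$ and $v(i)>\hat q$, then $i$ is final; if $u(i)<\hat p$ and $v(i)>\hat q$, then $\gamma_{u,v}(i)=+$; if $u(i)>\hat p$ and $v(i)<\hat q$, then $\gamma_{u,v}(i)=-$. **$0$-Hecke action.** The $0$-Hecke algebra has generators $T_i$ ($i\in\mathbb Z$) with $T_i^2=T_i$, $T_iT_j=T_jT_i$ for $|i-j|>1$, and $T_iT_{i+1}T_i=T_{i+1}T_iT_{i+1}$; for a reduced expression $w=s_{i_1}\cdots s_{i_k}$ set $T_w=T_{i_1}\cdots T_{i_k}$. It acts (on the left) on $(p,q)$-clans as follows. - If $\gamma(i)$ is a sign and $i+1$ is initial, then $T_i\cdot\gamma$ is obtained by moving the sign to $i+1$ and matching $i$ with $\gamma(i+1)$. - If $i$ is final and $\gamma(i+1)$ is a sign, then $T_i\cdot\gamma$ is obtained by moving the sign to $i$ and matching $i+1$ with $\gamma(i)$. - If (a) $i,i+1$ are both initial with $\gamma(i)<\gamma(i+1)$, or (b) $i,i+1$ are both final with $\gamma(i)<\gamma(i+1)$, or (c) $i$ is final and $i+1$ is initial, then $T_i\cdot\gamma$ is obtained by exchanging partners: $i$ is matched with $\gamma(i+1)$ and $i+1$ is matched with $\gamma(i)$. - If $\gamma(i)$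 and $\gamma(i+1)$ are opposite signs, then $T_i\cdot\gamma$ is obtained by removing these signs and matching $i$ with $i+1$. - In all other cases $T_i\cdot\gamma=\gamma$. In each case everything not mentioned is unchanged. *)

(* Defs.v *)
From HB Require Import structures.
From mathcomp Require Import all_boot all_order all_fingroup all_algebra.
From mathcomp Require Import ring_quotient generic_quotient boolp mpoly.
From Stdlib Require Import ClassicalEpsilon.

Set Implicit Arguments.
Unset Strict Implicit.
Unset Printing Implicit Defensive.

Import Order.TTheory GRing.Theory Num.Theory.
Local Open Scope ring_scope.
Local Open Scope quotient_scope.

(* Elements of S_Z are handled as functions int -> int, composed as functions.
   S_n is 'S_n, whose 0-based index i : 'I_n stands for the integer i + 1. *)
Definition permZ (n : nat) (u : 'S_n) (z : int) : int :=
  match z with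
  | Posz k.+1 => if insub k is Some i then (u i).+1%:Z else z
  | _ => z
  end.

Definition simpleZ (i z : int) : int :=
  if z == i then i + 1 else if z == i + 1 then i else z.

(* [:: i_1; ...; i_k] denotes s_(i_1) \o ... \o s_(i_k). *)
Definition word_perm (a : seq int) : int -> int :=
  foldr (fun i f => simpleZ i \o f) id a.

Definition is_coxeter_length (f : int -> int) (k : nat) : Prop :=
  (exists a, size a = k /\ word_perm a =1 f) /\
  (forall a, word_perm a =1 f -> (k <= size a)%N).

Definition coxeter_length (f : int -> int) : nat :=
  epsilon (inhabits 0%N) (is_coxeter_length f).

Definition reduced_word (f : int -> int) (a : seq int) : Prop :=
  word_perm a =1 f /\ size a = coxeter_length f.

Definition grassmannian (k : int) (f : int -> int) : Prop :=
  forall i : int, i != k -> f i < f (i + 1).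

Definition inverse_grassmannian (n : nat) (k : int) (u : 'S_n) : Prop :=
  grassmannian k (permZ u^-1%g).

Definition w0 (n : nat) : 'S_n := perm (@rev_ord_inj n).

(* The product of 'S_n composes from left to right, so [tperm i j * w] is
   w \o s_i; the divided difference is stated with its denominator cleared. *)
Definition is_schubert_family (n : nat) (S : 'S_n -> {mpoly int[n]}) : Prop :=
  S (w0 n) = \prod_(i < n) 'X_i ^+ (n - i.+1) /\
  (forall (w : 'S_n) (i j : 'I_n), j = i.+1 :> nat -> (w j < w i)%N ->
     ('X_i - 'X_j) * S (tperm i j * w)%g = S w - msym (tperm i j) (S w)).

Definition schubert (n : nat) : 'S_n -> {mpoly int[n]} :=
  epsilon (inhabits (fun=> 0)) (@is_schubert_family n).

(* Borel's presentation A(Flags_n) = Z[x_1, ..., x_n] / (e_1, ..., e_n), under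
   which the Schubert cycle sigma_w is the class of the Schubert polynomial. *)

Definition coinvariant_ideal (n : nat) (f : {mpoly int[n]}) : bool :=
  `[< exists h : 'I_n -> {mpoly int[n]}, f = \sum_(i < n) h i * mesym n int i.+1 >].

Lemma coinvariant_ideal_closed n : idealr_closed (@coinvariant_ideal n).
Proof.
split.
- apply/asboolP; exists (fun=> 0).
  by rewrite big1 // => i _; rewrite mul0r.
- apply/asboolP => -[h] /(congr1 (meval (fun=> 0))).
  rewrite rmorph1 raddf_sum /= big1 => [/eqP|i _]; first by rewrite oner_eq0.
  rewrite mevalM mesymE [X in _ * X]raddf_sum /= big1 ?mulr0 // => s /eqP cs.
  have [j js] : exists j, j \in s by apply/set0Pn; rewrite -card_gt0 cs.
  by rewrite mevalX (bigD1 j) //= mnmE js mul0r.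
- move=> a f g /asboolP[h ->] /asboolP[k ->]; apply/asboolP.
  exists (fun i => a * h i + k i); rewrite mulr_sumr -big_split /=.
  by apply: eq_bigr => i _; rewrite mulrDl mulrA.
Qed.

HB.instance Definition _ (n : nat) :=
  isIdealr.Build {mpoly int[n]} (@coinvariant_ideal n) (@coinvariant_ideal_closed n).

Definition coinvariant_idealr (n : nat) : idealr {mpoly int[n]} :=
  @coinvariant_ideal n.

Definition Chow (n : nat) : comNzRingType := {ideal_quot (coinvariant_idealr n)}.

Definition sigma (n : nat) (w : 'S_n) : Chow n :=
  \pi_({ideal_quot (coinvariant_idealr n)}) (schubert w).

Definition schubert_coeff (n : nat) (u v : 'S_n) : 'S_n -> int :=
  epsilon (inhabits (fun=> 0))
    (fun c => sigma u * sigma v = \sum_(w : 'S_n) sigma w *~ c w).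

Definition multiplicity_free (n : nat) (x : Chow n) : Prop :=
  exists c : 'S_n -> int,
    x = \sum_(w : 'S_n) sigma w *~ c w /\ (forall w, c w = 0 \/ c w = 1).

Inductive clan_entry : Type :=
  | Sign of bool    (* true is +, false is - *)
  | Mate of int.

Definition preclan : Type := int -> clan_entry.

Definition supported (g : preclan) (i j : int) : Prop :=
  forall k : int, 0 < k -> g (i - k) = Mate (j + k).

Definition matching (g : preclan) : Prop :=
  forall a b : int, g a = Mate b -> b <> a /\ g b = Mate a.

Definition initial (g : preclan) (a : int) : Prop :=
  exists2 b : int, g a = Mate b & a < b.

Definition final (g : preclan) (a : int) : Prop :=
  exists2 b : int, g a = Mate b & b < a.

Definition entry_weight (x : clan_entry) : int :=
  match x with Sign true => 1 | Sign false => -1 | Mate _ => 0 end.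

(* When g is supported on [i, j] every unmatched integer lies in [i, j], so the
   sum over i, i + 1, ..., j computes zeta(g). *)
Definition zeta (g : preclan) (i j : int) : int :=
  \sum_(k < absz (j - i + 1)) entry_weight (g (i + k%:Z)).

Definition pq_clan (p q : int) (g : preclan) : Prop :=
  matching g /\
  exists i j : int, [/\ supported g i j,
    2 * p = i + j + zeta g i j - 1 & 2 * q = i + j - zeta g i j - 1].

Definition noncrossing (g : preclan) : Prop :=
  ~ exists a b c d : int,
      [/\ a < b, b < c, c < d, g a = Mate c & g b = Mate d].

Definition rainbow (p q : int) : preclan := fun i =>
  if (q + 1 <= i) && (i <= p) then Sign true
  else if (p + 1 <= i) && (i <= q) then Sign false
  else Mate (p + q + 1 - i).

(* For an integer k, k < p + 1/2 is k <= p, and k > p + 1/2 is p < k. *)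
Definition is_gamma (n : nat) (p q : int) (u v : 'S_n) (g : preclan) : Prop :=
  [/\ pq_clan p q g, noncrossing g &
  forall i : int,
    [/\ permZ u i <= p -> permZ v i <= q -> initial g i,
        p < permZ u i -> q < permZ v i -> final g i,
        permZ u i <= p -> q < permZ v i -> g i = Sign true &
        p < permZ u i -> permZ v i <= q -> g i = Sign false]].

Definition gamma (n : nat) (p q : int) (u v : 'S_n) : preclan :=
  epsilon (inhabits (rainbow p q)) (is_gamma p q u v).

Definition put (g : preclan) (a : int) (x : clan_entry) : preclan :=
  fun z => if z == a then x else g z.

Definition link (g : preclan) (a b : int) : preclan :=
  put (put g a (Mate b)) b (Mate a).

Definition hecke_gen (i : int) (g : preclan) : preclan :=
  let j := i + 1 in
  match g i, g j with
  | Sign s, Mate b => if j < b then link (put g j (Sign s)) i b else g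
  | Mate a, Sign s => if a < i then link (put g i (Sign s)) j a else g
  | Mate a, Mate b =>
      if [|| [&& i < a, j < b & a < b],
             [&& a < i, b < j & a < b] |
             (a < i) && (j < b)]
      then link (link g i b) j a else g
  | Sign s, Sign t => if s != t then link g i j else g
  end.

(* T_w g = T_(i_1) (... (T_(i_k) g)) for a reduced expression
   w = s_(i_1) ... s_(i_k); the result does not depend on that expression. *)
Definition hecke_act (f : int -> int) (g : preclan) : preclan :=
  foldr hecke_gen g (epsilon (inhabits [::]) (reduced_word f)).

(* Main.v *)
Require Import Defs.
From HB Require Import structures.
From mathcomp Require Import all_boot all_order all_fingroup all_algebra.
From mathcomp Require Import ring_quotient generic_quotient boolp mpoly.
From mathcomp Require Import zify ring.
From Stdlib Require Import ClassicalEpsilon FunctionalExtensionality.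

(* For a reduced word a of w, let jet a f be the constant term of the divided
   difference of f along a. These forms are dual to the Schubert polynomials and
   their common kernel is the coinvariant ideal, so that c_{u,v}^w is the jet of
   S_u S_v along a. The letters of a are compared one by one with the action of
   T_w on gamma_{u,v}: if exactly one of u, v has a descent at i, the divided
   difference of S_u S_v is a product S_u' S_v' and T_i maps gamma_{u,v} to
   gamma_{u',v'}; if neither has one, the divided difference vanishes and T_i acts
   trivially; words meeting a common descent are avoided. Read backwards, such
   steps produce the pair (u, v) from one whose clan has only signs inside a large
   window and is a rainbow outside.

   For a clan with P + Q signs in a window one inducts on P and on the length of
   the word, written as a product of an arbitrary word of the inner window, an
   increasing run and a decreasing run. The two runs pair two signs and move the
   arc to the ends of the window, or else the word is killed on both sides: on
   the clans because a sign or an arc cannot reach its place in the rainbow, on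
   polynomials because the word misses a letter needed by u or v, or because
   some prefix of the window contains too few small values of u and v. *)

Set Implicit Arguments.
Unset Strict Implicit.
Unset Printing Implicit Defensive.

Import Order.TTheory GRing.Theory Num.Theory.
Local Open Scope ring_scope.

Implicit Types i j l r z : int.

(** * Words and permutations *)

(** The obstacle is a letter i at which both u and v have a descent: the Leibniz rule then yields
    two products, and no single move of the clan matches them. If the clan has only signs in the
    window, the small values of u and of v occupy complementary positions there, so no such letter
    exists at the start. It can appear only after arcs have been made, and this is why words are
    first brought into a form that controls the order of their letters. Unwinding trades generality
    of the pair for length of the word: if D_x H = S_u S_v, the jet of S_u S_v along c is the jet of
    H along c ++ x, and c ++ x has P Q letters exactly when c has l(u) + l(v). The window is
    symmetric under z -> p + q + 1 - z, so that gamma_{u,v} and the rainbow agree outside it, and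
    its left margin holds enough initial points to match every final point inside it. T_i is
    idempotent whereas D_i squares to zero, so a letter without effect kills the jet but not the
    clan. The induction therefore also shows that fewer than P Q letters never lead to the
    rainbow. *)

Lemma simpleZ_spec (i z : int) :
  [\/ z = i /\ simpleZ i z = i + 1, z = i + 1 /\ simpleZ i z = i
    | [/\ z <> i, z <> i + 1 & simpleZ i z = z]].
Proof.
rewrite /simpleZ; case: eqP => [->|h]; first by constructor 1.
by case: eqP => [->|h']; [constructor 2|constructor 3].
Qed.

Ltac sz i z := let h := fresh in
  have [h|h|h] := simpleZ_spec i z; [case: h => ? ?|case: h => ? ?|case: h => ? ? ?].

Ltac ifs := repeat match goal with
  | |- context [if ?b then _ else _] =>
      lazymatch b with context [if _ then _ else _] => fail | _ => let h := fresh in case h : b end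
  end.

Lemma simpleZl i : simpleZ i i = i + 1.
Proof. by rewrite /simpleZ eqxx. Qed.

Lemma simpleZr i : simpleZ i (i + 1) = i.
Proof. by rewrite /simpleZ eqxx; ifs; lia. Qed.

Lemma simpleZK i : involutive (simpleZ i).
Proof. by move=> z; rewrite /simpleZ; do ![case: eqP]; lia. Qed.

Lemma simpleZ_far (i j : int) : 1 < `|i - j| -> simpleZ i \o simpleZ j = simpleZ j \o simpleZ i.
Proof.
move=> h; apply: functional_extensionality => z /=.
sz i z; sz j z; sz i (simpleZ j z); sz j (simpleZ i z); lia.
Qed.

Lemma simpleZ_adj (i : int) :
  simpleZ i \o (simpleZ (i + 1) \o simpleZ i) =
  simpleZ (i + 1) \o (simpleZ i \o simpleZ (i + 1)).
Proof.
apply: functional_extensionality => z /=.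
rewrite /simpleZ; do ![case: eqP]; lia.
Qed.

Lemma word_perm_cat a b : word_perm (a ++ b) = word_perm a \o word_perm b.
Proof.
by elim: a => //= i a ->; apply: functional_extensionality.
Qed.

Lemma word_perm_rcons a i : word_perm (rcons a i) = word_perm a \o simpleZ i.
Proof. by rewrite -cats1 word_perm_cat. Qed.

Lemma word_permK a : cancel (word_perm a) (word_perm (rev a)).
Proof.
elim: a => //= i a IH z /=.
by rewrite rev_cons word_perm_rcons /= simpleZK IH.
Qed.

Lemma word_permVK a : cancel (word_perm (rev a)) (word_perm a).
Proof. by move=> z; have := word_permK (rev a) z; rewrite revK. Qed.

Lemma word_perm_inj a : injective (word_perm a).
Proof. exact: can_inj (word_permK a). Qed.

Lemma word_perm_revE a f : word_perm a \o f = id -> f = word_perm (rev a).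
Proof.
move=> h; apply: functional_extensionality => z.
by apply: (can_inj (word_permK a)); rewrite word_permVK -[LHS]/((word_perm a \o f) z) h.
Qed.

Lemma word_perm_cut a (k z : int) : all (predC1 k) a -> (word_perm a z <= k) = (z <= k).
Proof.
elim: a => //= i a IH /andP[/= ik /IH <-].
by sz i (word_perm a z); lia.
Qed.

Lemma word_perm_small (l : int) a (z : int) : all (>= l) a -> z < l -> word_perm a z = z.
Proof.
elim: a => //= i a IH /andP[il /IH h] hz; rewrite h //.
by sz i z; lia.
Qed.

Lemma word_perm_large (r : int) a (z : int) : all (< r) a -> r < z -> word_perm a z = z.
Proof.
elim: a => //= i a IH /andP[il /IH h] hz; rewrite h //.
by sz i z; lia.
Qed.

(** * Braid equivalence of words *)

Inductive braid_eq : seq int -> seq int -> Prop :=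
  | braid_refl a : braid_eq a a
  | braid_sym a b : braid_eq a b -> braid_eq b a
  | braid_trans b a c : braid_eq a b -> braid_eq b c -> braid_eq a c
  | braid_far x y i j : 1 < `|i - j| ->
      braid_eq (x ++ [:: i; j] ++ y) (x ++ [:: j; i] ++ y)
  | braid_adj x y i :
      braid_eq (x ++ [:: i; i + 1; i] ++ y) (x ++ [:: i + 1; i; i + 1] ++ y).

Lemma braid_catl x a b : braid_eq a b -> braid_eq (x ++ a) (x ++ b).
Proof.
elim=> [c|c d _ h|c d e _ h _ h'|y z i j h|y z i].
- exact: braid_refl.
- exact: braid_sym.
- exact: braid_trans h h'.
- by rewrite ![x ++ _ ++ _]catA; apply: braid_far.
- by rewrite ![x ++ _ ++ _]catA; apply: braid_adj.
Qed.

Lemma braid_catr x a b : braid_eq a b -> braid_eq (a ++ x) (b ++ x).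
Proof.
elim=> [c|c d _ h|c d e _ h _ h'|y z i j h|y z i].
- exact: braid_refl.
- exact: braid_sym.
- exact: braid_trans h h'.
- by rewrite -![(_ ++ _) ++ x]catA; apply: braid_far.
- by rewrite -![(_ ++ _) ++ x]catA; apply: braid_adj.
Qed.

Lemma braid_size a b : braid_eq a b -> size a = size b.
Proof.
elim=> // [c d e _ -> _ ->|x y i j _|x y i] //; by rewrite !size_cat.
Qed.

Lemma braid_all Q a b : braid_eq a b -> all Q a = all Q b.
Proof.
elim=> // [c d e _ -> _ ->|x y i j _|x y i] //; rewrite !all_cat /= !andbT; congr (_ && (_ && _)).
  by rewrite andbC.
by case: (Q i); case: (Q (i + 1)).
Qed.

Lemma braid_rev a b : braid_eq a b -> braid_eq (rev a) (rev b).
Proof.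
elim=> [c|c d _ h|c d e _ h _ h'|y z i j h|y z i].
- exact: braid_refl.
- exact: braid_sym.
- exact: braid_trans h h'.
- by rewrite !rev_cat -!catA; apply: (@braid_far _ _ j i); rewrite distrC.
- by rewrite !rev_cat -!catA; apply: braid_adj.
Qed.

Lemma braid_opp (c : int) a b : braid_eq a b ->
  braid_eq (map (fun i => c - i) a) (map (fun i => c - i) b).
Proof.
elim=> [d|e d _ h|f d e _ h _ h'|y z i j h|y z i].
- exact: braid_refl.
- exact: braid_sym.
- exact: braid_trans h h'.
- by rewrite !map_cat; apply: braid_far; lia.
- rewrite !map_cat /=; set k := c - (i + 1).
  have -> : c - i = k + 1 by rewrite /k; lia.
  exact/braid_sym/braid_adj.
Qed.

Lemma braid_word_perm a b : braid_eq a b -> word_perm a = word_perm b.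
Proof.
elim=> // [d e f _ -> _ ->|x y i j h|x y i] //; rewrite !word_perm_cat /=; congr (_ \o _).
  by congr (_ \o _); rewrite -(simpleZ_far h).
by congr (_ \o _); rewrite -(simpleZ_adj i).
Qed.

(** The invariant [I] serves the 0-Hecke action, whose relations are proved on matchings; for
    divided differences it is trivial. *)
Lemma braid_foldr (T : Type) (I : T -> Prop) (F : int -> T -> T) a b :
    (forall i x, I x -> I (F i x)) ->
    (forall i j x, I x -> 1 < `|i - j| -> F i (F j x) = F j (F i x)) ->
    (forall i x, I x -> F i (F (i + 1) (F i x)) = F (i + 1) (F i (F (i + 1) x))) ->
  braid_eq a b -> forall x, I x -> foldr F x a = foldr F x b.
Proof.
move=> FI Ffar Fadj.
have fI c x : I x -> I (foldr F x c) by move=> h; elim: c => //= i c; apply: FI.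
elim=> // [c d _ h x Ix|c d e _ h _ h' x Ix|x y i j h z Iz|x y i z Iz].
- by rewrite h.
- by rewrite h // h'.
- by rewrite !foldr_cat /= Ffar //; apply: fI.
- by rewrite !foldr_cat /= Fadj //; apply: fI.
Qed.

(** Such words are not reduced: they kill every polynomial because D_i D_i = 0, and on clans they
    lose a letter because T_i T_i = T_i. *)
Definition squareful (a : seq int) : Prop :=
  exists x i y, braid_eq a (x ++ [:: i; i] ++ y).

Lemma squareful_braid a b : braid_eq a b -> squareful a -> squareful b.
Proof.
move=> h [x [i [y h']]]; exists x, i, y.
exact: braid_trans (braid_sym h) h'.
Qed.

Lemma squareful_cat x a y : squareful a -> squareful (x ++ a ++ y).
Proof.
move=> [b [i [c h]]]; exists (x ++ b), i, (c ++ y).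
by rewrite -catA; apply: braid_catl; rewrite (catA [:: i; i]) catA; apply: braid_catr.
Qed.

(** * Monotone runs and Lehmer normal forms *)

Fixpoint dn (b : int) (k : nat) : seq int :=
  if k is k'.+1 then (b + k'%:Z) :: dn b k' else [::].

Definition up (b : int) (k : nat) : seq int := [seq b + d%:Z | d <- iota 0 k].

Definition in_window (l : int) (m : nat) : pred int := fun i => (l <= i) && (i < l + m%:Z).

Lemma dnSr (b : int) k : dn b k.+1 = rcons (dn (b + 1) k) b.
Proof.
elim: k => [|k IH]; first by rewrite /= addr0.
rewrite -[dn b k.+2]/((b + k.+1%:Z) :: dn b k.+1) IH /=.
by congr (_ :: _); lia.
Qed.

Lemma size_dn (b : int) k : size (dn b k) = k.
Proof. by elim: k => //= k ->. Qed.

Lemma dn_cat (b : int) k k' : dn (b + k%:Z) k' ++ dn b k = dn b (k + k').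
Proof.
elim: k' => [|k' IH]; first by rewrite addn0.
by rewrite addnS /= IH; congr (_ :: _); lia.
Qed.

Lemma mem_dn (b : int) k i : (i \in dn b k) = (b <= i) && (i < b + k%:Z).
Proof.
elim: k => [|k IH]; first by rewrite in_nil; lia.
by rewrite /= inE IH; lia.
Qed.

Lemma upSr (b : int) k : up b k.+1 = rcons (up b k) (b + k%:Z).
Proof. by rewrite /up -addn1 iotaD map_cat cats1. Qed.

Lemma size_up (b : int) k : size (up b k) = k.
Proof. by rewrite size_map size_iota. Qed.

Lemma rev_dn (b : int) k : rev (dn b k) = up b k.
Proof. by elim: k => //= k IH; rewrite rev_cons IH upSr. Qed.

Lemma mem_up (b : int) k i : (i \in up b k) = (b <= i) && (i < b + k%:Z).
Proof. by rewrite -rev_dn mem_rev mem_dn. Qed.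

Lemma up_opp (c b : int) k : map (fun i => c - i) (dn b k) = up (c - b - k%:Z + 1) k.
Proof.
elim: k b => // k IH b.
rewrite dnSr map_rcons IH upSr; congr (rcons _ _); last lia.
by congr up; lia.
Qed.

Lemma braid_commute_word i a : all (fun j => 1 < `|i - j|) a ->
  braid_eq (i :: a) (rcons a i).
Proof.
elim: a => [|j a IH] /=; first by move=> _; apply: braid_refl.
move=> /andP[ij /IH h].
apply: (braid_trans (b := j :: i :: a)); first exact: (@braid_far [::] a i j).
exact: (braid_catl [:: j] h).
Qed.

Lemma dn_commute i (b : int) k : (i < b - 1) || (b + k%:Z < i) ->
  braid_eq (i :: dn b k) (rcons (dn b k) i).
Proof.
by move=> h; apply: braid_commute_word; apply/allP => j; rewrite mem_dn; lia.
Qed.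

(** The run is a cycle, and conjugation by it shifts inner letters by one. The run is cut at i, i -
    1 passes the upper part, one braid relation turns it into i, and i passes the lower part. *)
Lemma dn_shift i (b : int) k : b < i < b + k%:Z ->
  braid_eq (i - 1 :: dn b k) (rcons (dn b k) i).
Proof.
move=> h; pose n1 := absz (i - 1 - b)%R; pose n2 := (k - n1 - 2)%N.
have n1E : b + n1%:Z = i - 1 by rewrite /n1; lia.
have -> : dn b k = dn (i + 1) n2 ++ [:: i; i - 1] ++ dn b n1.
  have {1}-> : k = (n1 + (2 + n2))%N by rewrite /n2 /n1; lia.
  rewrite -dn_cat -dn_cat -catA n1E; congr (_ ++ _); first by congr dn; lia.
  by congr (_ ++ _); rewrite /= addr0; congr [:: _; _]; lia.
rewrite -cats1 -!catA.
have hA : braid_eq (i - 1 :: dn (i + 1) n2 ++ [:: i; i - 1] ++ dn b n1)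
   (dn (i + 1) n2 ++ [:: i - 1; i; i - 1] ++ dn b n1).
  rewrite -(cat1s _ (dn _ _ ++ _)) catA [X in braid_eq _ X](_ : _ = (dn (i + 1) n2 ++ [:: i - 1]) ++ [:: i; i - 1] ++ dn b n1).
    by rewrite cats1; apply: braid_catr; apply: dn_commute; lia.
  by rewrite -catA.
apply: braid_trans hA _.
have hB : braid_eq (dn (i + 1) n2 ++ [:: i - 1; i; i - 1] ++ dn b n1)
   (dn (i + 1) n2 ++ [:: i; i - 1; i] ++ dn b n1).
  by have := @braid_adj (dn (i + 1) n2) (dn b n1) (i - 1); rewrite subrK.
apply: braid_trans hB _; apply: braid_catl.
rewrite (_ : [:: i; i - 1; i] ++ dn b n1 = [:: i; i - 1] ++ (i :: dn b n1)) //.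
by apply: braid_catl; rewrite cats1; apply: dn_commute; lia.
Qed.

Lemma word_perm_dn (b : int) k z : word_perm (dn b k) z =
  if z == b then b + k%:Z else if (b < z) && (z <= b + k%:Z) then z - 1 else z.
Proof.
elim: k => [|k IH]; first by rewrite /= addr0; case: eqP => // ?; case: ifP => //; lia.
rewrite -[LHS]/(simpleZ (b + k%:Z) (word_perm (dn b k) z)) IH.
by rewrite /simpleZ; ifs; lia.
Qed.

(* Normal forms for the permutations of l, ..., l+m: the length k of each
   descending run is a digit of the Lehmer code. *)
Fixpoint nf (l : int) (m : nat) (a : seq int) : Prop :=
  if m is m'.+1 then
    exists a1 k, [/\ nf l m' a1, (k <= m)%N & a = a1 ++ dn (l + m%:Z - k%:Z) k]
  else a = [::].

Lemma nf_window l m a : nf l m a -> all (in_window l m) a.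
Proof.
elim: m a => [|m IH] a /=; first by move=> ->.
move=> [a1 [k [/IH h1 hk ->]]]; rewrite all_cat; apply/andP; split.
  by apply: sub_all h1 => i; rewrite /in_window; lia.
by apply/allP => i; rewrite mem_dn /in_window; lia.
Qed.

Lemma nf_nil l m : nf l m [::].
Proof. by elim: m => //= m IH; exists [::], 0%N. Qed.

(** The exchange condition. If i = b - 1 the last run grows, if i = b it shrinks. Otherwise i passes
    through the run, unchanged below b and lowered by one above b, and the induction treats it in
    the smaller window. *)
Lemma nf_append l m a i : nf l m a -> in_window l m i ->
    (word_perm a i < word_perm a (i + 1) /\ exists2 a', nf l m a' & braid_eq (rcons a i) a')
  \/ (word_perm a (i + 1) < word_perm a i /\ exists x, braid_eq a (rcons x i)).
Proof.
elim: m a i => [|m IH] a i /=; first by rewrite /in_window; lia.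
move=> [a1 [k [h1 hk ->]]]; rewrite /in_window => hi.
set b := l + m.+1%:Z - k%:Z.
have w1 z : z <= l + m%:Z -> word_perm a1 z <= l + m%:Z.
  move=> hz; rewrite word_perm_cut //; apply: sub_all (nf_window h1) => j.
  by rewrite /in_window /=; lia.
have w1r : word_perm a1 (l + m.+1%:Z) = l + m.+1%:Z.
  apply: (@word_perm_large (l + m%:Z)); last lia.
  by apply: sub_all (nf_window h1) => j; rewrite /in_window /=; lia.
have wE z : word_perm (a1 ++ dn b k) z = word_perm a1
    (if z == b then b + k%:Z else if (b < z) && (z <= b + k%:Z) then z - 1 else z).
  by rewrite word_perm_cat /= word_perm_dn.
rewrite !wE -cats1 -catA.
set f := fun z => if z == b then b + k%:Z else if (b < z) && (z <= b + k%:Z) then z - 1 else z.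
rewrite -/(f i) -/(f (i + 1)).
have bk : b + k%:Z = l + m.+1%:Z by rewrite /b; lia.
case: (ltgtP i b) => hib.
- case: (i + 1 =P b) => hib1.
    left; split.
      have -> : f i = i by rewrite /f; ifs; lia.
      have -> : f (i + 1) = l + m.+1%:Z by rewrite /f; ifs; lia.
      rewrite w1r; have := w1 i; lia.
    exists (a1 ++ dn (b - 1) k.+1); last first.
      by rewrite dnSr cats1 subrK -hib1 addrK; apply: braid_refl.
    exists a1, k.+1; split => //; first by lia.
    by congr (_ ++ dn _ _); rewrite /b; lia.
  have hw : in_window l m i by rewrite /in_window; lia.
  have com : braid_eq (dn b k ++ [:: i]) (i :: dn b k).
    by rewrite cats1; apply/braid_sym/dn_commute; lia.
  have -> : f i = i by rewrite /f; ifs; lia.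
  have -> : f (i + 1) = i + 1 by rewrite /f; ifs; lia.
  case: (IH a1 i h1 hw) => -[hlt hx]; [left|right]; split => //.
    case: hx => a' na' ea'.
    exists (a' ++ dn b k); first by exists a', k.
    apply: braid_trans (braid_catl a1 com) _.
    by rewrite -cat_rcons; apply: braid_catr.
  case: hx => x ex; exists (x ++ dn b k).
  rewrite -cats1 -catA.
  apply: braid_trans (braid_catr _ ex) _; rewrite cat_rcons.
  exact/braid_catl/braid_sym.
- case: k hk @b hib bk wE @f => [|k] hk b hib bk wE f; first by lia.
  have hw : in_window l m (i - 1) by rewrite /in_window; lia.
  have sh : braid_eq (dn b k.+1 ++ [:: i]) (i - 1 :: dn b k.+1).
    by rewrite cats1; apply/braid_sym/dn_shift; lia.
  have -> : f i = i - 1 by rewrite /f; ifs; lia.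
  have -> : f (i + 1) = i - 1 + 1 by rewrite /f; ifs; lia.
  case: (IH a1 (i - 1) h1 hw) => -[hlt hx]; [left|right]; split => //.
    case: hx => a' na' ea'.
    exists (a' ++ dn b k.+1); first by exists a', k.+1.
    apply: braid_trans (braid_catl a1 sh) _.
    by rewrite -cat_rcons; apply: braid_catr.
  case: hx => x ex; exists (x ++ dn b k.+1).
  rewrite -cats1 -catA.
  apply: braid_trans (braid_catr _ ex) _; rewrite cat_rcons.
  exact/braid_catl/braid_sym.
- right.
  case: k hk @b hib bk wE @f => [|k] hk b hib bk wE f; first by lia.
  split.
    have -> : f i = l + m.+1%:Z by rewrite /f; ifs; lia.
    have -> : f (i + 1) = b by rewrite /f; ifs; lia.
    rewrite w1r; have := w1 b; lia.
  exists (a1 ++ dn (b + 1) k); rewrite hib dnSr -[rcons (_ ++ _) _]cats1 -catA cats1.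
  exact: braid_refl.
Qed.

Lemma nf_or_squareful l m a : all (in_window l m) a ->
  squareful a \/ exists2 a', nf l m a' & braid_eq a a'.
Proof.
elim/last_ind: a => [|a i IH]; first by right; exists [::]; [apply: nf_nil|apply: braid_refl].
rewrite all_rcons => /andP[hi /IH [sq|[a' na' ea']]].
  by left; have := squareful_cat [::] [:: i] sq; rewrite /= cats1.
have ea : braid_eq (rcons a i) (rcons a' i) by rewrite -!cats1; apply: braid_catr.
case: (nf_append na' hi) => -[_].
  by move=> [b nb eb]; right; exists b => //; apply: braid_trans eb.
move=> [x ex]; left; exists x, i, [::].
apply: braid_trans ea _.
by rewrite cats0 -cats1 -[[:: i; i]]cat1s catA; apply: braid_catr; rewrite cats1.
Qed.

Lemma nf_last l m a1 k : nf l m a1 -> word_perm a1 (l + m.+1%:Z) = l + m.+1%:Z /\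
  word_perm (a1 ++ dn (l + m.+1%:Z - k%:Z) k) (l + m.+1%:Z - k%:Z) = l + m.+1%:Z.
Proof.
move=> h1; have w1r : word_perm a1 (l + m.+1%:Z) = l + m.+1%:Z.
  apply: (@word_perm_large (l + m%:Z)); last lia.
  by apply: sub_all (nf_window h1) => j; rewrite /in_window /=; lia.
by split=> //; rewrite word_perm_cat /= word_perm_dn eqxx subrK.
Qed.

Lemma nf_inj l m a b : nf l m a -> nf l m b -> word_perm a = word_perm b -> a = b.
Proof.
elim: m a b => [|m IH] a b /=; first by move=> -> ->.
move=> [a1 [k [h1 hk ->]]] [b1 [k' [h1' hk' ->]]] e.
have [_ e1] := nf_last k h1; have [_ e2] := nf_last k' h1'.
have kk : l + m.+1%:Z - k%:Z = l + m.+1%:Z - k'%:Z.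
  by apply: (@word_perm_inj _ _ _ (etrans e1 (esym _))); rewrite e.
have {kk}kk : k = k' by lia.
subst k'; congr (_ ++ _); apply: IH => //.
move: e; rewrite !word_perm_cat => e.
apply: functional_extensionality => z.
have := congr1 (fun f => f (word_perm (rev (dn (l + m.+1%:Z - k%:Z) k)) z)) e.
by rewrite /= word_permVK.
Qed.

Lemma nf_widenr l m a : nf l m a -> nf l m.+1 a.
Proof. by move=> h; exists a, 0%N; rewrite cats0. Qed.

Lemma nf_widenl l m a : nf l m a -> nf (l - 1) m.+1 a.
Proof.
elim: m a => [|m IH] a; first by move=> ->; apply: nf_nil.
move=> [a1 [k [h1 hk ->]]]; exists a1, k; split; [exact: IH|lia|].
by congr (_ ++ dn _ _); lia.
Qed.

Lemma nf_widen l m l' m' a : l' <= l -> l + m%:Z <= l' + m'%:Z -> nf l m a -> nf l' m' a.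
Proof.
move=> h1 h2 na; pose d := absz (l - l')%R.
have -> : l' = l - d%:Z by rewrite /d; lia.
have -> : m' = (m' - d - m + (d + m))%N by rewrite /d; lia.
elim: (m' - d - m)%N => [|e IH]; last by rewrite addSn; apply: nf_widenr.
elim: d => [|d IH]; first by rewrite subr0.
rewrite (_ : l - _ = l - d%:Z - 1); last lia.
exact: nf_widenl.
Qed.

Lemma word_in_window a : exists l m, all (in_window l m) a.
Proof.
elim: a => [|i a [l [m h]]]; first by exists 0, 0%N.
exists (l - (absz (l - i)%R)%:Z), (m + absz (l - i)%R + absz (l - i)%R + 1)%N => /=.
rewrite (_ : in_window _ _ i); last by rewrite /in_window; lia.
by apply: sub_all h => j; rewrite /in_window; lia.
Qed.

Lemma squareful_shorten a : squareful a -> exists2 b, word_perm b = word_perm a &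
  (size b < size a)%N.
Proof.
move=> [x [i [y h]]]; exists (x ++ y); last by rewrite (braid_size h) !size_cat /=; lia.
rewrite (braid_word_perm h) !word_perm_cat; congr (_ \o _).
by apply: functional_extensionality => z /=; rewrite simpleZK.
Qed.

(** Induction on the length of the competitor b: a square in it gives a shorter competitor, and
    without squares it is braid equivalent to a normal form of a common window, which can only be
    a. *)
Lemma nf_minimal l m a b : nf l m a -> word_perm b = word_perm a -> (size a <= size b)%N.
Proof.
move=> na; have [k hk] := ubnP (size b); elim: k b hk => // k IH b hk e.
have [l' [m' hb]] := word_in_window b.
pose l'' := l - (absz (l - l')%R)%:Z; pose m'' := (absz (l - l')%R + absz (l - l')%R + m + m')%N.
have na' : nf l'' m'' a by apply: nf_widen na; rewrite /l'' /m''; lia.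
have hb' : all (in_window l'' m'') b.
  by apply: sub_all hb => j; rewrite /in_window /l'' /m''; lia.
case: (nf_or_squareful hb') => [sq|[b' nb' eb']].
  have [c e' hc] := squareful_shorten sq.
  by apply: leq_trans (IH c _ _) (ltnW hc); [exact: leq_trans hc _|rewrite e'].
rewrite (braid_size eb') (nf_inj na' nb') //.
by rewrite -e (braid_word_perm eb').
Qed.

(** * Reduced words, Coxeter length and factorisations *)

Definition reduced (a : seq int) : Prop :=
  forall b, word_perm b = word_perm a -> (size a <= size b)%N.

Lemma nf_reduced l m a : nf l m a -> reduced a.
Proof. by move=> na b; apply: nf_minimal na. Qed.

Lemma reduced_squareful a : reduced a -> ~ squareful a.
Proof. by move=> ra /squareful_shorten [b /ra]; rewrite leqNgt => /negP. Qed.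

Lemma reduced_rev a : reduced a -> reduced (rev a).
Proof.
move=> ra b e; rewrite size_rev -(size_rev b); apply: ra.
have : word_perm (rev a) \o word_perm (rev b) = id.
  by apply: functional_extensionality => z /=; rewrite -e word_permVK.
by move/word_perm_revE; rewrite revK.
Qed.

Lemma reduced_nf l m a : all (in_window l m) a -> reduced a ->
  exists2 a', nf l m a' & braid_eq a a'.
Proof. by move=> wa /reduced_squareful ra; case: (nf_or_squareful wa). Qed.

(** Reduced words contain no square, hence both are braid equivalent to normal forms of a common
    window, and these coincide by [nf_inj]. *)
Lemma matsumoto a b : reduced a -> reduced b -> word_perm a = word_perm b -> braid_eq a b.
Proof.
move=> ra rb e.
have [l [m h]] := word_in_window (a ++ b); move: h; rewrite all_cat => /andP[ha hb].
have [a' na' ea'] := reduced_nf ha ra; have [b' nb' eb'] := reduced_nf hb rb.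
apply: (braid_trans ea'); apply: braid_sym; rewrite (nf_inj na' nb') //.
by rewrite -(braid_word_perm ea') e (braid_word_perm eb').
Qed.

Lemma nf_exists l m a : all (in_window l m) a -> exists2 b, nf l m b & word_perm b = word_perm a.
Proof.
have [k hk] := ubnP (size a); elim: k a hk => // k IH a hk wa.
case: (nf_or_squareful wa) => [[x [i [y e]]]|[a' na' ea']].
  have [||b nb eb] := IH (x ++ y).
  - by move: hk; rewrite (braid_size e) !size_cat /=; lia.
  - by move: wa; rewrite (braid_all _ e) !all_cat; case: (all _ x) => //; case: (all _ y); rewrite ?andbF.
  exists b => //; rewrite eb (braid_word_perm e) !word_perm_cat; congr (_ \o _).
  by apply: functional_extensionality => z /=; rewrite simpleZK.
by exists a' => //; rewrite (braid_word_perm ea').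
Qed.

Lemma reduced_braid a b : braid_eq a b -> reduced a -> reduced b.
Proof.
by move=> e ra c; rewrite -(braid_word_perm e) -(braid_size e); apply: ra.
Qed.

Lemma reduced_rcons a i : reduced a -> word_perm a i < word_perm a (i + 1) ->
  reduced (rcons a i).
Proof.
move=> ra lt; have [l [m h]] := word_in_window (rcons a i).
move: (h); rewrite all_rcons => /andP[hi ha].
have [a' na' ea'] := reduced_nf ha ra.
have wE := braid_word_perm ea'.
case: (nf_append na' hi) => -[lt' h']; last by rewrite -wE in lt'; lia.
case: h' => b nb eb.
apply: reduced_braid (nf_reduced nb).
by apply: braid_sym; apply: braid_trans eb; rewrite -!cats1; apply: braid_catr.
Qed.

Lemma reduced_descent a i : reduced a -> word_perm a (i + 1) < word_perm a i ->
  exists2 x, braid_eq a (rcons x i) & reduced x.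
Proof.
move=> ra lt; have [l [m h]] := word_in_window (rcons a i).
move: (h); rewrite all_rcons => /andP[hi ha].
have [a' na' ea'] := reduced_nf ha ra.
have wE := braid_word_perm ea'.
case: (nf_append na' hi) => -[lt' h']; first by rewrite -wE in lt'; lia.
case: h' => x ex; exists x; first exact: braid_trans ex.
have e := braid_trans ea' ex.
move=> c wc.
have : (size a <= size (rcons c i))%N.
  by apply: ra; rewrite (braid_word_perm e) !word_perm_rcons wc.
by rewrite (braid_size e) !size_rcons.
Qed.

Lemma coxeter_length_reduced a : reduced a -> coxeter_length (word_perm a) = size a.
Proof.
move=> ra; have ex : exists k, is_coxeter_length (word_perm a) k.
  exists (size a); split; first by exists a.
  by move=> b e; apply: ra; apply: functional_extensionality.
have [[b [sb eb]] min] := epsilon_spec (inhabits 0%N) _ ex.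
apply/eqP; rewrite eqn_leq; apply/andP; split; first exact: min.
by rewrite /coxeter_length -sb; apply: ra; apply: functional_extensionality.
Qed.

Lemma reduced_wordP f a : reduced_word f a -> word_perm a = f /\ reduced a.
Proof.
move=> [ef sa]; have {}ef : word_perm a = f by apply: functional_extensionality.
split=> //; have [l [m /nf_exists [b nb eb]]] := word_in_window a.
move=> c e; have rb := nf_reduced nb.
rewrite sa -ef -eb (coxeter_length_reduced rb); apply: rb.
by rewrite e.
Qed.

Lemma reduced_word_exists a : exists b, reduced_word (word_perm a) b.
Proof.
have [l [m /nf_exists [b nb eb]]] := word_in_window a.
exists b; split; first by rewrite eb.
by rewrite -eb (coxeter_length_reduced (nf_reduced nb)).
Qed.

Lemma split_max l m a : all (in_window l m.+1) a ->
  squareful a \/ exists a1 k, [/\ all (in_window l m) a1, (k <= m.+1)%N &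
    braid_eq a (a1 ++ dn (l + m.+1%:Z - k%:Z) k)].
Proof.
move=> /nf_or_squareful [|[a' [a1 [k [n1 hk ->]]] e]]; first by left.
by right; exists a1, k; split => //; apply: nf_window.
Qed.

Lemma split_min l m a : all (in_window l m.+1) a ->
  squareful a \/ exists a1 k, [/\ all (in_window (l + 1) m) a1, (k <= m.+1)%N &
    braid_eq a (a1 ++ up l k)].
Proof.
(* The reflection of the letters l, ..., l + m turns the decreasing run at the right end into an
   increasing run at the left end. *)
pose c : int := l + l + m%:Z; pose o := [eta map (fun i : int => c - i)].
have oK b : o (o b) = b by rewrite /o /= -map_comp map_id_in // => i _ /=; lia.
move=> wa; have wo : all (in_window l m.+1) (o a).
  by rewrite all_map; apply: sub_all wa => i; rewrite /in_window /c /=; lia.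
case: (split_max wo) => [[x [i [y e]]]|[a1 [k [w1 hk e]]]].
  left; exists (o x), (c - i), (o y).
  by have := braid_opp c e; rewrite -/(o _) oK !map_cat.
right; exists (o a1), k; split => //.
  by rewrite all_map; apply: sub_all w1 => i; rewrite /in_window /c /=; lia.
have := braid_opp c e; rewrite -/(o _) oK map_cat up_opp.
by rewrite (_ : _ + 1 = l) // /c; lia.
Qed.

Lemma reduced_belast a i : reduced (rcons a i) -> reduced a.
Proof.
move=> h b e; have := h (rcons b i); rewrite !word_perm_rcons e !size_rcons ltnS; exact.
Qed.

Lemma reduced_last a i : reduced (rcons a i) -> word_perm a i < word_perm a (i + 1).
Proof.
move=> h; have ra := reduced_belast h.
have [//|ge] := ltP (word_perm a i) (word_perm a (i + 1)).
have [|x e _] := @reduced_descent a i ra; first by have := @word_perm_inj a (i + 1) i; lia.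
case: (reduced_squareful h); exists x, i, [::].
by rewrite cats0 -cat_rcons cats1; rewrite -cats1 -(cats1 (rcons x i)); apply: braid_catr.
Qed.

Lemma upD (b : int) k k' : up b (k + k') = up b k ++ up (b + k%:Z) k'.
Proof.
elim: k' => [|k' IH]; first by rewrite addn0 cats0.
by rewrite addnS !upSr IH rcons_cat; congr (_ ++ rcons _ _); lia.
Qed.

(** The factor [a2] fixes both end points b and b + n + 1 of the window, so that the two runs must
    bring there whatever the rainbow has at these points. *)
Lemma split_both (b : int) n a : all (in_window b n.+1) a ->
  squareful a \/ exists a2 k2 k1, [/\ all (in_window (b + 1) n.-1) a2, (k2 <= n)%N, (k1 <= n.+1)%N &
    braid_eq a ((a2 ++ up b k2) ++ dn (b + n.+1%:Z - k1%:Z) k1)].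
Proof.
move=> /split_max [|[a1 [k1 [w1 hk1 e1]]]]; first by left.
have ext a' : braid_eq a1 a' -> braid_eq a (a' ++ dn (b + n.+1%:Z - k1%:Z) k1).
  by move=> e; apply: braid_trans e1 _; apply: braid_catr.
case: n a w1 hk1 e1 ext => [|n] a w1 hk1 e1 ext.
  case: a1 w1 e1 ext => [|i a1] w1 e1 ext; last by move: w1; rewrite /= /in_window; lia.
  by right; exists [::], 0%N, k1; split.
have [sq|[a2 [k2 [w2 hk2 e2]]]] := split_min w1.
  left; have := squareful_cat [::] (dn (b + n.+2%:Z - k1%:Z) k1) sq.
  exact/squareful_braid/braid_sym.
by right; exists a2, k2, k1; split => //; apply: ext.
Qed.

(** * Divided differences *)

Definition pos (m : nat) l z : 'I_m.+1 := inord (absz (z - l)).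

Definition X (m : nat) l z : {mpoly int[m.+1]} := 'X_(pos m l z).

(** Outside the window [sw] is the identity and [D] is zero; this makes most identities of the
    calculus hold for every letter. *)
Definition tp (m : nat) l i : 'S_m.+1 :=
  if in_window l m i then tperm (pos m l i) (pos m l (i + 1)) else 1%g.

(* Locking keeps unification from unfolding these operators to sums over
   monomials. *)
HB.lock Definition sw (m : nat) l i : {mpoly int[m.+1]} -> {mpoly int[m.+1]} :=
  msym (tp m l i).

HB.lock Definition D (m : nat) l i (f : {mpoly int[m.+1]}) : {mpoly int[m.+1]} :=
  if in_window l m i
  then epsilon (inhabits 0) (fun g => (X m l i - X m l (i + 1)) * g = f - @sw m l i f)
  else 0.

Section DividedDifferences.

Variables (m : nat) (l : int).

Notation R := {mpoly int[m.+1]}.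
Notation pos := (@pos m l).
Notation X := (@X m l).
Notation tp := (@tp m l).
Notation sw := (@sw m l).
Notation D := (@D m l).

Implicit Types f g h : R.

Lemma sw_add i f g : sw i (f + g) = sw i f + sw i g.
Proof. by rewrite sw.unlock msymD. Qed.

Lemma sw_sub i f g : sw i (f - g) = sw i f - sw i g.
Proof. by rewrite sw.unlock msymB. Qed.

Lemma sw_mul i f g : sw i (f * g) = sw i f * sw i g.
Proof. by rewrite sw.unlock msymM. Qed.

Lemma sw0 i : sw i 0 = 0.
Proof. by rewrite sw.unlock msym0. Qed.

Lemma sw1 i : sw i 1 = 1.
Proof. by rewrite sw.unlock msym1. Qed.

Lemma sw_exp i f k : sw i (f ^+ k) = sw i f ^+ k.
Proof. by elim: k => [|k IH]; rewrite ?sw1 // !exprS sw_mul IH. Qed.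

Lemma pos_inj z z' : l <= z <= l + m%:Z -> l <= z' <= l + m%:Z -> pos z = pos z' -> z = z'.
Proof.
move=> hz hz' /(congr1 val); rewrite /pos /= !inordK; lia.
Qed.

Lemma msym_var (s : 'S_m.+1) k : msym s 'X_k = 'X_(s k) :> R.
Proof.
rewrite msymX; congr 'X_[_]; apply/mnmP => k'.
rewrite mnmE !mnm1E; congr nat_of_bool.
by apply/eqP/eqP => [->|<-]; rewrite ?permKV ?permK.
Qed.

Lemma swX i z : in_window l m i -> l <= z <= l + m%:Z -> sw i (X z) = X (simpleZ i z).
Proof.
move=> hi hz; rewrite sw.unlock /X msym_var /tp hi.
move: hi; rewrite /in_window => hi.
case: (simpleZ_spec i z) => [[-> ->]|[-> ->]|[h1 h2 ->]]; rewrite ?tpermL ?tpermR //.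
by rewrite tpermD //; apply/eqP => /pos_inj; lia.
Qed.

Lemma sw_inert i z : in_window l m i -> l <= z <= l + m%:Z -> z != i -> z != i + 1 ->
  sw i (X z) = X z.
Proof. by move=> hi hz h1 h2; rewrite swX //; congr X; sz i z; lia. Qed.

Lemma sw_out i f : ~~ in_window l m i -> sw i f = f.
Proof. by move=> /negbTE hi; rewrite sw.unlock /tp hi msym1m. Qed.

Lemma X_neq i : in_window l m i -> X i - X (i + 1) != 0.
Proof.
move=> hi; apply/eqP => /(congr1 (meval (fun k => (k == pos i)%:R))).
rewrite mevalB meval0 !mevalXU eqxx.
case: eqP => // /pos_inj; move: hi; rewrite /in_window; lia.
Qed.

(** The polynomials for which the quotient exists form a ring, by the product rule, and this ring
    contains the constants and the variables. *)
Lemma divided_exists i f : exists g, (X i - X (i + 1)) * g = f - sw i f.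
Proof.
have [hi|hi] := boolP (in_window l m i); last by exists 0; rewrite sw_out // mulr0 subrr.
pose Q f := exists g, (X i - X (i + 1)) * g = f - sw i f.
have QD f1 f2 : Q f1 -> Q f2 -> Q (f1 + f2).
  by move=> [g1 e1] [g2 e2]; exists (g1 + g2); rewrite mulrDr e1 e2 sw_add; ring.
have QM f1 f2 : Q f1 -> Q f2 -> Q (f1 * f2).
  move=> [g1 e1] [g2 e2]; exists (g1 * f2 + sw i f1 * g2).
  rewrite mulrDr mulrA e1 mulrCA e2 sw_mul; ring.
have Q1 : Q 1 by exists 0; rewrite mulr0 sw1 subrr.
have QX k : Q 'X_k.
  rewrite /Q sw.unlock /tp hi msym_var; case: tpermP => [->|->|_ _].
  - by exists 1; rewrite mulr1.
  - by exists (-1); rewrite /X mulrN1 opprB.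
  - by exists 0; rewrite mulr0 subrr.
elim/mpolyind: f => [|c k p _ _ Qp]; first by exists 0; rewrite mulr0 sw0 subrr.
apply: QD Qp; rewrite -mul_mpolyC; apply: (QM).
  by exists 0; rewrite mulr0 sw.unlock /msym mmapC subrr.
rewrite mpolyXE_id; apply: (big_ind Q) => // k' _.
by elim: (k k') => [|e IH]; rewrite ?expr0 ?exprS //; apply: QM.
Qed.

Lemma D_spec i f : (X i - X (i + 1)) * D i f = f - sw i f.
Proof.
rewrite D.unlock; case: (boolP (in_window l m i)) => hi; last by rewrite sw_out // mulr0 subrr.
exact: (epsilon_spec (inhabits 0) _ (divided_exists i f)).
Qed.

Lemma D_out i f : ~~ in_window l m i -> D i f = 0.
Proof. by rewrite D.unlock => /negbTE ->. Qed.

Lemma D_unique i f g : in_window l m i -> (X i - X (i + 1)) * g = f - sw i f -> D i f = g.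
Proof. by move=> hi e; apply: (mulfI (X_neq hi)); rewrite D_spec e. Qed.

Lemma swE i f : sw i f = f - (X i - X (i + 1)) * D i f.
Proof. by rewrite D_spec; ring. Qed.

Lemma D_add i f g : D i (f + g) = D i f + D i g.
Proof.
have [hi|hi] := boolP (in_window l m i); last by rewrite !D_out // addr0.
by apply: D_unique => //; rewrite mulrDr !D_spec sw_add; ring.
Qed.

Lemma D_mul i f g : D i (f * g) = D i f * g + sw i f * D i g.
Proof.
have [hi|hi] := boolP (in_window l m i); last by rewrite !D_out // mul0r mulr0 addr0.
by apply: D_unique => //; rewrite mulrDr mulrA mulrCA !D_spec sw_mul; ring.
Qed.

Lemma D_invariant i f : sw i f = f -> D i f = 0.
Proof.
move=> e; have [hi|hi] := boolP (in_window l m i); last by rewrite D_out.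
by apply: D_unique => //; rewrite e mulr0 subrr.
Qed.

Lemma D_mul_invariant i f g : sw i f = f -> D i (f * g) = f * D i g.
Proof. by move=> e; rewrite D_mul D_invariant // e mul0r add0r. Qed.

Lemma D_mulC_invariant i f g : D i g = 0 -> D i (f * g) = D i f * g.
Proof. by move=> e; rewrite D_mul e mulr0 addr0. Qed.

Lemma D_eq0_invariant i f : D i f = 0 -> sw i f = f.
Proof. by move=> e; rewrite swE e mulr0 subr0. Qed.

Lemma D0 i : D i 0 = 0.
Proof. by apply/D_invariant; exact: sw0. Qed.

Lemma swK i f : sw i (sw i f) = f.
Proof.
rewrite sw.unlock -msymMm /tp; case: ifP => _; first by rewrite tperm2 msym1m.
by rewrite mulg1 msym1m.
Qed.

Lemma sw_diff i : in_window l m i -> sw i (X i - X (i + 1)) = X (i + 1) - X i.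
Proof.
move=> hi; rewrite sw_sub; move: (hi); rewrite /in_window => hi'.
by rewrite !swX //; try lia; rewrite /simpleZ eqxx; ifs; try lia.
Qed.

Lemma sw_D i f : sw i (D i f) = D i f.
Proof.
have [hi|hi] := boolP (in_window l m i); last by rewrite sw_out.
have := congr1 (sw i) (D_spec i f); rewrite sw_mul sw_diff // sw_sub swK => e.
apply: (mulfI (X_neq hi)); rewrite D_spec -[RHS]opprB -e; ring.
Qed.

Lemma D_D i f : D i (D i f) = 0.
Proof. by rewrite D_invariant // sw_D. Qed.

Lemma sw_far i j f : 1 < `|i - j| -> sw i (sw j f) = sw j (sw i f).
Proof.
move=> h; have [hi|hi] := boolP (in_window l m i); last by rewrite !(sw_out _ hi).
have [hj|hj] := boolP (in_window l m j); last by rewrite !(sw_out _ hj).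
rewrite sw.unlock -!msymMm /tp hi hj; congr (msym _ _).
move: hi hj; rewrite /in_window => hi hj.
apply: perm_onC (tperm_on _ _) (tperm_on _ _) _.
rewrite disjoint_subset; apply/subsetP => k; rewrite !inE => /orP[] /eqP ->.
  by apply/negP => /orP[] /eqP /pos_inj; lia.
by apply/negP => /orP[] /eqP /pos_inj; lia.
Qed.

End DividedDifferences.

(** * Nil-Hecke relations, jets and order of vanishing *)

Section NilHecke.

Variables (m : nat) (l : int).

Notation R := {mpoly int[m.+1]}.
Notation X := (@X m l).
Notation D := (@D m l).
Notation sw := (@sw m l).

Implicit Types f g h : R.

Lemma D_sub i f g : D i (f - g) = D i f - D i g.
Proof.
have [hi|hi] := boolP (in_window l m i); last by rewrite !D_out // subr0.
by apply: D_unique => //; rewrite mulrBr !D_spec sw_sub; ring.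
Qed.

Lemma D_far i j f : 1 < `|i - j| -> D i (D j f) = D j (D i f).
Proof.
move=> far; have [hi|hi] := boolP (in_window l m i); last by rewrite !(D_out _ hi) D0.
have [hj|hj] := boolP (in_window l m j); last by rewrite !(D_out _ hj) D0.
(* With both denominators cleared the right-hand side is symmetric in i' and j', because the two
   swaps commute. *)
have formula i' j' : in_window l m i' -> in_window l m j' -> 1 < `|i' - j'| ->
    (X i' - X (i' + 1)) * (X j' - X (j' + 1)) * D i' (D j' f) =
    f - sw j' f - sw i' f + sw i' (sw j' f).
  move=> hi' hj' far'; have e1 := D_spec l i' (D j' f); have e2 := D_spec l j' f.
  have e3 := congr1 (sw i') e2.
  rewrite sw_mul !sw_sub !sw_inert in e3; move: (hi') (hj'); rewrite /in_window; try lia.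
  move=> _ _; rewrite -mulrA mulrCA e1 mulrBr e2 e3; ring.
apply: (mulfI (X_neq hi)); apply: (mulfI (X_neq hj)).
rewrite [RHS]mulrA formula // 1?distrC // mulrCA mulrA formula //.
rewrite (sw_far _ _ far).
move: (sw j (sw i f)) (sw i f) (sw j f) => x y z.
by rewrite -!addrA; congr (_ + _); rewrite addrCA.
Qed.

Lemma sw_adj i f : in_window l m i -> in_window l m (i + 1) ->
  sw i (sw (i + 1) (sw i f)) = sw (i + 1) (sw i (sw (i + 1) f)).
Proof.
move=> hi hj; rewrite sw.unlock -!msymMm /tp hi hj; congr (msym _ _).
have neq (d d' : int) : 0 <= d <= 2 -> 0 <= d' <= 2 -> d != d' ->
    pos m l (i + d) != pos m l (i + d').
  move=> h1 h2 h3; apply/eqP => /pos_inj; move: hi hj; rewrite /in_window; lia.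
have n01 := neq 0 1 isT isT isT; have n02 := neq 0 2 isT isT isT; have n12 := neq 1 2 isT isT isT.
rewrite addr0 in n01 n02; rewrite -!addrA (_ : 1 + 1 = 2 :> int) //.
set a := pos m l i in n01 n02 *; set b := pos m l (i + 1) in n01 n12 *; set c := pos m l (i + 2) in n02 n12 *.
have -> : (tperm a b * (tperm b c * tperm a b) = tperm a c)%g.
  by rewrite -{1}(tpermV a b) -/(conjg _ _) tpermJ tpermR tpermD.
have -> : (tperm b c * (tperm a b * tperm b c) = tperm a c)%g.
  by rewrite -{1}(tpermV b c) -/(conjg _ _) tpermJ tpermL tpermD // eq_sym.
by [].
Qed.

Lemma D_adj i f : D i (D (i + 1) (D i f)) = D (i + 1) (D i (D (i + 1) f)).
Proof.
have [hi|hi] := boolP (in_window l m i); last by rewrite !(D_out _ hi) !D0.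
have [hj|hj] := boolP (in_window l m (i + 1)); last by rewrite !(D_out _ hj) !D0.
pose a i := X i - X (i + 1).
(* With the denominators cleared there remains the alternating sum over the six elements of the
   group generated by the two swaps, which is symmetric in i' and j' by [sw_adj]. *)
have formula i' j' : in_window l m i' -> in_window l m j' ->
    sw i' (a j') = a i' + a j' -> sw j' (a i') = a i' + a j' ->
    a i' * a j' * (a i' + a j') * D i' (D j' (D i' f)) =
    f - sw i' f - sw j' f + sw j' (sw i' f) + sw i' (sw j' f) - sw i' (sw j' (sw i' f)).
  move=> hi' hj' ij ji.
  have e1 : a i' * D i' f = f - sw i' f := D_spec l i' f.
  have e2 : a j' * D j' (D i' f) = D i' f - sw j' (D i' f) := D_spec l j' (D i' f).
  have e3 : a i' * D i' (D j' (D i' f)) = D j' (D i' f) - sw i' (D j' (D i' f)).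
    exact: D_spec.
  have e4 := congr1 (sw i') e2; rewrite sw_mul sw_sub ij sw_D in e4.
  have e5 := congr1 (sw j') e1; rewrite sw_mul sw_sub ji in e5.
  have e6 := congr1 (sw i') e5; rewrite sw_mul !sw_sub sw_add ij /a sw_diff // -!/(a _) in e6.
  rewrite (_ : X (i' + 1) - X i' = - a i') in e6; last by rewrite /a; ring.
  rewrite addrA addNr add0r in e6.
  rewrite (_ : _ * _ * _ * _ = a j' * (a i' + a j') * (a i' * D i' (D j' (D i' f)))); last by ring.
  rewrite e3 mulrBr -[a j' * _ * sw _ _]mulrA e4.
  rewrite (_ : _ * _ * D _ _ = (a i' + a j') * (a j' * D j' (D i' f))); last by ring.
  rewrite e2 (_ : _ - _ = a i' * D i' f - (a i' + a j') * sw j' (D i' f)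
     + a j' * sw i' (sw j' (D i' f))); last by ring.
  by rewrite e1 e5 e6; ring.
have ij : sw i (a (i + 1)) = a i + a (i + 1).
  rewrite /a sw_sub !swX //; move: (hi) (hj); rewrite /in_window; try lia.
  rewrite /simpleZ; ifs; try lia; move=> _ _; ring.
have ji : sw (i + 1) (a i) = a i + a (i + 1).
  rewrite /a sw_sub !swX //; move: (hi) (hj); rewrite /in_window; try lia.
  rewrite /simpleZ; ifs; try lia; move=> _ _; ring.
have nz : a i + a (i + 1) != 0.
  rewrite -ij; apply/eqP => /(congr1 (sw i)); rewrite swK sw0.
  by apply/eqP; apply: X_neq.
apply: (mulfI (X_neq hi)); apply: (mulfI (X_neq hj)); apply: (mulfI nz).
have F1 := formula i (i + 1) hi hj ij ji.
have F2 := formula (i + 1) i hj hi _ _; rewrite ij ji addrC in F2.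
have {}F2 := F2 erefl erefl.
have e1 x : (a i + a (i + 1)) * ((X (i + 1) - X (i + 1 + 1)) * ((X i - X (i + 1)) * x)) =
    a i * a (i + 1) * (a i + a (i + 1)) * x by rewrite /a; ring.
have e2 x : (a i + a (i + 1)) * ((X (i + 1) - X (i + 1 + 1)) * ((X i - X (i + 1)) * x)) =
    a (i + 1) * a i * (a (i + 1) + a i) * x by rewrite /a; ring.
rewrite [LHS](_ : _ = (a i + a (i + 1)) * ((X (i + 1) - X (i + 1 + 1)) * ((X i - X (i + 1)) *
  D i (D (i + 1) (D i f))))); last by rewrite /a; ring.
rewrite e1 F1 [RHS](_ : _ = (a i + a (i + 1)) * ((X (i + 1) - X (i + 1 + 1)) * ((X i - X (i + 1)) *
  D (i + 1) (D i (D (i + 1) f))))); last by rewrite /a; ring.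
rewrite e2 F2 sw_adj //; ring.
Qed.

Definition Dw (a : seq int) f : R := foldr D f a.

Definition eps f : int := meval (fun=> 0) f.

(* By duality with the Schubert polynomials ([jet_schub]) the jets are the
   coefficients of the expansion modulo the coinvariant ideal. *)
Definition jet (a : seq int) f : int := eps (Dw a f).

Lemma Dw_cat a b f : Dw (a ++ b) f = Dw a (Dw b f).
Proof. exact: foldr_cat. Qed.

Lemma Dw_rcons a i f : Dw (rcons a i) f = Dw a (D i f).
Proof. by rewrite -cats1 Dw_cat. Qed.

Lemma Dw_braid a b f : braid_eq a b -> Dw a f = Dw b f.
Proof.
move=> h; apply: (@braid_foldr R (fun=> True) D) h _ I => //.
  by move=> i j x _; apply: D_far.
by move=> i x _; apply: D_adj.
Qed.

Lemma jet_braid a b f : braid_eq a b -> jet a f = jet b f.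
Proof. by move=> h; rewrite /jet (Dw_braid _ h). Qed.

Lemma Dw0 a : Dw a 0 = 0.
Proof. by elim: a => //= i a ->; rewrite D0. Qed.

Lemma Dw_add a f g : Dw a (f + g) = Dw a f + Dw a g.
Proof. by elim: a => //= i a ->; rewrite D_add. Qed.

Lemma Dw_sub a f g : Dw a (f - g) = Dw a f - Dw a g.
Proof. by elim: a => //= i a ->; rewrite D_sub. Qed.

Lemma Dw_squareful a f : squareful a -> Dw a f = 0.
Proof.
by move=> [x [i [y e]]]; rewrite (Dw_braid _ e) !Dw_cat /= D_D Dw0.
Qed.

Lemma jet0 a : jet a 0 = 0.
Proof. by rewrite /jet Dw0 /eps meval0. Qed.

Lemma jet_add a f g : jet a (f + g) = jet a f + jet a g.
Proof. by rewrite /jet Dw_add /eps mevalD. Qed.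

Lemma jet_sub a f g : jet a (f - g) = jet a f - jet a g.
Proof. by rewrite /jet Dw_sub /eps mevalB. Qed.

Lemma jet_mulz a f (c : int) : jet a (f *~ c) = jet a f * c.
Proof.
have jn n : jet a (f *+ n) = jet a f *+ n.
  by elim: n => [|n IH]; rewrite ?mulr0n ?jet0 // !mulrS jet_add IH.
rewrite -mulrzz; case: c => n; first by rewrite -!pmulrn jn.
by rewrite NegzE !mulrNz -!pmulrn -[- (f *+ _)]sub0r jet_sub jet0 sub0r jn.
Qed.

Lemma jet_cat a b f : jet (a ++ b) f = jet a (Dw b f).
Proof. by rewrite /jet Dw_cat. Qed.

Lemma jet_rcons a i f : jet (rcons a i) f = jet a (D i f).
Proof. by rewrite /jet Dw_rcons. Qed.

Lemma jet_squareful a f : squareful a -> jet a f = 0.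
Proof. by move=> h; rewrite /jet Dw_squareful // /eps meval0. Qed.

Lemma jet_sum a (I : Type) (r : seq I) (P : pred I) (F : I -> R) :
  jet a (\sum_(k <- r | P k) F k) = \sum_(k <- r | P k) jet a (F k).
Proof.
by elim/big_rec2: _ => [|k y x _ <-]; rewrite ?jet0 ?jet_add.
Qed.

Lemma eps_mul f g : eps (f * g) = eps f * eps g.
Proof. exact: mevalM. Qed.

Lemma eps_sw i f : eps (sw i f) = eps f.
Proof.
have [hi|hi] := boolP (in_window l m i); last by rewrite sw_out.
by rewrite swE /eps mevalB mevalM mevalB !mevalXU subrr mul0r subr0.
Qed.

(** By the Leibniz rule at the last letter i, h f is replaced by (D_i h) f and (s_i h)(D_i f), where
    D_i f again has no jets along words in L; hence the induction varies h and f. *)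
Lemma jet_ideal (L : pred int) f :
    (forall a, all L a -> jet a f = 0) ->
  forall h a, all L a -> jet a (h * f) = 0.
Proof.
move=> Kf h a; elim/last_ind: a h f Kf => [|a i IH] h f Kf.
  by move=> _; rewrite /jet /= eps_mul [X in _ * X](Kf [::]) // mulr0.
rewrite all_rcons => /andP[hi ha].
rewrite jet_rcons D_mul jet_add !IH ?addr0 // => b hb.
by rewrite -jet_rcons Kf // all_rcons hi.
Qed.

(** An order of vanishing measured by jets. By [jet_order_mul] it behaves like the filtration by
    powers of the ideal of polynomials without constant term. *)
Definition jet_order (L : pred int) (e : nat) f : Prop :=
  forall a, all L a -> (size a < e)%N -> jet a f = 0.

Lemma jet_order_D (L : pred int) e f i : L i -> jet_order L e f -> jet_order L e.-1 (D i f).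
Proof.
move=> hi Of b hb sb; rewrite -jet_rcons Of // ?all_rcons ?hi // size_rcons.
by case: e Of sb.
Qed.

Lemma jet_order_mull L e h f : jet_order L e f -> jet_order L e (h * f).
Proof.
move=> Of a; elim/last_ind: a e h f Of => [|a i IH] e h f Of.
  by move=> _ e0; rewrite /jet /= eps_mul [X in _ * X](Of [::]) // mulr0.
rewrite all_rcons size_rcons => /andP[hi ha] he.
rewrite jet_rcons D_mul jet_add (IH e) ?(ltnW he) // (IH e.-1) ?addr0 //; last lia.
exact: jet_order_D.
Qed.

(** In the Leibniz rule (D_i h) f keeps the order e of f while the word has lost a letter, and s_i h
    again has constant term zero in front of D_i f, of order e - 1. *)
Lemma jet_order_mul L e h f : eps h = 0 -> jet_order L e f -> jet_order L e.+1 (h * f).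
Proof.
move=> h0 Of a; elim/last_ind: a e h f h0 Of => [|a i IH] e h f h0 Of.
  by move=> _ e0; rewrite /jet /= eps_mul h0 mul0r.
rewrite all_rcons size_rcons ltnS => /andP[hi ha] he.
rewrite jet_rcons D_mul jet_add (jet_order_mull _ Of) // add0r.
by apply: (IH e.-1); rewrite ?eps_sw //; [exact: jet_order_D|lia].
Qed.

End NilHecke.

(** * Schubert polynomials *)

Lemma all_window_cut l m a k : all (in_window l m) a -> k < l \/ l + m%:Z <= k -> all (predC1 k) a.
Proof. by move=> h hk; apply: sub_all h => i; rewrite /in_window /=; lia. Qed.

Lemma window_perm l m a z : all (in_window l m) a ->
  (l <= word_perm a z <= l + m%:Z) = (l <= z <= l + m%:Z).
Proof.
move=> h; have c1 : all (predC1 (l - 1)) a by apply: all_window_cut h _; lia.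
have c2 : all (predC1 (l + m%:Z)) a by apply: all_window_cut h _; lia.
by have := word_perm_cut z c1; have := word_perm_cut z c2; lia.
Qed.

(** A reduced word of the longest permutation of the k + 1 points l, ..., l + k. *)
Fixpoint om (l : int) (k : nat) : seq int := if k is k'.+1 then om l k' ++ dn l k else [::].

Lemma word_perm_om l k z :
  word_perm (om l k) z = if l <= z <= l + k%:Z then l + l + k%:Z - z else z.
Proof.
elim: k z => [|k IH] z; first by rewrite /=; ifs; lia.
rewrite (_ : om l k.+1 = om l k ++ dn l k.+1) // word_perm_cat.
rewrite -[LHS]/(word_perm (om l k) (word_perm (dn l k.+1) z)) IH word_perm_dn.
by case: eqP => [->|h]; ifs; lia.
Qed.

Lemma om_window l k : all (in_window l k) (om l k).
Proof.
elim: k => //= k IH; rewrite all_cat; apply/andP; split.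
  by apply: sub_all IH => i; rewrite /in_window; lia.
rewrite -/(dn l k.+1); apply/allP => i; rewrite mem_dn /in_window; lia.
Qed.

Lemma om_divr l k i : in_window l k i -> exists x, braid_eq (om l k) (rcons x i).
Proof.
elim: k i => [|k IH] i; rewrite /in_window; first by lia.
move=> hi; have [->|ne] := eqVneq i l.
  exists (om l k ++ dn (l + 1) k); rewrite -[om l k.+1]/(om l k ++ dn l k.+1) dnSr rcons_cat.
  exact: braid_refl.
have [|x ex] := IH (i - 1); first by rewrite /in_window; lia.
exists (x ++ dn l k.+1); rewrite -[om l k.+1]/(om l k ++ dn l k.+1) rcons_cat.
apply: braid_trans (braid_catr _ ex) _; rewrite cat_rcons; apply: braid_catl.
by apply: dn_shift; lia.
Qed.

Lemma nf_om l k : nf l k (om l k).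
Proof. by elim: k => // k IH; exists (om l k), k.+1; rewrite addrK. Qed.

Lemma size_omS l k : size (om l k.+1) = (size (om l k) + k.+1)%N.
Proof. by rewrite size_cat size_dn. Qed.

Lemma size_om_shift l l' k : size (om l k) = size (om l' k).
Proof. by elim: k => // k IH; rewrite !size_omS IH. Qed.

(** Every digit of the Lehmer code is bounded by its place, and the longest permutation is the one
    whose digits are all maximal. *)
Lemma nf_size l m a : nf l m a ->
  (size a <= size (om l m))%N /\ (size a = size (om l m) -> a = om l m).
Proof.
elim: m a => [|m IH] a; first by move=> ->.
move=> [a1 [k [/IH [h1 h2] hk ->]]]; rewrite size_omS size_cat size_dn; split; first lia.
move=> e; rewrite h2; last lia.
rewrite -[om l m.+1]/(om l m ++ dn l m.+1).
have -> : k = m.+1 by lia.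
by rewrite addrK.
Qed.

Section SchubertPolynomials.

Variables (m : nat) (l : int).

Notation R := {mpoly int[m.+1]}.
Notation X := (@X m l).
Notation D := (@D m l).
Notation sw := (@sw m l).
Notation Dw := (@Dw m l).
Notation w0Z := (word_perm (om l m)).

Fixpoint staircase (b : int) (k : nat) : R :=
  if k is k'.+1 then X b ^+ k * staircase (b + 1) k' else 1.

Lemma Dw_mul_invariant a (f g : R) : (forall i, i \in a -> sw i f = f) ->
  Dw a (f * g) = f * Dw a g.
Proof.
elim: a => //= i a IH h; rewrite IH; last by move=> j ja; apply: h; rewrite inE ja orbT.
by rewrite D_mul_invariant // h // inE eqxx.
Qed.

Lemma sw_expX i z k : in_window l m i -> l <= z <= l + m%:Z -> z != i -> z != i + 1 ->
  sw i (X z ^+ k) = X z ^+ k.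
Proof.
by move=> *; rewrite sw_exp sw_inert.
Qed.

Lemma sw_staircase i b k : in_window l m i -> l <= b -> b + k%:Z <= l + m%:Z + 1 -> i + 1 < b ->
  sw i (staircase b k) = staircase b k.
Proof.
move=> hi; elim: k b => [|k IH] b h1 h2 h3 /=; first by rewrite sw1.
by rewrite sw_mul sw_expX ?IH; try lia.
Qed.

Lemma DX i : in_window l m i -> D i (X i) = 1.
Proof.
move=> hi; apply: D_unique => //; rewrite mulr1 swX //; first by rewrite /simpleZ eqxx.
by move: hi; rewrite /in_window; lia.
Qed.

(** The staircase is x_b times (x_b x_(b+1))^k times later variables, and all but the factor x_b are
    invariant under s_b. *)
Lemma D_staircase b k : l <= b -> b + k.+1%:Z <= l + m%:Z ->
  D b (staircase b k.+1) = X b ^+ k * staircase (b + 1) k.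
Proof.
move=> h1 h2; have hb : in_window l m b by rewrite /in_window; lia.
rewrite /= exprS -mulrA D_mulC_invariant ?DX ?mul1r //.
apply: D_invariant; case: k h2 => [|k] h2; first by rewrite /= expr0 mulr1 sw1.
rewrite /= mulrA -exprMn sw_mul sw_staircase; try lia.
congr (_ * _); rewrite sw_exp sw_mul !swX //; try lia.
rewrite /simpleZ eqxx; ifs; try lia; by rewrite mulrC.
Qed.

Lemma Dw_dn_staircase b k : l <= b -> b + k%:Z <= l + m%:Z ->
  Dw (dn b k) (staircase b k) = staircase b k.-1.
Proof.
elim: k b => // k IH b h1 h2.
rewrite dnSr Dw_rcons D_staircase // Dw_mul_invariant.
  by rewrite IH; try lia; case: k {IH h2} => [|k] //=; rewrite expr0 mulr1.
by move=> i; rewrite mem_dn => hi; rewrite sw_expX // /in_window; lia.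
Qed.

Lemma Dw_om_staircase b k : l <= b -> b + k%:Z <= l + m%:Z -> Dw (om b k) (staircase b k) = 1.
Proof.
elim: k => // k IH h1 h2.
rewrite -[om b k.+1]/(om b k ++ dn b k.+1) Dw_cat Dw_dn_staircase // IH //; lia.
Qed.

Lemma eps_X z : eps (X z) = 0.
Proof. exact: mevalXU. Qed.

Lemma staircase_order L b k : jet_order l L (size (om b k)) (staircase b k).
Proof.
elim: k b => [|k IH] b //.
rewrite size_omS (size_om_shift b (b + 1)) addnC /=.
elim: (k.+1) => [|e' IH']; first by rewrite expr0 mul1r; apply: IH.
by rewrite exprS -mulrA addSn; apply: jet_order_mul => //; apply: eps_X.
Qed.

Definition in_group (f : int -> int) : Prop :=
  exists2 a, all (in_window l m) a & f = word_perm a.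

Lemma in_group_id : in_group id.
Proof. by exists [::]. Qed.

Lemma in_group_simple f i : in_group f -> in_window l m i -> in_group (f \o simpleZ i).
Proof.
move=> [a wa ->] hi; exists (rcons a i); first by rewrite all_rcons hi.
by rewrite word_perm_rcons.
Qed.

Lemma in_group_inj f : in_group f -> injective f.
Proof. by move=> [a _ ->]; apply: word_perm_inj. Qed.

Lemma in_group_window f z : in_group f -> (l <= f z <= l + m%:Z) = (l <= z <= l + m%:Z).
Proof. by move=> [a wa ->]; apply: window_perm. Qed.

Lemma in_group_fix f z : in_group f -> ~~ (l <= z <= l + m%:Z) -> f z = z.
Proof.
move=> [a wa ->]; rewrite negb_and -!ltNge => hz; have [h|h] := boolP (z < l).
  by apply: (word_perm_small (l := l)) => //; apply: sub_all wa => i; rewrite /in_window /=; lia.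
apply: (word_perm_large (r := l + m%:Z)); last by move: hz; rewrite (negbTE h).
by apply: sub_all wa => i; rewrite /in_window /=; lia.
Qed.

(** Here f = w_0 c^-1, so the letters of c lead from the staircase, the polynomial of w_0, down to
    that of f. *)
Definition complement_word f (c : seq int) : Prop := nf l m c /\ f \o word_perm c = w0Z.

Definition schub (f : int -> int) : R :=
  Dw (epsilon (inhabits [::]) (complement_word f)) (staircase l m).

Lemma complement_exists f : in_group f -> exists c, complement_word f c.
Proof.
move=> [a wa ->].
have [|c nc ec] := @nf_exists l m (rev a ++ om l m).
  by rewrite all_cat all_rev wa om_window.
exists c; split => //; rewrite ec word_perm_cat.
by apply: functional_extensionality => z /=; rewrite word_permVK.
Qed.

Lemma schubE f c : in_group f -> reduced c -> f \o word_perm c = w0Z ->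
  schub f = Dw c (staircase l m).
Proof.
move=> gf rc ec; have [nc0 ec0] := epsilon_spec (inhabits [::]) _ (complement_exists gf).
apply: Dw_braid; apply: matsumoto => //; first exact: nf_reduced nc0.
apply: functional_extensionality => z; apply: (in_group_inj gf).
by rewrite -[LHS]/((f \o _) z) ec0 -ec.
Qed.

Lemma w0ZK : involutive w0Z.
Proof. by move=> z; rewrite !word_perm_om; ifs; lia. Qed.

Lemma schub_descent f i : in_group f -> in_window l m i -> f (i + 1) < f i ->
  D i (schub f) = schub (f \o simpleZ i).
Proof.
move=> gf hi lt; have [c [nc ec]] := complement_exists gf.
have rc := nf_reduced nc.
rewrite (schubE gf rc ec) (schubE (c := i :: c)) //; first exact: in_group_simple.
  rewrite -[i :: c]revK rev_cons; apply/reduced_rev/reduced_rcons; first exact: reduced_rev.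
  have E z : word_perm (rev c) z = w0Z (f z).
    rewrite -{2}(word_permVK c z) -[f _]/((f \o word_perm c) _) ec w0ZK //.
  move: hi; rewrite /in_window => hi.
  have h1 : l <= f i <= l + m%:Z by rewrite in_group_window //; lia.
  have h2 : l <= f (i + 1) <= l + m%:Z by rewrite in_group_window //; lia.
  by rewrite !E !word_perm_om h1 h2; lia.
by rewrite -ec; apply: functional_extensionality => z /=; rewrite simpleZK.
Qed.

Lemma schub_ascent f i : in_group f -> in_window l m i -> f i < f (i + 1) -> D i (schub f) = 0.
Proof.
move=> gf hi lt; have gf' := in_group_simple gf hi.
have -> : f = (f \o simpleZ i) \o simpleZ i.
  by apply: functional_extensionality => z /=; rewrite simpleZK.
by rewrite -schub_descent ?D_D //= simpleZl simpleZr.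
Qed.

Lemma schub_w0 : schub w0Z = staircase l m.
Proof.
by rewrite (schubE (c := [::])) //; exists (om l m) => //; apply: om_window.
Qed.

Lemma schub_id : schub id = 1.
Proof.
rewrite (schubE (c := om l m)) //; [|exact: in_group_id|exact: nf_reduced (nf_om l m)].
exact: Dw_om_staircase.
Qed.

(** For f other than the identity the complement word is shorter than the longest word, whose length
    is the order of vanishing of the staircase. *)
Lemma eps_schub f : in_group f -> f <> id -> eps (schub f) = 0.
Proof.
move=> gf nf1; have [c [nc ec]] := complement_exists gf.
rewrite (schubE gf (nf_reduced nc) ec); apply: (staircase_order (L := predT)).
  exact: all_predT.
have [h1 h2] := nf_size nc.
rewrite ltn_neqAle h1 andbT; apply/eqP => /h2 e.
apply: nf1; apply: functional_extensionality => z /=.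
by rewrite -{1}(w0ZK z) -[f _]/((f \o w0Z) _) -e ec e w0ZK.
Qed.

End SchubertPolynomials.

(** * The coinvariant ideal *)

HB.instance Definition _ (m : nat) l i :=
  GRing.isZmodMorphism.Build {mpoly int[m.+1]} {mpoly int[m.+1]} (@D m l i) (@D_sub m l i).

HB.instance Definition _ (m : nat) l i :=
  GRing.isZmodMorphism.Build {mpoly int[m.+1]} {mpoly int[m.+1]} (@sw m l i) (@sw_sub m l i).

HB.instance Definition _ (m : nat) l i :=
  GRing.isMonoidMorphism.Build {mpoly int[m.+1]} {mpoly int[m.+1]} (@sw m l i)
    (conj (@sw1 m l i) (@sw_mul m l i)).

Lemma pos_ord (m : nat) l (k : 'I_m.+1) : pos m l (l + k%:Z) = k.
Proof.
by apply/val_inj; rewrite /pos /= inordK; have := ltn_ord k; rewrite addrAC subrr add0r.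
Qed.

Lemma adjacent_perm_ind (m : nat) l (P : 'S_m.+1 -> Prop) : P 1%g ->
    (forall s t, P s -> P t -> P (s * t)%g) ->
    (forall i, in_window l m i -> P (tperm (pos m l i) (pos m l (i + 1)))) ->
  forall s, P s.
Proof.
move=> H1 HM Hadj.
have H0 (d : nat) : (d <= m)%N -> P (tperm (pos m l l) (pos m l (l + d%:Z))).
  elim: d => [|d IH] hd; first by rewrite addr0 tperm1.
  have [->|d0] := posnP d; first by apply: Hadj; rewrite /in_window; lia.
  have hw : in_window l m (l + d%:Z) by rewrite /in_window; lia.
  have := HM _ _ (Hadj _ hw) (HM _ _ (IH (ltnW hd)) (Hadj _ hw)).
  rewrite -{1}tpermV -/(conjg _ _) tpermJ tpermL tpermD; try by apply/eqP => /pos_inj; lia.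
  by rewrite -addrA (_ : d%:Z + 1 = d.+1%:Z) //; lia.
have Hk (k : 'I_m.+1) : P (tperm (pos m l l) k).
  by rewrite -(pos_ord l k); apply: H0; have := ltn_ord k; rewrite ltnS.
move=> s; have [ts -> _] := prod_tpermP s.
elim/big_ind: _ => // -[y z] _ /=.
have [<-|Nyz] := eqVneq y z; first by rewrite tperm1.
have [->|Nxz] := eqVneq z (pos m l l); first by rewrite tpermC.
rewrite eq_sym in Nxz.
by rewrite -(tpermJ_tperm Nxz Nyz) /conjg tpermV; apply: (HM) => //; apply: (HM).
Qed.

Section Coinvariants.

Variables (m : nat) (l : int).

Notation R := {mpoly int[m.+1]}.
Notation X := (@X m l).
Notation D := (@D m l).
Notation sw := (@sw m l).
Notation Dw := (@Dw m l).
Notation jet := (@jet m l).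

Lemma adjacent_symmetric (f : R) : (forall i, in_window l m i -> sw i f = f) -> f \is symmetric.
Proof.
move=> h; apply/issymP; apply: (adjacent_perm_ind (l := l)) => [|s t es et|i hi].
- exact: msym1m.
- by rewrite msymMm es.
by have := h i hi; rewrite sw.unlock /tp hi.
Qed.

Lemma coinvariant_mulDr (a f g : R) :
  coinvariant_ideal f -> coinvariant_ideal g -> coinvariant_ideal (a * f + g).
Proof. by have [_ _ h] := coinvariant_ideal_closed m.+1; apply: h. Qed.

Lemma coinvariant0 : coinvariant_ideal (0 : R).
Proof. by have [h _ _] := coinvariant_ideal_closed m.+1. Qed.

(** By the fundamental theorem f is a polynomial in the elementary symmetric ones. The polynomials
    that become constant modulo the ideal under this substitution form a ring containing the
    variables; the constant is found by evaluation at 0. *)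
Lemma symmetric_coinvariant (f : R) : f \is symmetric -> coinvariant_ideal (f - (eps f)%:MP).
Proof.
move=> /sym_fundamental [t [<- _]].
set S := [tuple mesym _ _ _ | i < _].
pose Q (t : R) := exists c : int, coinvariant_ideal (t \mPo S - c%:MP).
have QC c : Q c%:MP by exists c; rewrite comp_mpolyC subrr coinvariant0.
have QD t1 t2 : Q t1 -> Q t2 -> Q (t1 + t2).
  move=> [c1 h1] [c2 h2]; exists (c1 + c2).
  have := coinvariant_mulDr 1 h1 h2; congr coinvariant_ideal.
  rewrite comp_mpolyD mpolyCD mul1r; move: (_ \mPo _) (_ \mPo _) c1%:MP c2%:MP => a b c d.
  by rewrite opprD addrACA.
have QM t1 t2 : Q t1 -> Q t2 -> Q (t1 * t2).
  move=> [c1 h1] [c2 h2]; exists (c1 * c2).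
  have := coinvariant_mulDr (t2 \mPo S) h1 (coinvariant_mulDr c1%:MP h2 coinvariant0).
  congr coinvariant_ideal.
  have -> : (t1 * t2) \mPo S = (t1 \mPo S) * (t2 \mPo S) by exact: rmorphM.
  rewrite mpolyCM addr0.
  move: (_ \mPo _) (_ \mPo _) c1%:MP c2%:MP => a b c d.
  ring.
have {QC QD QM} [c hc] : Q t.
  elim/mpolyind: t => [|c k p _ _ Qp]; first by rewrite -mpolyC0; exact: (QC 0).
  apply: (QD _ _ _ Qp); rewrite -mul_mpolyC; apply: (QM _ _ (QC c)).
  rewrite mpolyXE_id; apply: (big_ind Q _ QM) => [|k' _]; first by rewrite -mpolyC1; exact: (QC 1).
  elim: (k k') => [|e IH]; first by rewrite expr0 -mpolyC1; exact: (QC 1).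
  rewrite exprS; apply: (QM _ _ _ IH); exists 0; rewrite mpolyC0 subr0 comp_mpolyXU -tnth_nth tnth_mktuple.
  apply/asboolP; exists (fun d => (d == k')%:R).
  rewrite (bigD1 k') //= eqxx mul1r big1 ?addr0 // => d /negbTE ned.
  by rewrite /= ned mul0r.
suff -> : eps (t \mPo S) = c by [].
move: hc => /asboolP[h e].
have : eps (t \mPo S - c%:MP) = 0.
  rewrite e /eps raddf_sum /= big1 // => i _.
  rewrite mevalM mesymE [X in _ * X]raddf_sum /= big1 ?mulr0 // => s /eqP cs.
  have [d ds] : exists d, d \in s by apply/set0Pn; rewrite -card_gt0 cs.
  by rewrite mevalX (bigD1 d) //= mnmE ds mul0r.
by rewrite /eps mevalB mevalC => /eqP; rewrite subr_eq0 => /eqP.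
Qed.

(** The product of the factors x - T over the first k variables x; the sign is chosen so that D_i of
    x_i - T is 1. *)
Fixpoint linear_factors (k : nat) : {poly R} :=
  if k is k'.+1 then linear_factors k' * ((X (l + k'%:Z))%:P - 'X) else 1.

Lemma map_swM i (p q : {poly R}) :
  map_poly (sw i) (p * q) = map_poly (sw i) p * map_poly (sw i) q.
Proof. exact: rmorphM. Qed.

Lemma map_sw_linear i (c : R) : map_poly (sw i) (c%:P - 'X) = (sw i c)%:P - 'X.
Proof. by rewrite raddfB /= map_polyC map_polyX. Qed.

Lemma linear_factors_inert i k : in_window l m i -> l + k%:Z <= i ->
  map_poly (sw i) (linear_factors k) = linear_factors k.
Proof.
move=> hi; have := hi; rewrite /in_window => hi'.
elim: k => [|k IH] hk; first exact: rmorph1.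
rewrite -[linear_factors k.+1]/(linear_factors k * _) map_swM map_sw_linear.
by rewrite sw_inert ?IH //; lia.
Qed.

Lemma linear_factors_sym i k : in_window l m i -> (k <= m.+1)%N -> i + 1 < l + k%:Z ->
  map_poly (sw i) (linear_factors k) = linear_factors k.
Proof.
move=> hi; have := hi; rewrite /in_window => hi'.
elim: k => [|k IH] hk hik; first by lia.
rewrite -[linear_factors k.+1]/(linear_factors k * _) map_swM map_sw_linear.
have [h|h] := ltP (i + 1) (l + k%:Z).
  by rewrite sw_inert ?IH //; lia.
case: k IH hk hik h => [|k] IH hk hik h; first lia.
rewrite -[linear_factors k.+1]/(linear_factors k * _) map_swM map_sw_linear.
have -> : l + k%:Z = i by lia.
have -> : l + k.+1%:Z = i + 1 by lia.
have -> : map_poly (sw i) (linear_factors k) = linear_factors k.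
  by apply: linear_factors_inert => //; lia.
have -> : sw i (X i) = X (i + 1) by rewrite swX ?simpleZl //; lia.
have -> : sw i (X (i + 1)) = X i by rewrite swX ?simpleZr //; lia.
exact: mulrAC.
Qed.

Lemma D_horner i (p : {poly R}) (c : R) : sw i c = c -> D i p.[c] = (map_poly (D i) p).[c].
Proof.
move=> hc; rewrite horner_coef raddf_sum /=.
rewrite (@horner_coef_wide _ (size p)) ?size_poly //.
apply: eq_bigr => k _; rewrite coef_map /= mulrC D_mul_invariant 1?mulrC //.
by elim: (k : nat) => [|e IH]; rewrite ?expr0 ?sw1 // exprS sw_mul hc IH.
Qed.

(** On coefficients, D_i (p (x_i - T)) = p + (x_(i+1) - T) D_i p, and the second term vanishes at T
    = x_(i+1). *)
Lemma D_linear_factor i (p : {poly R}) : in_window l m i ->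
  (map_poly (D i) (p * ((X i)%:P - 'X))).[X (i + 1)] = p.[X (i + 1)].
Proof.
move=> hi; have -> : map_poly (D i) (p * ((X i)%:P - 'X)) =
    p + (X (i + 1))%:P * map_poly (D i) p - 'X * map_poly (D i) p.
  apply/polyP => k; rewrite coef_map /= mulrBr coefB !coefB coefD mulrC coefCM.
  rewrite commr_polyX !coefXM coefCM coef_map /=.
  rewrite D_sub D_mul DX // mul1r swX //; last by move: hi; rewrite /in_window; lia.
  rewrite simpleZl; case: k => [|k] /=; first by rewrite D0.
  by rewrite coef_map.
by rewrite hornerD hornerN hornerD !hornerM hornerC hornerX -addrA subrr addr0.
Qed.

Lemma Dw_linear_factors k (c : R) : (k <= m)%N -> (forall i, l <= i < l + k%:Z -> sw i c = c) ->
  Dw (up l k) (linear_factors k).[c] = 1.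
Proof.
elim: k => [|k IH] hk hc; first by rewrite /= hornerC.
have hw : in_window l m (l + k%:Z) by rewrite /in_window; lia.
rewrite upSr Dw_rcons /= hornerM hornerD hornerC hornerN hornerX.
rewrite D_mul_invariant.
  rewrite D_sub DX // (D_invariant (hc _ _)) ?subr0 ?mulr1; last lia.
  by apply: IH => [|i hi]; [exact: ltnW|apply: hc; lia].
have e : sw (l + k%:Z) c = c by apply: hc; lia.
rewrite !horner_coef raddf_sum /=; apply: eq_bigr => d _.
by rewrite rmorphM rmorphXn /= e -coef_map /= linear_factors_inert.
Qed.

Definition partially_symmetric (k : nat) (f : R) : Prop :=
  forall i, l <= i < l + k%:Z -> sw i f = f.

(* Interpolation at the next variable: the new coefficients are symmetric in one
   variable more, so that iterating ends with symmetric polynomials. *)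
Lemma symmetric_expansion k (f : R) : (k < m)%N -> partially_symmetric k f ->
  f = \sum_(d < size (linear_factors k.+1))
        Dw (up l k.+1) (f * (linear_factors k.+1)`_d) * X (l + k.+1%:Z) ^+ d.
Proof.
move=> hk sf; set w := X _; set P := linear_factors k.+1.
have evD a (p : {poly R}) : (forall i, i \in a -> sw i w = w) ->
    Dw a p.[w] = (foldr (fun i => map_poly (D i)) p a).[w].
  elim: a p => //= i a IH p h; rewrite IH; last by move=> j ja; apply: h; rewrite inE ja orbT.
  by rewrite D_horner // h // inE eqxx.
have coefD a (p : {poly R}) d : (foldr (fun i => map_poly (D i)) p a)`_d = Dw a p`_d.
  by elim: a => //= i a <-; rewrite coef_map.
have sizeD a (p : {poly R}) : (size (foldr (fun i => map_poly (D i)) p a) <= size p)%N.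
  by elim: a => //= i a IH; apply: leq_trans (size_poly _ _) IH.
have hw : in_window l m (l + k%:Z) by rewrite /in_window; lia.
have hin i : l <= i < l + k%:Z -> sw i w = w.
  by move=> hi; apply: sw_inert; rewrite ?/in_window; lia.
(* The first operator to act, at the letter l + k, does not fix w and must act on coefficients
   before T = w is substituted; the other letters of the run fix w. *)
have : (foldr (fun i => map_poly (D i)) (f%:P * P) (up l k.+1)).[w] = f.
  rewrite upSr -cats1 foldr_cat /= -evD; last by move=> i; rewrite mem_up => /hin.
  rewrite mulrA (_ : w = X (l + k%:Z + 1)); last by rewrite /w; congr (X _); lia.
  rewrite D_linear_factor // (_ : X (l + k%:Z + 1) = w); last by rewrite /w; congr (X _); lia.
  rewrite hornerM hornerC Dw_mul_invariant; last by move=> i; rewrite mem_up; apply: sf.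
  by rewrite Dw_linear_factors ?mulr1 //; exact: ltnW.
rewrite (@horner_coef_wide _ (size P)).
  by move=> {1}<-; apply: eq_bigr => d _; rewrite coefD coefCM.
apply: leq_trans (sizeD _ _) _; rewrite mul_polyC; exact: size_scale_leq.
Qed.

Lemma up_shift i (b : int) k : b < i < b + k%:Z ->
  braid_eq (i :: up b k) (rcons (up b k) (i - 1)).
Proof.
move=> /dn_shift /braid_rev; rewrite rev_rcons rev_cons rev_dn.
exact: braid_sym.
Qed.

(** A letter i above l slides through the run, becomes i - 1 and kills f; for i = l the run itself
    begins with l and D_l D_l = 0. *)
Lemma Dw_up_symmetric k (f : R) : (k < m)%N -> partially_symmetric k f ->
  partially_symmetric k.+1 (Dw (up l k.+1) f).
Proof.
move=> hk sf i hi; apply: D_eq0_invariant; have [->|ne] := eqVneq i l.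
  rewrite (_ : up l k.+1 = l :: up (l + 1) k) /= ?D_D //.
  by rewrite -!rev_dn dnSr rev_rcons.
rewrite -[D i _]/(Dw (i :: up l k.+1) f) (Dw_braid _ _ (@up_shift i l k.+1 _)); last by lia.
by rewrite Dw_rcons (D_invariant (sf _ _)) ?Dw0 //; lia.
Qed.

(** Induction on the number of variables in which f is not yet symmetric: the coefficients of
    [symmetric_expansion] have no jets either, since they are images under a run of multiples of f.
    A symmetric polynomial without constant term lies in the ideal. *)
Lemma jet_coinvariant (f : R) : (forall a, all (in_window l m) a -> jet a f = 0) ->
  coinvariant_ideal f.
Proof.
have H d (k : nat) (g : R) : (k + d = m)%N -> partially_symmetric k g ->
    (forall a, all (in_window l m) a -> jet a g = 0) -> coinvariant_ideal g.
  elim: d k g => [|d IH] k g hk sg Kg.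
    have g0 : eps g = 0 by exact: (Kg [::]).
    have := @symmetric_coinvariant g; rewrite g0 mpolyC0 subr0; apply.
    by apply: adjacent_symmetric => i hi; apply: sg; move: hi; rewrite /in_window; lia.
  have km : (k < m)%N by lia.
  rewrite (symmetric_expansion km sg).
  apply: (big_ind (fun g : R => coinvariant_ideal g)); first exact: coinvariant0.
    by move=> g1 g2 h1 h2; have := coinvariant_mulDr 1 h1 h2; rewrite mul1r.
  move=> e _; rewrite mulrC -[_ * _]addr0; apply: coinvariant_mulDr; last exact: coinvariant0.
  apply: (IH k.+1); first by lia.
    apply: Dw_up_symmetric => // i hi; rewrite sw_mul sg //; congr (_ * _).
    rewrite -[LHS](@coef_map _ _ (sw i) (linear_factors k.+1) e).
    suff -> : map_poly (sw i) (linear_factors k.+1) = linear_factors k.+1 by [].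
    by apply: linear_factors_sym; rewrite ?/in_window; lia.
  move=> a wa; rewrite -jet_cat mulrC; apply: (jet_ideal (L := in_window l m)) => //.
  rewrite all_cat wa; apply/allP => i; rewrite mem_up /in_window; lia.
by move=> Kf; apply: (H m 0%N) => // i; lia.
Qed.

End Coinvariants.

(** * The 0-Hecke action on clans *)

Definition theta (g : preclan) z : int := if g z is Mate b then b else z.

Definition conj_entry i (x : clan_entry) : clan_entry :=
  if x is Mate b then Mate (simpleZ i b) else x.

Definition conj_clan i (g : preclan) : preclan := fun z => conj_entry i (g (simpleZ i z)).

Definition opposite_signs (g : preclan) z z' : bool :=
  match g z, g z' with Sign s, Sign t => s != t | _, _ => false end.

(** In a matching the excluded case is that of two adjacent signs, where T_i makes an arc or does
    nothing. *)
Definition rising (g : preclan) i : bool :=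
  (theta g i < theta g (i + 1)) && ~~ ((theta g i == i) && (theta g (i + 1) == i + 1)).

Lemma theta_conj i g z : theta (conj_clan i g) z = simpleZ i (theta g (simpleZ i z)).
Proof. by rewrite /theta /conj_clan; case: (g _) => //= _; rewrite simpleZK. Qed.

Lemma matching_theta g : matching g -> involutive (theta g).
Proof.
move=> mg z; rewrite /theta; case e : (g z) => [s|b]; first by rewrite e.
by have [_ ->] := mg _ _ e.
Qed.

Lemma theta_sign g z s : g z = Sign s -> theta g z = z.
Proof. by rewrite /theta => ->. Qed.

Lemma theta_mate g z b : g z = Mate b -> theta g z = b.
Proof. by rewrite /theta => ->. Qed.

Lemma conj_link i g a b :
  conj_clan i (link g a b) = link (conj_clan i g) (simpleZ i a) (simpleZ i b).
Proof.
have E z c : (simpleZ i z == c) = (z == simpleZ i c).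
  by apply/eqP/eqP => [<-|->]; rewrite simpleZK.
apply: functional_extensionality => z; rewrite /conj_clan /link /put !E.
by case: ifP => //= _; case: ifP.
Qed.

Lemma theta_link g a b z :
  theta (link g a b) z = if z == b then a else if z == a then b else theta g z.
Proof. by rewrite /theta /link /put; case: ifP => // _; case: ifP. Qed.

(* Regarding a clan as the involution [theta] labelled on its fixed points, T_i
   either creates an arc or conjugates by s_i. *)
Lemma hecke_genE i g : matching g -> hecke_gen i g =
  if opposite_signs g i (i + 1) then link g i (i + 1)
  else if rising g i then conj_clan i g else g.
Proof.
move=> mg; rewrite /opposite_signs /rising /hecke_gen /theta.
have other z c : g z = Mate c -> c <> i -> c <> i + 1 -> conj_entry i (g z) = g z.
  by move=> -> h1 h2 /=; congr Mate; sz i c; lia.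
have conjE z : z <> i -> z <> i + 1 -> conj_clan i g z = conj_entry i (g z).
  by move=> h1 h2; rewrite /conj_clan; congr (conj_entry _ (g _)); sz i z; lia.
have conjl : conj_clan i g i = conj_entry i (g (i + 1)) by rewrite /conj_clan simpleZl.
have conjr : conj_clan i g (i + 1) = conj_entry i (g i) by rewrite /conj_clan simpleZr.
have eqf (b : bool) (x y z : preclan) : x = y -> (if b then x else z) = (if b then y else z).
  by move=> ->.
case ei : (g i) => [s|a]; case ej : (g (i + 1)) => [t|b].
- by rewrite eqxx eqxx andbF; case: ifP.
- have [_ eb] := mg _ _ ej.
  have bi : b <> i by move=> e; rewrite e ei in eb.
  have bj : b <> i + 1 by case: (mg _ _ ej).
  rewrite (_ : _ && _ = (i + 1 < b)); last by lia.
  apply: eqf; apply: functional_extensionality => z.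
  rewrite /link /put; case: eqP => [->|zb].
    by rewrite conjE // eb /=; congr Mate; rewrite simpleZr.
  case: eqP => [->|zi]; first by rewrite conjl ej /=; congr Mate; sz i b; lia.
  case: eqP => [->|zj]; first by rewrite conjr ei.
  rewrite conjE //; case ez : (g z) => [r|c] //; rewrite -ez.
  have [_ ec] := mg _ _ ez.
  by rewrite (other _ _ ez) // => e; rewrite e ?ei ?ej in ec => //; case: ec => /esym.
- have [_ ea] := mg _ _ ei.
  have ai : a <> i by case: (mg _ _ ei).
  have aj : a <> i + 1 by move=> e; rewrite e ej in ea.
  rewrite (_ : _ && _ = (a < i)); last by lia.
  apply: eqf; apply: functional_extensionality => z.
  rewrite /link /put; case: eqP => [->|za].
    by rewrite conjE // ea /=; congr Mate; rewrite simpleZl.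
  case: eqP => [->|zj]; first by rewrite conjr ei /=; congr Mate; sz i a; lia.
  case: eqP => [->|zi]; first by rewrite conjl ej.
  rewrite conjE //; case ez : (g z) => [r|c] //; rewrite -ez.
  have [_ ec] := mg _ _ ez.
  by rewrite (other _ _ ez) // => e; rewrite e ?ei ?ej in ec => //; case: ec => /esym.
- have [ai ea] := mg _ _ ei; have [bj eb] := mg _ _ ej.
  have ab : a <> b by move=> e; rewrite e eb in ea; case: ea; lia.
  have [aj|aj] := eqVneq a (i + 1).
    have bi : b = i by move: ej ea; rewrite aj => -> [].
    by rewrite !ifF //; lia.
  have bi : b <> i by move=> e; rewrite e ei in eb; case: eb => e'; rewrite e' eqxx in aj.
  move/eqP: aj => aj.
  rewrite (_ : _ && ~~ _ = [|| [&& i < a, i + 1 < b & a < b], [&& a < i, b < i + 1 & a < b]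
     | (a < i) && (i + 1 < b)]); last by lia.
  apply: eqf; apply: functional_extensionality => z.
  rewrite /link /put; case: eqP => [->|za].
    by rewrite conjE // ea /=; congr Mate; rewrite simpleZl.
  case: eqP => [->|zj]; first by rewrite conjr ei /=; congr Mate; sz i a; lia.
  case: eqP => [->|zb].
    by rewrite conjE // eb /=; congr Mate; rewrite simpleZr.
  case: eqP => [->|zi]; first by rewrite conjl ej /=; congr Mate; sz i b; lia.
  rewrite conjE //; case ez : (g z) => [r|c] //; rewrite -ez.
  have [_ ec] := mg _ _ ez.
  rewrite (other _ _ ez) // => e; rewrite e ?ei ?ej in ec; case: ec => e'.
    by rewrite e' in za.
  by rewrite e' in zb.
Qed.

Lemma matching_conj i g : matching g -> matching (conj_clan i g).
Proof.
move=> mg a b; rewrite /conj_clan; case e : (g (simpleZ i a)) => [//|c] /= [<-].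
have [ne ec] := mg _ _ e; split; last by rewrite simpleZK ec /= simpleZK.
by move=> h; apply: ne; rewrite -h simpleZK.
Qed.

Lemma matching_link g a b s t : matching g -> a <> b -> g a = Sign s -> g b = Sign t ->
  matching (link g a b).
Proof.
move=> mg ab ea eb c d; rewrite /link /put.
case: eqP => [->|cb].
  move=> [<-]; split => //; case: eqP => // _; by rewrite eqxx.
case: eqP => [->|ca].
  by move=> [<-]; rewrite eqxx; split => // e; apply: ab.
move=> e; have [ne ed] := mg _ _ e; split => //.
case: eqP => [h|_]; first by rewrite h eb in ed.
by case: eqP => [h|_] //; rewrite h ea in ed.
Qed.

Lemma matching_hecke_gen i g : matching g -> matching (hecke_gen i g).
Proof.
move=> mg; rewrite hecke_genE //; rewrite /opposite_signs.
case ei : (g i) => [s|a]; case ej : (g (i + 1)) => [t|b];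
  try by case: ifP => // _; apply: matching_conj.
case: ifP => [_|_]; first by apply: matching_link ei ej => //; lia.
by case: ifP => // _; apply: matching_conj.
Qed.

Lemma hecke_link i g s : matching g -> g i = Sign s -> g (i + 1) = Sign (~~ s) ->
  hecke_gen i g = link g i (i + 1).
Proof.
by move=> mg ei ej; rewrite hecke_genE // /opposite_signs ei ej; case: s {ei ej}.
Qed.

Lemma hecke_rise i g : matching g -> theta g i < theta g (i + 1) ->
  theta g i <> i \/ theta g (i + 1) <> i + 1 -> hecke_gen i g = conj_clan i g.
Proof.
move=> mg lt h; rewrite hecke_genE // /rising lt.
rewrite (_ : opposite_signs _ _ _ = false); last first.
  rewrite /opposite_signs; case ei : (g i) => [s|//]; case ej : (g (i + 1)) => [t|//].
  by move: h; rewrite (theta_sign ei) (theta_sign ej); case.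
by rewrite ifT //; apply/negP => /andP[/eqP h1 /eqP h2]; case: h.
Qed.

Lemma hecke_fall i g : matching g -> theta g (i + 1) < theta g i -> hecke_gen i g = g.
Proof.
move=> mg lt; rewrite hecke_genE // /rising ltNge (ltW lt) /=.
rewrite (_ : opposite_signs _ _ _ = false) //.
rewrite /opposite_signs; case ei : (g i) => [s|//]; case ej : (g (i + 1)) => [t|//].
by move: lt; rewrite (theta_sign ei) (theta_sign ej); lia.
Qed.

Lemma hecke_same i g s : g i = Sign s -> g (i + 1) = Sign s -> hecke_gen i g = g.
Proof. by move=> ei ej; rewrite /hecke_gen ei ej eqxx. Qed.

Lemma theta_inj g : matching g -> injective (theta g).
Proof. by move=> /matching_theta; apply: can_inj. Qed.

Lemma hecke_gen_idem i g : matching g -> hecke_gen i (hecke_gen i g) = hecke_gen i g.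
Proof.
move=> mg; have mg' := @matching_hecke_gen i g mg; move: (mg').
rewrite (hecke_genE i mg); case: ifP => [o|no].
  move=> ml; rewrite hecke_fall // !theta_link !eqxx; ifs; lia.
case: ifP => [r|nr] m2; last by rewrite hecke_genE // no nr.
rewrite hecke_fall // !theta_conj simpleZl simpleZr.
move: r; rewrite /rising; have := theta_inj mg.
move: (theta g i) (theta g (i + 1)) => x y _.
by sz i x; sz i y; lia.
Qed.

Lemma simpleZ_other i z : z <> i -> z <> i + 1 -> simpleZ i z = z.
Proof. by move=> h1 h2; sz i z. Qed.

Lemma opposite_signs_conj i g a b :
  opposite_signs (conj_clan i g) a b = opposite_signs g (simpleZ i a) (simpleZ i b).
Proof. by rewrite /opposite_signs /conj_clan; case: (g (simpleZ i a)); case: (g (simpleZ i b)). Qed.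

Lemma opposite_signs_link g a b c d : c <> a -> c <> b -> d <> a -> d <> b ->
  opposite_signs (link g a b) c d = opposite_signs g c d.
Proof. by move=> ca cb da db; rewrite /opposite_signs /link /put; do ![case: eqP => //]. Qed.

Lemma hecke_link_far i j g : matching g -> 1 < `|i - j| -> opposite_signs g i (i + 1) ->
  hecke_gen i (hecke_gen j g) = hecke_gen j (hecke_gen i g).
Proof.
move=> mg far oi.
have sj z : z = i \/ z = i + 1 -> simpleZ j z = z by move=> h; apply: simpleZ_other; lia.
rewrite (hecke_genE i (@matching_hecke_gen j g mg)) (hecke_genE j (@matching_hecke_gen i g mg)).
rewrite !hecke_genE // oi.
have -> : rising (link g i (i + 1)) j = rising g j.
  by rewrite /rising !theta_link; do !(rewrite ifF; last lia).
rewrite (@opposite_signs_link g i (i + 1) j (j + 1)); try lia.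
case oj : (opposite_signs g j (j + 1)).
  rewrite (@opposite_signs_link g j (j + 1) i (i + 1)); try lia.
  rewrite oi; apply: functional_extensionality => z; rewrite /link /put; ifs => //; lia.
case rj : (rising g j); last by rewrite oi.
by rewrite opposite_signs_conj !sj ?oi ?conj_link ?sj; auto.
Qed.

Lemma simpleZ_rising i j x y : 1 < `|i - j| -> x <> y ->
    (x = j -> y = j + 1 -> False) -> (x = j + 1 -> y = j -> False) ->
  (simpleZ j x < simpleZ j y) && ~~ ((simpleZ j x == i) && (simpleZ j y == i + 1)) =
  (x < y) && ~~ ((x == i) && (y == i + 1)).
Proof.
move=> far xy h1 h2; have far' : i + 1 < j \/ j + 1 < i by lia.
clear far.
have -> : (simpleZ j x == i) && (simpleZ j y == i + 1) = (x == i) && (y == i + 1).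
  by congr (_ && _); [sz j x|sz j y]; lia.
by congr (_ && _); sz j x; sz j y; clear far'; subst; try lia; case: h1.
Qed.

Lemma hecke_gen_far i j g : matching g -> 1 < `|i - j| ->
  hecke_gen i (hecke_gen j g) = hecke_gen j (hecke_gen i g).
Proof.
move=> mg far.
have [oi|noi] := boolP (opposite_signs g i (i + 1)); first exact: hecke_link_far.
have [oj|noj] := boolP (opposite_signs g j (j + 1)).
  by rewrite -hecke_link_far // distrC.
have ti := matching_theta mg.
(* Two arcs joining i to j and i + 1 to j + 1 let distant letters interact: conjugation by s_i and
   by s_j then gives the same clan, on which neither letter acts any more. *)
have [/andP[/eqP xj /eqP yj]|general] := boolP ((theta g i == j) && (theta g (i + 1) == j + 1)).
  have Xi := ti i; have Yi := ti (i + 1); rewrite xj yj in Xi Yi.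
  have E : conj_clan i g = conj_clan j g.
    have [a ea] : exists a, g i = Mate a.
      by case e : (g i) => [s|a]; [move: xj; rewrite (theta_sign e); lia|exists a].
    have [b eb] : exists b, g (i + 1) = Mate b.
      by case e : (g (i + 1)) => [s|b]; [move: yj; rewrite (theta_sign e); lia|exists b].
    have aj : a = j by rewrite -xj (theta_mate ea).
    have bj : b = j + 1 by rewrite -yj (theta_mate eb).
    have [_ ej] := mg _ _ ea; have [_ ej'] := mg _ _ eb; subst a b.
    apply: functional_extensionality => z; rewrite /conj_clan.
    have [->|zi] := eqVneq z i.
      rewrite simpleZl eb /= (@simpleZ_other i); try lia.
      by rewrite simpleZ_other ?ea /= ?simpleZl //; lia.
    have [->|zi'] := eqVneq z (i + 1).
      rewrite simpleZr ea /= (@simpleZ_other i); try lia.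
      by rewrite simpleZ_other ?eb /= ?simpleZr //; lia.
    have [->|zj] := eqVneq z j.
      rewrite simpleZl ej' /= (@simpleZ_other j); try lia.
      by rewrite simpleZ_other ?ej /= ?simpleZl //; lia.
    have [->|zj'] := eqVneq z (j + 1).
      rewrite simpleZr ej /= (@simpleZ_other j); try lia.
      by rewrite simpleZ_other ?ej' /= ?simpleZr //; lia.
    rewrite !simpleZ_other; try by apply/eqP.
    case ez : (g z) => [//|c] /=; have [_ ec] := mg _ _ ez; congr Mate.
    have nc d w : g d = Mate w -> w != z -> c <> d.
      by move=> ed wz e; move: ec; rewrite e ed => -[] /eqP; apply/negP.
    have h1 := nc _ _ ea; have h2 := nc _ _ eb; have h3 := nc _ _ ej; have h4 := nc _ _ ej'.
    rewrite eq_sym in zi; rewrite eq_sym in zi'; rewrite eq_sym in zj; rewrite eq_sym in zj'.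
    by rewrite !simpleZ_other //; auto.
  have -> : hecke_gen j g = conj_clan j g by apply: hecke_rise => //; lia.
  have -> : hecke_gen i g = conj_clan i g by apply: hecke_rise => //; lia.
  have -> : hecke_gen i (conj_clan j g) = conj_clan j g.
    apply: hecke_fall; first exact: matching_conj.
    rewrite -E !theta_conj simpleZr simpleZl xj yj !(@simpleZ_other i); lia.
  have -> : hecke_gen j (conj_clan i g) = conj_clan i g.
    apply: hecke_fall; first exact: matching_conj.
    rewrite E !theta_conj simpleZr simpleZl Xi Yi !(@simpleZ_other j); lia.
  by rewrite E.
have inj := theta_inj mg.
have rE i' j' : 1 < `|i' - j'| -> ~~ ((theta g i' == j') && (theta g (i' + 1) == j' + 1)) ->
    ~~ ((theta g j' == i') && (theta g (j' + 1) == i' + 1)) ->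
    rising g j' -> rising (conj_clan j' g) i' = rising g i'.
  move=> far' gen gen' rj; rewrite /rising !theta_conj (@simpleZ_other j' i') ?(@simpleZ_other j' (i' + 1)); try lia.
  move: rj; rewrite /rising; have := inj i' (i' + 1).
  have := ti i'; have := ti (i' + 1); have := ti j'; have := ti (j' + 1).
  move: gen gen'; move e1 : (theta g i') => x; move e2 : (theta g (i' + 1)) => y.
  move e3 : (theta g j') => x'; move e4 : (theta g (j' + 1)) => y' gen gen' t1 t2 t3 t4 nxy.
  move=> /andP[lt _]; apply: simpleZ_rising => //; first by move=> /nxy; lia.
    by move=> h h'; move: gen; rewrite h h' !eqxx.
  by move=> h h'; rewrite h in t4; rewrite h' in t3; move: lt; rewrite -e3 -e4 t3 t4; lia.
have general' : ~~ ((theta g j == i) && (theta g (j + 1) == i + 1)).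
  apply/negP => /andP[/eqP h /eqP h']; have hi := ti j; have hi' := ti (j + 1).
  by move: general; rewrite h in hi; rewrite h' in hi'; rewrite hi hi' !eqxx.
have far' : 1 < `|j - i| by rewrite distrC.
rewrite (hecke_genE i (@matching_hecke_gen j g mg)) (hecke_genE j (@matching_hecke_gen i g mg)).
rewrite !hecke_genE // (negbTE noi) (negbTE noj).
have oi' : opposite_signs (conj_clan j g) i (i + 1) = false.
  by rewrite opposite_signs_conj !simpleZ_other ?(negbTE noi); lia.
have oj' : opposite_signs (conj_clan i g) j (j + 1) = false.
  by rewrite opposite_signs_conj !simpleZ_other ?(negbTE noj); lia.
case ri : (rising g i); case rj : (rising g j); rewrite ?oi' ?oj' ?(negbTE noi) ?(negbTE noj) ?rE ?ri ?rj //.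
apply: functional_extensionality => z; rewrite /conj_clan.
have comm : simpleZ i (simpleZ j z) = simpleZ j (simpleZ i z).
  exact: (congr1 (fun f => f z) (simpleZ_far far)).
rewrite comm; case: (g _) => //= b; congr Mate.
exact: (congr1 (fun f => f b) (simpleZ_far far)).
Qed.

Lemma hecke_no_opposite i g : matching g -> opposite_signs g i (i + 1) = false ->
  hecke_gen i g = if rising g i then conj_clan i g else g.
Proof. by move=> mg e; rewrite hecke_genE // e. Qed.

Lemma opposite_signsC g a b : opposite_signs g a b = opposite_signs g b a.
Proof. by rewrite /opposite_signs; case: (g a); case: (g b) => // s t; rewrite eq_sym. Qed.

Lemma conj_clan_adj i g :
  conj_clan i (conj_clan (i + 1) (conj_clan i g)) =
  conj_clan (i + 1) (conj_clan i (conj_clan (i + 1) g)).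
Proof.
apply: functional_extensionality => z; rewrite /conj_clan.
have E c : simpleZ i (simpleZ (i + 1) (simpleZ i c)) =
    simpleZ (i + 1) (simpleZ i (simpleZ (i + 1) c)).
  exact: (congr1 (fun f => f c) (simpleZ_adj i)).
by rewrite E; case: (g _) => //= b; congr Mate; rewrite E.
Qed.

Lemma simpleZ_values i :
  [/\ simpleZ i i = i + 1, simpleZ i (i + 1) = i & simpleZ i (i + 1 + 1) = i + 1 + 1] /\
  [/\ simpleZ (i + 1) i = i, simpleZ (i + 1) (i + 1) = i + 1 + 1 &
      simpleZ (i + 1) (i + 1 + 1) = i + 1].
Proof. by rewrite /simpleZ !eqxx; split; split; ifs; lia. Qed.

Lemma hecke_gen_adj_same i j k g : j = i + 1 -> k = j + 1 -> matching g ->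
    opposite_signs g i j = false -> opposite_signs g j k = false ->
    opposite_signs g i k = false ->
  hecke_gen i (hecke_gen j (hecke_gen i g)) = hecke_gen j (hecke_gen i (hecke_gen j g)).
Proof.
move=> hj hk mg oij ojk oik.
have [[ii ij ik] [ji jj jk]] := simpleZ_values i; rewrite -hj -hk in ii ij ik ji jj jk.
have RI h : rising h i = (theta h i < theta h j) && ~~ ((theta h i == i) && (theta h j == j)).
  by rewrite hj.
have RJ h : rising h j = (theta h j < theta h k) && ~~ ((theta h j == j) && (theta h k == k)).
  by rewrite hk.
have CC h : conj_clan i (conj_clan j (conj_clan i h)) = conj_clan j (conj_clan i (conj_clan j h)).
  by rewrite hj; apply: conj_clan_adj.
pose P h := [/\ matching h, opposite_signs h i j = false, opposite_signs h j k = false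
   & opposite_signs h i k = false].
have Pg : P g by [].
have Pi h : P h -> P (conj_clan i h).
  move=> [h1 h2 h3 h4]; split; first exact: matching_conj.
  - by rewrite opposite_signs_conj ii ij opposite_signsC.
  - by rewrite opposite_signs_conj ij ik.
  - by rewrite opposite_signs_conj ii ik.
have Pj h : P h -> P (conj_clan j h).
  move=> [h1 h2 h3 h4]; split; first exact: matching_conj.
  - by rewrite opposite_signs_conj ji jj.
  - by rewrite opposite_signs_conj jj jk opposite_signsC.
  - by rewrite opposite_signs_conj ji jk.
have Ei h : P h -> hecke_gen i h = if rising h i then conj_clan i h else h.
  by move=> [h1 h2 h3 h4]; apply: hecke_no_opposite => //; rewrite -hj.
have Ej h : P h -> hecke_gen j h = if rising h j then conj_clan j h else h.
  by move=> [h1 h2 h3 h4]; apply: hecke_no_opposite => //; rewrite -hk.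
have ti := matching_theta mg; have inj := theta_inj mg.
have tri (c : int) : exists2 d, [/\ d < i \/ k < d, simpleZ i d = d & simpleZ j d = d] &
    [\/ c = i, c = j, c = k | c = d].
  have out d : d < i \/ k < d -> [/\ d < i \/ k < d, simpleZ i d = d & simpleZ j d = d].
    by move=> h; split => //; apply: simpleZ_other; lia.
  have outk := out (k + 1) ltac:(lia).
  have [->|/eqP h1] := eqVneq c i; first by exists (k + 1) => //; constructor 1.
  have [->|/eqP h2] := eqVneq c j; first by exists (k + 1) => //; constructor 2.
  have [->|/eqP h3] := eqVneq c k; first by exists (k + 1) => //; constructor 3.
  by exists c; [apply: out; lia|constructor 4].
have hxy := inj i j; have hxz := inj i k; have hyz := inj j k.
have ax := ti i; have ay := ti j; have az := ti k.
have Pgi := Pi _ Pg; have Pgj := Pj _ Pg; have Pgij := Pj _ Pgi; have Pgji := Pi _ Pgj.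
have [x [cx1 cxi cxj] cx] := tri (theta g i).
have [y [cy1 cyi cyj] cy] := tri (theta g j).
have [z [cz1 czi czj] cz] := tri (theta g k).
case: cx => e1; case: cy => e2; case: cz => e3;
  rewrite e1 ?e2 ?e3 in ax hxy hxz; rewrite e2 ?e1 ?e3 in ay hxy hyz;
  rewrite e3 ?e1 ?e2 in az hyz hxz;
  try (exfalso; clear - hj hk ax ay az hxy hxz hyz cx1 cy1 cz1; lia);
  clear ax ay az tri inj ti oij ojk oik Pi Pj;
  pose V := (theta_conj, (ii, ij, ik), (ji, jj, jk), (cxi, cyi, czi), (cxj, cyj, czj), (e1, e2, e3));
  (case r1 : (rising g i); have q1 := r1; rewrite RI !V in q1;
    try (exfalso; clear - hj hk q1 hxy hxz hyz cx1 cy1 cz1; lia));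
  (case r2 : (rising g j); have q2 := r2; rewrite RJ !V in q2;
    try (exfalso; clear - hj hk q1 q2 hxy hxz hyz cx1 cy1 cz1; lia));
  rewrite (Ei _ Pg) (Ej _ Pg) ?r1 ?r2 ?(Ej _ Pgi) ?(Ei _ Pgj) ?(Ei _ Pg) ?(Ej _ Pg) ?r1 ?r2.
all: (case r3 : (rising (conj_clan i g) j); have q3 := r3; rewrite RJ !V in q3;
    try (exfalso; clear - hj hk q1 q2 q3 hxy hxz hyz cx1 cy1 cz1; lia)).
all: (case r4 : (rising (conj_clan j g) i); have q4 := r4; rewrite RI !V in q4;
    try (exfalso; clear - hj hk q1 q2 q3 q4 hxy hxz hyz cx1 cy1 cz1; lia)).
all: rewrite ?r3 ?r4 ?(Ei _ Pgij) ?(Ej _ Pgji) ?(Ei _ Pgi) ?(Ej _ Pgj) ?(Ei _ Pg) ?(Ej _ Pg) ?(Ej _ Pgi) ?(Ei _ Pgj) ?r1 ?r2 ?r3 ?r4 //.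
all: repeat match goal with
  | |- context [if rising ?h ?a then _ else _] =>
    let r := fresh in let q := fresh in case r : (rising h a); have q := r; rewrite ?RI ?RJ !V in q;
    try (exfalso; clear - hj hk q1 q2 q3 q4 q hxy hxz hyz cx1 cy1 cz1; lia)
  end.
all: try reflexivity.
all: exact: CC.
Qed.

(** At least two of the three points carry signs. If the third is matched, its partner lies outside,
    and only the side on which it lies matters. *)
Lemma hecke_gen_adj_opposite i j k g : j = i + 1 -> k = j + 1 -> matching g ->
    [|| opposite_signs g i j, opposite_signs g j k | opposite_signs g i k] ->
  hecke_gen i (hecke_gen j (hecke_gen i g)) = hecke_gen j (hecke_gen i (hecke_gen j g)).
Proof.
move=> hj hk mg opp.
have [[ii ij ik] [ji jj jk]] := simpleZ_values i; rewrite -hj -hk in ii ij ik ji jj jk.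
have Li h s : matching h -> h i = Sign s -> h j = Sign (~~ s) -> hecke_gen i h = link h i j.
  by rewrite hj; apply: hecke_link.
have Lj h s : matching h -> h j = Sign s -> h k = Sign (~~ s) -> hecke_gen j h = link h j k.
  by rewrite hk; apply: hecke_link.
have Ri h : matching h -> theta h i < theta h j -> theta h i <> i \/ theta h j <> j ->
    hecke_gen i h = conj_clan i h by rewrite hj; apply: hecke_rise.
have Rj h : matching h -> theta h j < theta h k -> theta h j <> j \/ theta h k <> k ->
    hecke_gen j h = conj_clan j h by rewrite hk; apply: hecke_rise.
have Fi h : matching h -> theta h j < theta h i -> hecke_gen i h = h.
  by rewrite hj; apply: hecke_fall.
have Fj h : matching h -> theta h k < theta h j -> hecke_gen j h = h.
  by rewrite hk; apply: hecke_fall.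
have Si h s : h i = Sign s -> h j = Sign s -> hecke_gen i h = h.
  by rewrite hj; apply: hecke_same.
have Sj h s : h j = Sign s -> h k = Sign s -> hecke_gen j h = h.
  by rewrite hk; apply: hecke_same.
have Mc a h : matching h -> matching (conj_clan a h) := @matching_conj a h.
have Ml a b h s t : matching h -> a <> b -> h a = Sign s -> h b = Sign t -> matching (link h a b).
  by move=> *; apply: matching_link; eauto.
have nij : i <> j by lia.
have nik : i <> k by lia.
have njk : j <> k by lia.
have outside z b : z = i \/ z = j \/ z = k -> g z = Mate b ->
    (forall w, w = i \/ w = j \/ w = k -> w <> z -> exists s, g w = Sign s) ->
    [/\ theta g z = b, simpleZ i b = b, simpleZ j b = b & b < i \/ k < b].
  move=> hz e h; have [ne eb] := mg _ _ e.
  have hb w : w = i \/ w = j \/ w = k -> b <> w.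
    move=> hw ebw; have [ew|/eqP nw] := eqVneq w z; first by rewrite -ew -ebw in ne.
    by have [s es] := h w hw nw; rewrite ebw es in eb.
  have [b1 b2 b3] : [/\ b <> i, b <> j & b <> k] by split; apply: hb; auto.
  split; [exact: theta_mate|by apply: simpleZ_other; rewrite -?hj|
    by apply: simpleZ_other; rewrite -?hk|lia].
case ei : (g i) => [s|b]; case ej : (g j) => [t|c]; case ek : (g k) => [r|d];
  move: opp; rewrite /opposite_signs ?ei ?ej ?ek ?orbF ?orFb //= => opp.
- have ti := theta_sign ei; have tj := theta_sign ej; have tk := theta_sign ek.
  pose V := (theta_conj, theta_link, (ii, ij, ik), (ji, jj, jk), (ti, tj, tk)).
  have [st|st] := eqVneq t s; [have rs : r = ~~ s|have {st}st : t = ~~ s; [|have [rs|rs] := eqVneq r s]].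
  + by move: opp; rewrite st eqxx; case: (s); case: (r).
  + rewrite st in ej; rewrite rs in ek.
    have E1 : hecke_gen i g = g by apply: Si ei ej.
    have E2 : hecke_gen j g = link g j k by apply: (Lj _ s).
    have M2 : matching (link g j k) by apply: (Ml _ _ _ _ _ _ _ ej ek).
    have E3 : hecke_gen i (link g j k) = conj_clan i (link g j k).
      by apply: Ri => //; rewrite !V; ifs; lia.
    rewrite E1 E2 E3; symmetry; apply: Fj; first exact: (Mc).
    by rewrite !V; ifs; rewrite ?V; lia.
  + by move: st; case: (s); case: (t).
  + rewrite st in ej; rewrite rs in ek.
    have E1 : hecke_gen i g = link g i j by apply: (Li _ s).
    have M1 : matching (link g i j) by apply: (Ml _ _ _ _ _ _ _ ei ej).
    have E2 : hecke_gen j g = link g j k by apply: (Lj _ (~~ s)); rewrite ?negbK.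
    have M2 : matching (link g j k) by apply: (Ml _ _ _ _ _ _ _ ej ek).
    have E3 : hecke_gen j (link g i j) = conj_clan j (link g i j).
      by apply: Rj => //; rewrite !V; ifs; lia.
    have E4 : hecke_gen i (link g j k) = conj_clan i (link g j k).
      by apply: Ri => //; rewrite !V; ifs; lia.
    rewrite E1 E2 E3 E4 Fi ?Fj; try exact: (Mc).
    * apply: functional_extensionality => z; rewrite !conj_link ?V /link /put.
      case: eqP => // zk; case: eqP => // zi; rewrite /conj_clan.
      have [->|/eqP zj] := eqVneq z j; first by rewrite jj ek ij ei.
      by rewrite !simpleZ_other -?hj -?hk //; case ez : (g z) => [//|e];
        have [_ eb] := mg _ _ ez; rewrite /= !simpleZ_other // => h; move: eb; rewrite h -?hj -?hk ?ei ?ej ?ek.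
    * by rewrite !V; ifs; rewrite ?V; lia.
    * by rewrite !V; ifs; rewrite ?V; lia.
  + have {}rs : r = ~~ s by move: rs; case: (s); case: (r).
    rewrite st in ej; rewrite rs in ek.
    have E1 : hecke_gen i g = link g i j by apply: (Li _ s).
    have M1 : matching (link g i j) by apply: (Ml _ _ _ _ _ _ _ ei ej).
    have E2 : hecke_gen j g = g by apply: Sj ej ek.
    have E3 : hecke_gen j (link g i j) = conj_clan j (link g i j).
      by apply: Rj => //; rewrite !V; ifs; lia.
    rewrite E2 E1 E3; apply: Fi; first exact: (Mc).
    by rewrite !V; ifs; rewrite ?V; lia.
- have ti := theta_sign ei; have tj := theta_sign ej.
  have {opp}st : t = ~~ s by move: opp; case: (s); case: (t).
  rewrite st in ej.
  have [||tk hi hjd hd] := outside k d _ ek; auto.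
    by move=> w [->|[->|->]] ? //; eauto.
  pose V := (theta_conj, theta_link, (ii, ij, ik), (ji, jj, jk), (ti, tj, tk), (hi, hjd)).
  have E1 : hecke_gen i g = link g i j by apply: (Li _ s).
  have M1 : matching (link g i j) by apply: (Ml _ _ _ _ _ _ _ ei ej).
  case: hd => hd.
    have E2 : hecke_gen j (link g i j) = link g i j.
      by apply: Fj => //; rewrite !V; ifs; lia.
    have E3 : hecke_gen i (link g i j) = link g i j.
      by apply: Fi => //; rewrite !V; ifs; lia.
    have E4 : hecke_gen j g = g by apply: Fj => //; rewrite !V; lia.
    by rewrite E4 E1 E2 E3.
  have E2 : hecke_gen j (link g i j) = conj_clan j (link g i j).
    by apply: Rj => //; rewrite !V; ifs; lia.
  have E3 : hecke_gen i (conj_clan j (link g i j)) = conj_clan i (conj_clan j (link g i j)).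
    by apply: Ri; [exact: (Mc)|rewrite !V; ifs; rewrite ?V; lia|rewrite !V; ifs; rewrite ?V; lia].
  have E4 : hecke_gen j g = conj_clan j g by apply: Rj => //; rewrite !V; lia.
  have E5 : hecke_gen i (conj_clan j g) = conj_clan i (conj_clan j g).
    by apply: Ri; [exact: (Mc)|rewrite !V; lia|rewrite !V; lia].
  rewrite E1 E2 E3 E4 E5 (Lj _ s).
  + by rewrite !conj_link !V.
  + by do 2 apply: (Mc).
  + by rewrite /conj_clan ij ji ei.
  + by rewrite /conj_clan ik jk ej.
- have ti := theta_sign ei; have tk := theta_sign ek.
  have {opp}rs : r = ~~ s by move: opp; case: (s); case: (r).
  rewrite rs in ek.
  have [||tj hi hjc hc] := outside j c _ ej; auto.
    by move=> w [->|[->|->]] ? //; eauto.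
  pose V := (theta_conj, theta_link, (ii, ij, ik), (ji, jj, jk), (ti, tj, tk), (hi, hjc)).
  case: hc => hc.
    have E1 : hecke_gen i g = g by apply: Fi => //; rewrite !V; lia.
    have E2 : hecke_gen j g = conj_clan j g by apply: Rj => //; rewrite !V; lia.
    have e1 : conj_clan j g i = Sign s by rewrite /conj_clan ji ei.
    have e2 : conj_clan j g j = Sign (~~ s) by rewrite /conj_clan jj ek.
    have E3 : hecke_gen i (conj_clan j g) = link (conj_clan j g) i j.
      by apply: (Li _ s) => //; apply: (Mc).
    rewrite E1 E2 E3; symmetry; apply: Fj; first by apply: (Ml _ _ _ _ _ _ _ e1 e2) => //; apply: (Mc).
    by rewrite !V; ifs; rewrite ?V; lia.
  have E1 : hecke_gen i g = conj_clan i g by apply: Ri => //; rewrite !V; lia.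
  have E2 : hecke_gen j g = g by apply: Fj => //; rewrite !V; lia.
  have e1 : conj_clan i g j = Sign s by rewrite /conj_clan ij ei.
  have e2 : conj_clan i g k = Sign (~~ s) by rewrite /conj_clan ik ek.
  have E3 : hecke_gen j (conj_clan i g) = link (conj_clan i g) j k.
    by apply: (Lj _ s) => //; apply: (Mc).
  rewrite E2 E1 E3; apply: Fi; first by apply: (Ml _ _ _ _ _ _ _ e1 e2) => //; apply: (Mc).
  by rewrite !V; ifs; rewrite ?V; lia.
- have tj := theta_sign ej; have tk := theta_sign ek.
  have {opp}rs : r = ~~ t by move: opp; case: (t); case: (r).
  rewrite rs in ek.
  have [||ti hi hjb hb] := outside i b _ ei; auto.
    by move=> w [->|[->|->]] ? //; eauto.
  pose V := (theta_conj, theta_link, (ii, ij, ik), (ji, jj, jk), (ti, tj, tk), (hi, hjb)).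
  have E2 : hecke_gen j g = link g j k by apply: (Lj _ t).
  have M2 : matching (link g j k) by apply: (Ml _ _ _ _ _ _ _ ej ek).
  case: hb => hb.
    have E1 : hecke_gen i g = conj_clan i g by apply: Ri => //; rewrite !V; lia.
    have E3 : hecke_gen j (conj_clan i g) = conj_clan j (conj_clan i g).
      by apply: Rj; [exact: (Mc)|rewrite !V; lia|rewrite !V; lia].
    have E4 : hecke_gen i (link g j k) = conj_clan i (link g j k).
      by apply: Ri => //; rewrite !V; ifs; lia.
    have E5 : hecke_gen j (conj_clan i (link g j k)) = conj_clan j (conj_clan i (link g j k)).
      by apply: Rj; [exact: (Mc)|rewrite !V; ifs; rewrite ?V; lia|rewrite !V; ifs; rewrite ?V; lia].
    rewrite E1 E2 E3 E4 E5 (Li _ t).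
    + by rewrite !conj_link !V.
    + by do 2 apply: (Mc).
    + by rewrite /conj_clan ji ii ej.
    + by rewrite /conj_clan jj ik ek.
  have E1 : hecke_gen i g = g by apply: Fi => //; rewrite !V; lia.
  have E3 : hecke_gen i (link g j k) = link g j k.
    by apply: Fi => //; rewrite !V; ifs; lia.
  have E4 : hecke_gen j (link g j k) = link g j k.
    by apply: Fj => //; rewrite !V; ifs; lia.
  by rewrite E1 E2 E3 E4.
Qed.

Lemma hecke_gen_adj i g : matching g ->
  hecke_gen i (hecke_gen (i + 1) (hecke_gen i g)) =
  hecke_gen (i + 1) (hecke_gen i (hecke_gen (i + 1) g)).
Proof.
move=> mg; have [|] := boolP [|| opposite_signs g i (i + 1),
  opposite_signs g (i + 1) (i + 1 + 1) | opposite_signs g i (i + 1 + 1)].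
  exact: hecke_gen_adj_opposite.
by rewrite !negb_or => /and3P[/negbTE ? /negbTE ? /negbTE ?]; apply: (@hecke_gen_adj_same i _ (i + 1 + 1)).
Qed.

(** * Noncrossing clans with prescribed types *)

Definition has_types (A B : int -> bool) (g : preclan) : Prop := forall z,
  [/\ A z -> B z -> initial g z, ~~ A z -> ~~ B z -> final g z,
      A z -> ~~ B z -> g z = Sign true & ~~ A z -> B z -> g z = Sign false].

(** In the application [A] and [B] are the sets of z with u(z) <= p and v(z) <= q, and the clan is
    gamma_{u,v}. *)
Definition clan_of (A B : int -> bool) (g : preclan) : Prop :=
  [/\ matching g, noncrossing g & has_types A B g].

(* An innermost disagreement between two noncrossing clans with equal types
   produces a strictly shorter one. *)
Lemma clan_unique A B g g' : clan_of A B g -> clan_of A B g' -> g = g'.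
Proof.
have key (k : nat) h h' a b b' : clan_of A B h -> clan_of A B h' ->
    h a = Mate b -> h' a = Mate b' -> a < b -> b < b' -> (absz (b - a)%R < k)%N -> False.
  elim: k a b b' h h' => // k IH a b b' h h' ch ch' ha ha' ab bb' sz.
  have [mh nh th] := ch; have [mh' nh' th'] := ch'.
  have [_ hb] := mh _ _ ha.
  have notA : A b = false /\ B b = false.
    have [t1 _ t3 t4] := th b.
    case Ab : (A b); case Bb : (B b) => //; first last.
    - by have := t4 (negbT Ab) Bb; rewrite hb.
    - by have := t3 Ab (negbT Bb); rewrite hb.
    by have [d] := t1 Ab Bb; rewrite hb => -[<-]; lia.
  have [_ t2 _ _] := th' b; have [c hc cb] := t2 (negbT notA.1) (negbT notA.2).
  have [_ hc'] := mh' _ _ hc.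
  have ca : c <> a by move=> e; rewrite e ha' in hc'; case: hc'; lia.
  have ac : a < c.
    have [//|h1] := ltP a c; case: nh'; exists c, a, b, b'; split => //; lia.
  have initc : A c /\ B c.
    have [_ s2 s3 s4] := th' c; case Ac : (A c); case Bc : (B c) => //.
    - by have := s3 Ac (negbT Bc); rewrite hc'.
    - by have := s4 (negbT Ac) Bc; rewrite hc'.
    by have [d] := s2 (negbT Ac) (negbT Bc); rewrite hc' => -[<-]; lia.
  have [t1 _ _ _] := th c; have [d hd cd] := t1 initc.1 initc.2.
  have [_ hd'] := mh _ _ hd.
  have db : d <> b by move=> e; rewrite e hb in hd'; case: hd'; lia.
  have {}db : d < b.
    have [//|h1] := ltP d b; case: nh; exists a, c, b, d; split => //; lia.
  by apply: (IH c d b h h' ch ch' hd hc' cd db); lia.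
have key2 a b b' : clan_of A B g -> clan_of A B g' -> g a = Mate b -> g' a = Mate b' ->
    a < b -> a < b' -> b = b'.
  move=> cg cg' ga ga' ab ab'; have [lt|lt|//] := ltgtP b b'.
    by case: (key (absz (b - a)%R).+1 g g' a b b').
  by case: (key (absz (b' - a)%R).+1 g' g a b' b).
move=> cg cg'; have [mg ng tg] := cg; have [mg' ng' tg'] := cg'.
apply: functional_extensionality => a.
have [t1 t2 t3 t4] := tg a; have [s1 s2 s3 s4] := tg' a.
case Aa : (A a); case Ba : (B a).
- have [b gb ab] := t1 Aa Ba; have [b' gb' ab'] := s1 Aa Ba.
  by rewrite gb gb' (key2 a b b').
- by rewrite t3 ?s3 ?Ba.
- by rewrite t4 ?s4 ?Aa.
have [b gb ba] := t2 (negbT Aa) (negbT Ba).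
have [b' gb' ba'] := s2 (negbT Aa) (negbT Ba).
have [_ hb] := mg _ _ gb; have [_ hb'] := mg' _ _ gb'.
have initb c h x : clan_of A B h -> h c = Mate x -> c < x -> A c /\ B c.
  move=> [mh nh th] hc cx; have [u1 u2 u3 u4] := th c.
  case Ac : (A c); case Bc : (B c) => //.
  - by have := u3 Ac (negbT Bc); rewrite hc.
  - by have := u4 (negbT Ac) Bc; rewrite hc.
  by have [d] := u2 (negbT Ac) (negbT Bc); rewrite hc => -[<-]; lia.
have [Ab Bb] := initb _ _ _ cg hb ba.
have [r1 _ _ _] := tg' b; have [x gx bx] := r1 Ab Bb.
have e := key2 _ _ _ cg cg' hb gx ba bx.
by rewrite -e in gx; have [_ ga] := mg' _ _ gx; rewrite gb ga.
Qed.

Lemma clan_initial A B g z : clan_of A B g -> A z -> B z -> exists2 b, g z = Mate b & z < b.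
Proof. by move=> [_ _ t] Az Bz; have [t1 _ _ _] := t z; apply: t1. Qed.

Lemma clan_final A B g z : clan_of A B g -> ~~ A z -> ~~ B z -> exists2 b, g z = Mate b & b < z.
Proof. by move=> [_ _ t] Az Bz; have [_ t2 _ _] := t z; apply: t2. Qed.

Lemma clan_plus A B g z : clan_of A B g -> A z -> ~~ B z -> g z = Sign true.
Proof. by move=> [_ _ t] Az Bz; have [_ _ t3 _] := t z; apply: t3. Qed.

Lemma clan_minus A B g z : clan_of A B g -> ~~ A z -> B z -> g z = Sign false.
Proof. by move=> [_ _ t] Az Bz; have [_ _ _ t4] := t z; apply: t4. Qed.

Lemma clan_theta A B g z : clan_of A B g ->
  if A z then (if B z then z < theta g z else theta g z == z)
  else (if B z then theta g z == z else theta g z < z).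
Proof.
move=> c; case Az : (A z); case Bz : (B z); rewrite /theta.
- by have [b -> lt] := clan_initial c Az Bz.
- by rewrite (clan_plus c Az (negbT Bz)).
- by rewrite (clan_minus c (negbT Az) Bz).
by have [b -> lt] := clan_final c (negbT Az) (negbT Bz).
Qed.

Definition ascent_at (A : int -> bool) i : bool := ~~ A i && A (i + 1).

(** Without ascents the two points carry equal signs or the partners decrease from i to i + 1; for
    two initial or two final points this is forced by the absence of crossings. *)
Lemma clan_trivial A B g i : clan_of A B g -> ~~ ascent_at A i -> ~~ ascent_at B i ->
  hecke_gen i g = g.
Proof.
move=> c; rewrite /ascent_at => nA nB; have [mg ng tg] := c.
have h1 := clan_theta i c; have h2 := clan_theta (i + 1) c.
have mt := matching_theta mg.
have same : A i = A (i + 1) -> B i = B (i + 1) -> A i != B i -> hecke_gen i g = g.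
  move=> eA eB; case Ai : (A i); case Bi : (B i) => // _.
    by apply: (@hecke_same _ _ true); [apply: (clan_plus c)|apply: (clan_plus c)];
      rewrite -?eA -?eB ?Ai ?Bi.
  by apply: (@hecke_same _ _ false); [apply: (clan_minus c)|apply: (clan_minus c)];
    rewrite -?eA -?eB ?Ai ?Bi.
have mateE z : theta g z <> z -> g z = Mate (theta g z) by rewrite /theta; case: (g z).
have ne : theta g i <> theta g (i + 1) by move/(theta_inj mg); lia.
move: nA nB h1 h2 same; case Ai : (A i); case Aj : (A (i + 1)); case Bi : (B i); case Bj : (B (i + 1)) => //= _ _ h1 h2 same;
  try (by apply: same); apply: hecke_fall => //; try lia.
  have [//|lt] := ltP (theta g (i + 1)) (theta g i); case: ng.
  have e1 : g i = Mate (theta g i) by apply: mateE; lia.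
  have e2 : g (i + 1) = Mate (theta g (i + 1)) by apply: mateE; lia.
  have ne' : theta g i <> i + 1.
    move=> e; have := mt i; rewrite e; lia.
  by exists i, (i + 1), (theta g i), (theta g (i + 1)); split => //; lia.
have [//|lt] := ltP (theta g (i + 1)) (theta g i); case: ng.
have ne' : theta g (i + 1) <> i by move=> e; have := mt (i + 1); rewrite e; lia.
have e1 : g (theta g i) = Mate i by rewrite mateE mt //; lia.
have e2 : g (theta g (i + 1)) = Mate (i + 1) by rewrite mateE mt //; lia.
by exists (theta g i), (theta g (i + 1)), i, (i + 1); split => //; lia.
Qed.

(** The sign at p is one of the two exchanged points, and s_i is increasing on all the others; so
    arcs keep their orientation and no crossing arises. *)
Lemma clan_conj A B g i p s : clan_of A B g -> p = i \/ p = i + 1 -> g p = Sign s ->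
  clan_of (A \o simpleZ i) (B \o simpleZ i) (conj_clan i g).
Proof.
move=> [mg ng tg] hp ep.
have mono z z' : z <> p -> z' <> p -> z < z' -> simpleZ i z < simpleZ i z'.
  by move=> h1 h2 lt; sz i z; sz i z'; lia.
have np a b : g a = Mate b -> a <> p /\ b <> p.
  move=> e; split=> h; first by rewrite h ep in e.
  by have [_] := mg _ _ e; rewrite h ep.
have conjE z b : conj_clan i g z = Mate b -> g (simpleZ i z) = Mate (simpleZ i b).
  by rewrite /conj_clan; case: (g _) => //= c [<-]; rewrite simpleZK.
split; first exact: matching_conj.
  move=> [a [b [c [d [ab bc cd /conjE ha /conjE hb]]]]].
  have [a1 c1] := np _ _ ha; have [b1 d1] := np _ _ hb.
  have mono' z z' : simpleZ i z <> p -> simpleZ i z' <> p -> z < z' -> simpleZ i z < simpleZ i z'.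
    by move=> h1 h2 lt; sz i z; sz i z'; lia.
  apply: ng; exists (simpleZ i a), (simpleZ i b), (simpleZ i c), (simpleZ i d).
  by split => //; apply: mono'.
move=> z; have [t1 t2 t3 t4] := tg (simpleZ i z); rewrite /initial /final /conj_clan /=.
split=> h1 h2.
- have [b e lt] := t1 h1 h2; exists (simpleZ i b); rewrite ?e //.
  by have [n1 n2] := np _ _ e; rewrite -(simpleZK i z); apply: mono.
- have [b e lt] := t2 h1 h2; exists (simpleZ i b); rewrite ?e //.
  by have [n1 n2] := np _ _ e; rewrite -(simpleZK i z); apply: mono.
- by rewrite t3.
- by rewrite t4.
Qed.

Lemma comp_simpleZ_same (B : int -> bool) i : B i = B (i + 1) -> B \o simpleZ i = B.
Proof.
by move=> e; apply: functional_extensionality => z /=; rewrite /simpleZ; ifs => //; [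
  have -> : z = i by apply/eqP|have -> : z = i + 1 by apply/eqP].
Qed.

(** Point i is a minus or final, point i + 1 a plus or initial. A final point followed by an initial
    one, where T_i would produce a crossing, is the excluded ascent of [B]. Minus and plus become an
    arc; in the other two cases T_i conjugates. *)
Lemma clan_stepA A B g i : clan_of A B g -> ascent_at A i -> ~~ ascent_at B i ->
  clan_of (A \o simpleZ i) B (hecke_gen i g).
Proof.
move=> c /andP[Ai Aj]; rewrite /ascent_at => nB; have [mg ng tg] := c.
have h1 := clan_theta i c; have h2 := clan_theta (i + 1) c; rewrite (negbTE Ai) Aj in h1 h2.
move: nB h1 h2; case Bi : (B i); case Bj : (B (i + 1)) => //= _ h1 h2.
- rewrite hecke_rise //; try lia.
  rewrite -(comp_simpleZ_same (B := B) (i := i)); last by rewrite Bi Bj.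
  by apply: (clan_conj c (p := i) (s := false)); [left|apply: (clan_minus c)].
- have ei := clan_minus c Ai Bi; have ej := clan_plus c Aj (negbT Bj).
  rewrite (hecke_link (s := false)) //.
  split; first by apply: matching_link ei ej => //; lia.
    have other z b : link g i (i + 1) z = Mate b -> (z = i /\ b = i + 1) \/ (z = i + 1 /\ b = i) \/
        (g z = Mate b).
      by rewrite /link /put; case: eqP => [->|_]; [move=> [<-]; auto|case: eqP => [->|_]; [move=> [<-]; auto|auto]].
    move=> [a [b [d [e [ab bd de /other ha /other hb]]]]].
    case: ha => [[]|[[]|ha]]; case: hb => [[]|[[]|hb]]; try lia.
    by apply: ng; exists a, b, d, e.
  move=> z; have [t1 t2 t3 t4] := tg z; rewrite /initial /final /link /put /= /simpleZ.
  have [->|/eqP zi] := eqVneq z i.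
    rewrite Aj Bi; split=> // _ _; exists (i + 1); last lia.
    by case: eqP => //; lia.
  have [->|/eqP zj] := eqVneq z (i + 1).
    by rewrite (negbTE Ai) Bj; split=> // _ _; exists i => //; lia.
  by split.
rewrite hecke_rise //; try lia.
rewrite -(comp_simpleZ_same (B := B) (i := i)); last by rewrite Bi Bj.
by apply: (clan_conj c (p := i + 1) (s := true)); [right|apply: (clan_plus c); rewrite ?Bj].
Qed.

(** Changing all signs exchanges the roles of u and v, so that [clan_stepB] follows from
    [clan_stepA]. *)
Definition flip_clan (g : preclan) : preclan :=
  fun z => if g z is Sign s then Sign (~~ s) else g z.

Lemma flip_clanK : involutive flip_clan.
Proof.
by move=> g; apply: functional_extensionality => z; rewrite /flip_clan; case: (g z) => // s; rewrite negbK.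
Qed.

Lemma flip_mate g z b : flip_clan g z = Mate b <-> g z = Mate b.
Proof. by rewrite /flip_clan; case: (g z). Qed.

Lemma clan_flip A B g : clan_of A B g -> clan_of B A (flip_clan g).
Proof.
move=> [mg ng tg]; split.
- by move=> a b /flip_mate /mg [h1 h2]; split => //; apply/flip_mate.
- move=> [a [b [c [d [h1 h2 h3 /flip_mate h4 /flip_mate h5]]]]].
  by apply: ng; exists a, b, c, d.
move=> z; have [t1 t2 t3 t4] := tg z; split=> h1 h2.
- by have [b e lt] := t1 h2 h1; exists b => //; apply/flip_mate.
- by have [b e lt] := t2 h2 h1; exists b => //; apply/flip_mate.
- by rewrite /flip_clan t4.
- by rewrite /flip_clan t3.
Qed.

Lemma hecke_flip i g : hecke_gen i (flip_clan g) = flip_clan (hecke_gen i g).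
Proof.
have put_flip h a x y : y = (if x is Sign s then Sign (~~ s) else x) ->
    put (flip_clan h) a y = flip_clan (put h a x).
  move=> ->; apply: functional_extensionality => z; rewrite /put /flip_clan.
  by case: eqP.
have link_flip h a b : link (flip_clan h) a b = flip_clan (link h a b).
  by rewrite /link (put_flip _ _ (Mate b)) // (put_flip _ _ (Mate a)).
rewrite /hecke_gen [flip_clan g i]/flip_clan [flip_clan g (i + 1)]/flip_clan.
case: (g i) => [s|a]; case: (g (i + 1)) => [t|b].
- by rewrite link_flip (inj_eq negb_inj); case: ifP.
- by case: ifP => // _; rewrite (put_flip _ _ (Sign s)) ?link_flip.
- by case: ifP => // _; rewrite (put_flip _ _ (Sign t)) ?link_flip.
- by case: ifP => // _; rewrite !link_flip.
Qed.

Lemma clan_stepB A B g i : clan_of A B g -> ~~ ascent_at A i -> ascent_at B i ->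
  clan_of A (B \o simpleZ i) (hecke_gen i g).
Proof.
move=> /clan_flip c nA aB; have := clan_flip (clan_stepA c aB nA).
by rewrite hecke_flip flip_clanK.
Qed.

Lemma hecke_keep_sign i g z s : matching g -> z <> i -> z <> i + 1 ->
  g z = Sign s -> hecke_gen i g z = Sign s.
Proof.
move=> mg h1 h2 e; rewrite hecke_genE //; case: ifP => _.
  by rewrite /link /put; do 2 case: eqP => //.
by case: ifP => // _; rewrite /conj_clan simpleZ_other // e.
Qed.

Lemma hecke_keep_mate i g z b : matching g -> z <> i -> z <> i + 1 ->
  g z = Mate b -> hecke_gen i g z = Mate b \/ hecke_gen i g z = Mate (simpleZ i b).
Proof.
move=> mg h1 h2 e; rewrite hecke_genE //; case: ifP => _.
  by rewrite /link /put; do 2 case: eqP => //; left.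
by case: ifP => _; [right; rewrite /conj_clan simpleZ_other // e|left].
Qed.

Definition hecke_word (a : seq int) (g : preclan) : preclan := foldr hecke_gen g a.

Lemma matching_hecke_word a g : matching g -> matching (hecke_word a g).
Proof. by move=> mg; elim: a => //= i a; apply: matching_hecke_gen. Qed.

Lemma hecke_word_braid a b g : braid_eq a b -> matching g -> hecke_word a g = hecke_word b g.
Proof.
move=> e mg; apply: (braid_foldr (I := matching)) e _ mg.
- exact: matching_hecke_gen.
- by move=> i j x mx far; apply: hecke_gen_far.
- by move=> i x; apply: hecke_gen_adj.
Qed.

Lemma hecke_word_cat a b g : hecke_word (a ++ b) g = hecke_word a (hecke_word b g).
Proof. exact: foldr_cat. Qed.

Lemma hecke_word_squareful a g : squareful a -> matching g -> exists2 b,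
  (size b < size a)%N /\ (forall L : pred int, all L a -> all L b) & hecke_word a g = hecke_word b g.
Proof.
move=> [x [i [y e]]] mg; exists (x ++ [:: i] ++ y).
  rewrite (braid_size e) !size_cat /=; split; first lia.
  move=> L; rewrite (braid_all L e) !all_cat /=.
  by case: (all L x) => //=; case: (L i).
rewrite (hecke_word_braid e mg) !hecke_word_cat /= hecke_gen_idem //.
exact: matching_hecke_word.
Qed.

(** * Products of two shuffles *)

Lemma dn_shift_word (b : int) k w : all (fun i => b < i < b + k%:Z) w ->
  braid_eq (map (fun i => i - 1) w ++ dn b k) (dn b k ++ w).
Proof.
elim: w => [|i w IH]; first by rewrite cats0 => _; apply: braid_refl.
move=> /= /andP[hi /IH e]; apply: (braid_trans (braid_catl [:: i - 1] e)).
by rewrite -cat_rcons; apply: (braid_catr w (dn_shift hi)).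
Qed.

Lemma map_sub_dn (b : int) k : map (fun i => i - 1) (dn b k) = dn (b - 1) k.
Proof. by elim: k => //= k ->; congr (_ :: _); lia. Qed.

Lemma map_add_dn (b c : int) k : map (fun i => i + c) (dn b k) = dn (b + c) k.
Proof. by elim: k => //= k ->; congr (_ :: _); lia. Qed.

Lemma map_sub_om l k : map (fun i => i - 1) (om l k) = om (l - 1) k.
Proof.
elim: k => // k IH; rewrite -[om l k.+1]/(om l k ++ dn l k.+1) map_cat IH map_sub_dn.
by [].
Qed.

Lemma om_divl l k : braid_eq (om l k.+1) (dn l k.+1 ++ om (l + 1) k).
Proof.
have -> : om l k.+1 = map (fun i => i - 1) (om (l + 1) k) ++ dn l k.+1.
  by rewrite map_sub_om addrK.
apply: dn_shift_word; apply: sub_all (om_window (l + 1) k) => i; rewrite /in_window; lia.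
Qed.

(* The word of the permutation exchanging two adjacent blocks of P and Q letters. *)
Fixpoint block_word (l : int) (P Q : nat) : seq int :=
  if P is P'.+1 then dn l Q ++ block_word (l + 1) P' Q else [::].

Lemma size_block_word l P Q : size (block_word l P Q) = (P * Q)%N.
Proof. by elim: P l => //= P IH l; rewrite size_cat size_dn IH mulSn. Qed.

Lemma block_word_window l P Q : all (fun i => l <= i < l + P%:Z + Q%:Z - 1) (block_word l P Q).
Proof.
elim: P l => //= P IH l; rewrite all_cat; apply/andP; split.
  by apply/allP => i; rewrite mem_dn; lia.
by apply: sub_all (IH (l + 1)) => i; lia.
Qed.

(** The permutation carries the first P points upwards by Q without changing their order, and so
    raises the letters acting among them by Q. *)
Lemma block_word_shift l P Q i : l <= i < l + P%:Z - 1 ->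
  braid_eq (block_word l P Q ++ [:: i]) (i + Q%:Z :: block_word l P Q).
Proof.
elim: P l => [|P IH] l hi /=; first by lia.
have [->|ne] := eqVneq i l; last first.
  rewrite -catA; apply: (braid_trans (braid_catl _ (IH (l + 1) _))); first lia.
  rewrite -cat_rcons -cat_cons; apply: braid_catr; apply: braid_sym.
  by apply: dn_commute; lia.
case: P IH hi => [|P] IH hi; first lia.
rewrite /= -!catA.
have c1 : braid_eq (block_word (l + 1 + 1) P Q ++ [:: l]) (l :: block_word (l + 1 + 1) P Q).
  rewrite cats1; apply/braid_sym/braid_commute_word.
  by apply: sub_all (block_word_window _ P Q) => j; lia.
apply: (braid_trans (braid_catl _ (braid_catl _ c1))).
have -> : dn l Q ++ dn (l + 1) Q ++ l :: block_word (l + 1 + 1) P Q =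
    (dn l Q ++ dn l Q.+1) ++ block_word (l + 1 + 1) P Q.
  by rewrite dnSr -catA cat_rcons.
rewrite catA -cat_cons; apply: braid_catr.
have -> : l + Q%:Z :: dn l Q ++ dn (l + 1) Q = dn l Q.+1 ++ dn (l + 1) Q by [].
have -> : dn l Q = map (fun i => i - 1) (dn (l + 1) Q) by rewrite map_sub_dn addrK.
rewrite map_sub_dn addrK -{1}(addrK 1 l) -(map_sub_dn (l + 1)).
by apply: dn_shift_word; apply/allP => j; rewrite mem_dn; lia.
Qed.

Lemma block_word_shift_word l P Q w : all (fun i => l <= i < l + P%:Z - 1) w ->
  braid_eq (block_word l P Q ++ w) (map (fun i => i + Q%:Z) w ++ block_word l P Q).
Proof.
elim: w => [|i w IH]; first by rewrite cats0 => _; apply: braid_refl.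
move=> /= /andP[hi /IH e]; rewrite -cat1s catA.
apply: (braid_trans (braid_catr w (block_word_shift Q hi))).
exact: (braid_catl [:: i + Q%:Z] e).
Qed.

(** Reversing P + b + 1 points is reversing inside the blocks of P and b + 1 points and then
    exchanging the blocks; the subscripts differ by one because [om l k] reverses k + 1 points. *)
Lemma om_parabolic l P b :
  braid_eq (om l (P + b)) (block_word l P b.+1 ++ om l P.-1 ++ om (l + P%:Z) b).
Proof.
elim: P l => [|P IH] l; first by rewrite /= addr0 add0n; apply: braid_refl.
rewrite addSn; apply: (braid_trans (om_divl _ _)).
apply: (braid_trans (braid_catl _ (IH (l + 1)))).
rewrite (_ : l + 1 + P%:Z = l + P.+1%:Z); last lia.
rewrite !catA; apply: braid_catr.
have -> : dn l (P + b).+1 = dn (l + b.+1%:Z) P ++ dn l b.+1 by rewrite dn_cat addSn addnC.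
case: P {IH} => [|P]; first by rewrite /= !cats0; apply: braid_refl.
rewrite -[P.+2.-1]/P.+1 -[P.+1.-1]/P.
have sh : braid_eq (block_word l P.+2 b.+1 ++ dn l P.+1)
    (dn (l + b.+1%:Z) P.+1 ++ block_word l P.+2 b.+1).
  rewrite -map_add_dn; apply: block_word_shift_word.
  by apply/allP => i; rewrite mem_dn; lia.
have E : (dn (l + b.+1%:Z) P.+1 ++ dn l b.+1) ++ block_word (l + 1) P.+1 b.+1 =
    dn (l + b.+1%:Z) P.+1 ++ block_word l P.+2 b.+1 by rewrite -catA.
rewrite E; move: (block_word l P.+2 b.+1) sh => B sh.
apply: (braid_trans (braid_catr _ (braid_sym sh))).
by rewrite -catA; apply: braid_catl; apply/braid_sym/om_divl.
Qed.

(** * Counting the low points in prefixes of a window *)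

Definition cnt (B : int -> bool) (b : int) (k : nat) : nat :=
  (\sum_(d < k) B (b + d%:Z)%R)%N.

(** Moving one low point a step to the left raises this sum by one. For a shuffle it therefore
    measures the length, up to sign and an additive constant ([prefix_sum_length]). *)
Definition prefix_sum (B : int -> bool) (b : int) (k : nat) : nat :=
  (\sum_(e < k.+1) cnt B b e)%N.

Lemma cntS B b k : cnt B b k.+1 = (cnt B b k + B (b + k%:Z)%R)%N.
Proof. by rewrite /cnt big_ord_recr. Qed.

Lemma cnt_swap B b k i : b <= i ->
  (cnt (B \o simpleZ i) b k)%:Z =
  (cnt B b k)%:Z + (if i == b + k%:Z - 1 then (B (i + 1))%:Z - (B i)%:Z else 0).
Proof.
move=> hi; elim: k => [|k IH].
  by rewrite /cnt !big_ord0 ifF //; lia.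
rewrite !cntS !PoszD IH /= /simpleZ.
have [e|n1] := eqVneq (b + k%:Z) i.
  have -> : i = b + k.+1%:Z - 1 by lia.
  rewrite eqxx ifF; last lia.
  by rewrite (_ : b + k.+1%:Z - 1 = b + k%:Z); lia.
have [e|n2] := eqVneq (b + k%:Z) (i + 1).
  rewrite ifT; last lia; rewrite ifF; last lia.
  by rewrite e; lia.
by rewrite ifF; last lia; rewrite ifF; lia.
Qed.

Lemma cnt_le (c : int) b k : (cnt (<= c) b k)%:Z =
  if c < b then 0 else if c < b + k%:Z then c - b + 1 else k%:Z.
Proof.
elim: k => [|k IH]; first by rewrite /cnt big_ord0; ifs; lia.
by rewrite cntS PoszD IH /=; ifs; lia.
Qed.

Lemma cnt_bound B b k : (cnt B b k <= k)%N.
Proof. by elim: k => [|k IH]; [rewrite /cnt big_ord0|rewrite cntS; case: (B _); lia]. Qed.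

Lemma cnt_full B b k z : cnt B b k = k -> b <= z < b + k%:Z -> B z.
Proof.
elim: k => [|k IH]; first by lia.
rewrite cntS => e hz; have := cnt_bound B b k; case Bk : (B (b + k%:Z)) e => e h; last by lia.
have [->//|ne] := eqVneq z (b + k%:Z); apply: IH; lia.
Qed.

Lemma cnt_lt B b k : (cnt B b k < k)%N -> exists2 z, b <= z < b + k%:Z & ~~ B z.
Proof.
elim: k => // k IH; rewrite cntS; case Bk : (B (b + k%:Z)) => h.
  by have [|z hz nz] := IH; [lia|exists z => //; lia].
by exists (b + k%:Z); rewrite ?Bk //; lia.
Qed.

Lemma cnt_gt0 B b k : (0 < cnt B b k)%N -> exists2 z, b <= z < b + k%:Z & B z.
Proof.
elim: k => [|k IH]; first by rewrite /cnt big_ord0.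
rewrite cntS; case Bk : (B (b + k%:Z)) => h; first by exists (b + k%:Z); rewrite ?Bk //; lia.
by have [|z hz nz] := IH; [lia|exists z => //; lia].
Qed.

Lemma cntD B b k k' : cnt B b (k + k') = (cnt B b k + cnt B (b + k%:Z)%R k')%N.
Proof.
elim: k' => [|k' IH]; first by rewrite addn0 /cnt big_ord0 addn0.
by rewrite addnS !cntS IH addnA PoszD addrA.
Qed.

Lemma prefix_sumS B b k : prefix_sum B b k.+1 = (prefix_sum B b k + cnt B b k.+1)%N.
Proof. by rewrite /prefix_sum big_ord_recr. Qed.

Lemma prefix_sum_swap B b k i : b <= i -> i < b + k%:Z ->
  (prefix_sum (B \o simpleZ i) b k)%:Z = (prefix_sum B b k)%:Z + (B (i + 1))%:Z - (B i)%:Z.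
Proof.
move=> hi hk; have H (e : nat) : (prefix_sum (B \o simpleZ i) b e)%:Z = (prefix_sum B b e)%:Z +
    (if i < b + e%:Z then (B (i + 1))%:Z - (B i)%:Z else 0).
  elim: e => [|e IH]; first by rewrite /prefix_sum !big_ord1 /cnt !big_ord0 ifF //; lia.
  by rewrite !prefix_sumS !PoszD IH cnt_swap //; ifs; lia.
by rewrite H hk addrA.
Qed.

(** The prefix sum of Q low points at the left end of P + Q points. In [sum_sub] they stand at the
    right end, and the difference P Q counts the steps between these positions. *)
Lemma sum_minn P Q : (\sum_(e < (P + Q).+1) minn e Q = 'C(Q.+1, 2) + P * Q)%N.
Proof.
elim: P => [|P IH].
  rewrite mul0n addn0 add0n -bin2_sum big_mkord; apply: eq_bigr => e _.
  by have := ltn_ord e; lia.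
by rewrite addSn big_ord_recr IH /=; lia.
Qed.

Lemma sum_sub P Q : (\sum_(e < (P + Q).+1) (e - P) = 'C(Q.+1, 2))%N.
Proof.
elim: P => [|P IH].
  by rewrite add0n -bin2_sum big_mkord; apply: eq_bigr => e _; rewrite subn0.
by rewrite addSn big_ord_recl /= add0n; apply: IH.
Qed.

Lemma cnt_signs A B (b : int) k : (forall z, b <= z < b + k%:Z -> A z (+) B z) ->
  (cnt A b k + cnt B b k)%N = k.
Proof.
elim: k => [|k IH] h; first by rewrite /cnt !big_ord0.
have := h (b + k%:Z); rewrite !cntS addnACA IH => [|z hz]; last by apply: h; lia.
by case: (A _); case: (B _) => /=; lia.
Qed.

Lemma cnt_empty B (b : int) k : cnt B b k = 0%N -> forall z, b <= z < b + k%:Z -> ~~ B z.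
Proof.
elim: k => [|k IH] h z hz; first by lia.
move: h; rewrite cntS => h; have [->|ne] := eqVneq z (b + k%:Z); first by case: (B _) h; lia.
by apply: IH; lia.
Qed.

Definition low (p : int) (u : int -> int) : int -> bool := fun z => u z <= p.

(* When u is inverse p-Grassmannian it is determined by [low p u]; the points of
   gamma_{u,v} are initial, final or signed according to [low p u] and [low q v]. *)
Definition shuffled (p : int) (u : int -> int) : Prop :=
  forall x y : int, x < y -> low p u x = low p u y -> u x < u y.

Lemma shuffled_descent p u i : shuffled p u -> (u (i + 1) < u i) = ascent_at (low p u) i.
Proof.
move=> su; have := su i (i + 1); rewrite /ascent_at /low.
have lt : i < i + 1 by lia.
move=> /(_ lt); case: (boolP (u i <= p)); case: (boolP (u (i + 1) <= p)) => h1 h2 h3 /=;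
  try (have := h3 erefl); lia.
Qed.

Lemma shuffled_swap p u i : shuffled p u -> low p u i != low p u (i + 1) ->
  shuffled p (u \o simpleZ i).
Proof.
move=> su ne x y xy e; have [lt|ge] := ltP (simpleZ i x) (simpleZ i y); first exact: su.
have [xi yi] : x = i /\ y = i + 1 by sz i x; sz i y; lia.
by move: ne e; rewrite xi yi /low /= simpleZl simpleZr eq_sym => /eqP.
Qed.

Lemma increasing_id l m u : in_group m l u -> (forall i, u i < u (i + 1)) -> u = id.
Proof.
move=> gu inc.
have up (d : nat) : l - 1 + d%:Z <= u (l - 1 + d%:Z).
  elim: d => [|d IH]; first by rewrite addr0 (in_group_fix gu) //; lia.
  by have := inc (l - 1 + d%:Z); rewrite (_ : l - 1 + d%:Z + 1 = l - 1 + d.+1%:Z); lia.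
have dwn (d : nat) : u (l + m%:Z + 1 - d%:Z) <= l + m%:Z + 1 - d%:Z.
  elim: d => [|d IH]; first by rewrite subr0 (in_group_fix gu) //; lia.
  have := inc (l + m%:Z + 1 - d.+1%:Z).
  by rewrite (_ : l + m%:Z + 1 - d.+1%:Z + 1 = l + m%:Z + 1 - d%:Z); lia.
apply: functional_extensionality => z.
have [hz|hz] := boolP (l <= z <= l + m%:Z); last by rewrite (in_group_fix gu).
have := up (absz (z - (l - 1))%R); have := dwn (absz (l + m%:Z + 1 - z)%R).
by rewrite (_ : l + m%:Z + 1 - _ = z); [rewrite (_ : l - 1 + _ = z); lia|lia].
Qed.

Lemma shuffled_id l m p u : in_group m l u -> shuffled p u ->
  (forall i, ~~ ascent_at (low p u) i) -> u = id.
Proof.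
move=> gu su h; apply: (increasing_id gu) => i.
have := h i; rewrite -shuffled_descent // -leNgt le_eqVlt => /orP[/eqP e|//].
by have := in_group_inj gu e; lia.
Qed.

Section Shuffles.

Variables (m : nat) (l : int).

Notation R := {mpoly int[m.+1]}.
Notation D := (@D m l).
Notation Dw := (@Dw m l).
Notation jet := (@jet m l).
Notation S := (@schub m l).

Implicit Types (f g h : R) (u v : int -> int) (p q : int).

Lemma D_shuffled p u i : in_group m l u -> shuffled p u -> in_window l m i ->
  D i (S u) = if ascent_at (low p u) i then S (u \o simpleZ i) else 0.
Proof.
move=> gu su hi; have := shuffled_descent i su; case: ifP => _ d.
  exact: schub_descent.
apply: schub_ascent => //; have [//|ge] := ltP (u i) (u (i + 1)).
have /in_group_inj inj := gu; have : u (i + 1) <> u i by move/inj; lia.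
by lia.
Qed.

Lemma shuffled_ascent p u i : shuffled p u -> ascent_at (low p u) i ->
  shuffled p (u \o simpleZ i).
Proof.
by move=> su /andP[h1 h2]; apply: shuffled_swap; rewrite // (negbTE h1) h2.
Qed.

Lemma eps1 : eps (1 : R) = 1.
Proof. exact: meval1. Qed.

(** Letters other than k keep points on their side of k, so a large value on the left and a small
    one on the right persist. The permutation never becomes the identity and its polynomial has
    constant term zero. *)
Lemma jet_cut p u k f a : in_group m l u -> shuffled p u -> all (in_window l m) a ->
    all (predC1 k) a -> (exists2 z, z <= k & ~~ low p u z) -> (exists2 z, k < z & low p u z) ->
  jet a (f * S u) = 0.
Proof.
elim/last_ind: a u f => [|a i IH] u f gu su.
  move=> _ _ [z zk nz] [z' kz lz]; rewrite /jet /= eps_mul (eps_schub gu) ?mulr0 // => e.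
  by move: nz lz; rewrite e /low; lia.
rewrite !all_rcons /= => /andP[hi wa] /andP[ik ca] h1 h2.
rewrite jet_rcons D_mul jet_add IH // add0r (D_shuffled gu su hi).
case: ifP => as_i; last by rewrite mulr0 jet0.
apply: IH => //; [exact: in_group_simple|exact: shuffled_ascent| |].
  by have [z zk nz] := h1; exists (simpleZ i z); [sz i z; lia|rewrite /low /= simpleZK].
by have [z zk nz] := h2; exists (simpleZ i z); [sz i z; lia|rewrite /low /= simpleZK].
Qed.

Lemma low_id p : low p id = (<= p).
Proof. by []. Qed.

(** Every letter that does not kill the polynomial moves a low point one step to the left, and a
    nonzero jet means that the identity is reached. *)
Lemma jet_size p u (b : int) (k : nat) a : in_group m l u -> shuffled p u ->
    all (in_window l m) a -> all (in_window b k) a -> jet a (S u) <> 0 ->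
  (size a + prefix_sum (low p u) b k = prefix_sum (<= p) b k)%N.
Proof.
elim/last_ind: a u => [|a i IH] u gu su.
  move=> _ _ nz; rewrite add0n; have [->|ne] := pselect (u = id); first by [].
  by case: nz; apply: eps_schub.
rewrite !all_rcons => /andP[hi wa] /andP[hi' wa'].
rewrite jet_rcons (D_shuffled gu su hi); case: ifP => as_i; last by rewrite jet0.
move=> /IH -/(_ (in_group_simple gu hi) (shuffled_ascent su as_i) wa wa') e.
move: hi'; rewrite /in_window => hi'.
have := @prefix_sum_swap (low p u) b k i; move: as_i => /andP[/negbTE -> ->].
by rewrite size_rcons -e; move: (prefix_sum _ _ _) (prefix_sum _ _ _); lia.
Qed.

(** The longest word can be made to end in i, and after D_i both sides become the jet of (D_i f)(D_i
    g). *)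
Lemma jet_om_adjoint (b : int) (k : nat) i f g : in_window b k i ->
  jet (om b k) (f * D i g) = jet (om b k) (D i f * g).
Proof.
move=> hi; have [x ex] := om_divr hi.
rewrite !(jet_braid _ _ ex) !jet_rcons; congr (jet _ _).
by rewrite D_mulC_invariant ?D_D // D_mul_invariant // sw_D.
Qed.

Lemma jet_om_adjoint_word (b : int) (k : nat) a f g : all (in_window b k) a ->
  jet (om b k) (f * Dw a g) = jet (om b k) (Dw (rev a) f * g).
Proof.
elim: a f => //= i a IH f /andP[hi wa].
by rewrite jet_om_adjoint // IH // rev_cons Dw_rcons.
Qed.

(** Take for f the image of the staircase under the reversed word. By adjunction the pairing becomes
    that of the staircase with D_a F, and only the constant term of D_a F counts, because the
    staircase already vanishes to the order of the longest word. *)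
Lemma jet_om_detect (b : int) (k : nat) (F : R) : l <= b -> b + k%:Z <= l + m%:Z ->
    (forall f, jet (om b k) (f * F) = 0) ->
  forall a, all (in_window b k) a -> jet a F = 0.
Proof.
move=> h1 h2 hF a wa.
have := hF (Dw (rev a) (staircase m l b k)).
rewrite mulrC jet_om_adjoint_word ?all_rev // revK.
have -> : Dw a F = (Dw a F - 1 *~ jet a F) + 1 *~ jet a F by rewrite subrK.
rewrite mulrDl jet_add.
have -> : jet (om b k) ((Dw a F - 1 *~ jet a F) * staircase m l b k) = 0.
  apply: (jet_order_mul (L := predT) (e := size (om b k))) => //; last exact: all_predT.
    by rewrite -[eps _]/(jet [::] _) jet_sub jet_mulz /jet /= eps1 mul1r subrr.
  exact: staircase_order.
have j1 : jet (om b k) (staircase m l b k) = 1 by rewrite /jet Dw_om_staircase // eps1.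
by rewrite add0r mulrzl jet_mulz j1 mul1r.
Qed.

Lemma Dw_mulC_invariant a f g : (forall i, i \in a -> D i g = 0) -> Dw a (f * g) = Dw a f * g.
Proof.
elim: a => //= i a IH h; rewrite IH; last by move=> j ja; apply: h; rewrite inE ja orbT.
by rewrite D_mulC_invariant // h // inE eqxx.
Qed.

Lemma cnt_group p u : in_group m l u -> l - 1 <= p <= l + m%:Z ->
  (cnt (low p u) l m.+1)%:Z = p - l + 1.
Proof.
move=> [a wa ->] hp; elim/last_ind: a wa => [|a i IH].
  by move=> _; rewrite low_id cnt_le; ifs; lia.
rewrite all_rcons word_perm_rcons => /andP[hi wa].
move: hi; rewrite /in_window => hi.
rewrite -[low p _]/(low p (word_perm a) \o simpleZ i) cnt_swap; last lia.
by rewrite ifF ?IH ?addr0 //; lia.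
Qed.

Lemma cnt_const (B : int -> bool) (b : int) (k : nat) c :
  (forall z, b <= z < b + k%:Z -> B z = c) -> cnt B b k = (if c then k else 0%N).
Proof.
elim: k => [|k IH] h; first by rewrite /cnt big_ord0; case: c {h}.
by rewrite cntS IH ?h; [case: c {h IH} => /=; lia|lia|move=> z hz; apply: h; lia].
Qed.

Lemma cnt_subwindow p u (b : int) (k : nat) : in_group m l u -> l - 1 <= p <= l + m%:Z ->
    l <= b -> b + k%:Z <= l + m%:Z + 1 ->
    (forall z, z < b -> low p u z) -> (forall z, b + k%:Z <= z -> ~~ low p u z) ->
  (cnt (low p u) b k)%:Z = p - b + 1.
Proof.
move=> gu hp h1 h2 hlow hhigh; have := cnt_group gu hp.
pose c := absz (b - l)%R; pose d := (m.+1 - c - k)%N.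
have -> : m.+1 = (c + (k + d))%N by rewrite /d /c; lia.
rewrite !cntD (_ : l + c%:Z = b); last by rewrite /c; lia.
rewrite (@cnt_const _ l c true); last by move=> z hz; apply: hlow; rewrite /c in hz; lia.
rewrite (@cnt_const _ (b + k%:Z) d false); first by rewrite /c; lia.
by move=> z hz; apply/negbTE/hhigh; lia.
Qed.

(* The operator along the longest word is self-adjoint, so v may be moved up
   until all its low points of the window stand to the right; the longest word
   then factors through words avoiding the letter p, along which u has no jets. *)
Lemma unbalanced_vanish (p q : int) u v (b : int) (k : nat) (e : nat) : in_group m l u -> in_group m l v ->
    shuffled p u -> shuffled q v -> l <= b -> b + k%:Z <= l + m%:Z ->
    b - 1 <= p <= b + k%:Z -> b - 1 <= q <= b + k%:Z -> p + q + 1 = b + b + k%:Z ->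
    (forall z, z < b -> low p u z) -> (forall z, z < b -> low q v z) ->
    (forall z, b + k.+1%:Z <= z -> ~~ low p u z) -> (forall z, b + k.+1%:Z <= z -> ~~ low q v z) ->
    (e <= k.+1)%N -> (cnt (low p u) b e + cnt (low q v) b e < e)%N ->
  forall a, all (in_window b k) a -> jet a (S u * S v) = 0.
Proof.
move=> gu gv su sv lb bm hp hq pq lu lv hu hv ek ub.
apply: jet_om_detect => // f; rewrite mulrA.
have [N hN] := ubnP (prefix_sum (low q v) b k.+1).
elim: N u v f hN gu gv su sv lu lv hu hv ub => // N IH u v f hN gu gv su sv lu lv hu hv ub.
have wl i : in_window b k i -> in_window l m i by rewrite /in_window; lia.
have [[i hi /andP[vi vj]]|stuck] :=
    pselect (exists2 i, in_window b k i & low q v i && ~~ low q v (i + 1)).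
  pose v' := v \o simpleZ i.
  have gv' : in_group m l v' by apply: in_group_simple => //; apply: wl.
  have sv' : shuffled q v' by apply: shuffled_swap => //; rewrite vi (negbTE vj).
  have as_v' : ascent_at (low q v') i.
    by rewrite /ascent_at /low /v' /= simpleZl simpleZr; apply/andP.
  have vE : S v = D i (S v').
    rewrite (D_shuffled gv' sv' (wl _ hi)) as_v'; congr S.
    by apply: functional_extensionality => z; rewrite /v' /= simpleZK.
  move: hi (hi); rewrite {1}/in_window => hib hi.
  have lowC w z c : z <> i -> z <> i + 1 -> low c (w \o simpleZ i) z = low c w z.
    by move=> h1 h2; rewrite /low /= simpleZ_other.
  have pv : (prefix_sum (low q v') b k.+1 < N)%N.
    have := @prefix_sum_swap (low q v) b k.+1 i; rewrite vi (negbTE vj).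
    by rewrite -/(low q v'); move: (prefix_sum _ _ _) (prefix_sum _ _ _) hN; lia.
  have cv : (cnt (low q v') b e)%:Z = (cnt (low q v) b e)%:Z - (if i == b + e%:Z - 1 then 1 else 0).
    have := @cnt_swap (low q v) b e i; rewrite vi (negbTE vj) -/(low q v') => -> //; last lia.
    by case: ifP => _; lia.
  (* The Leibniz rule for f S_u. In the first term only v has changed, and its count cannot grow; in
     the second the count of u gains exactly what that of v loses. The deficit at e survives in
     both. *)
  rewrite vE jet_om_adjoint // D_mul mulrDl jet_add.
  rewrite IH ?add0r //.
  - rewrite (D_shuffled gu su (wl _ hi)); case: ifP => as_i; last by rewrite mulr0 mul0r jet0.
    have cu : (cnt (low p (u \o simpleZ i)) b e)%:Z =
        (cnt (low p u) b e)%:Z + (if i == b + e%:Z - 1 then 1 else 0).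
      rewrite -[low p _]/(low p u \o simpleZ i) cnt_swap; last lia.
      by move: as_i => /andP[/negbTE -> ->].
    apply: IH => //.
    + by apply: in_group_simple => //; apply: wl.
    + exact: shuffled_ascent.
    + by move=> z hz; rewrite lowC ?lu //; lia.
    + by move=> z hz; rewrite lowC ?lv //; lia.
    + by move=> z hz; rewrite lowC ?hu //; lia.
    + by move=> z hz; rewrite lowC ?hv //; lia.
    + by move: cu cv ub; case: ifP => _; lia.
  - by move=> z hz; rewrite lowC ?lv //; lia.
  - by move=> z hz; rewrite lowC ?hv //; lia.
  - by move: cv ub; case: ifP => _; lia.
have mono z (d : nat) : b <= z -> z + d%:Z <= b + k%:Z -> low q v z -> low q v (z + d%:Z).
  move=> h1; elim: d => [|d IHd] h2 lz; first by rewrite addr0.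
  have {IHd lz} ld : low q v (z + d%:Z) by apply: IHd => //; lia.
  have [//|nd] := boolP (low q v (z + d.+1%:Z)); case: stuck.
  exists (z + d%:Z); first by rewrite /in_window; lia.
  by rewrite ld (_ : z + d%:Z + 1 = z + d.+1%:Z) //; lia.
have cv : (cnt (low q v) b k.+1)%:Z = q - b + 1 by apply: cnt_subwindow => //; lia.
have cu : (cnt (low p u) b k.+1)%:Z = p - b + 1 by apply: cnt_subwindow => //; lia.
(* The q - b + 1 low points of v fill the right end of the window; by p + q + 1 = b + b + k this is
   the part beyond p. *)
have lowv z : b <= z <= b + k%:Z -> low q v z = (p < z).
  move=> hz; pose c := absz (z - b)%R; have kc : k.+1 = (c + (k.+1 - c))%N by rewrite /c; lia.
  have zc : b + c%:Z = z by rewrite /c; lia.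
  move: cv; rewrite {1}kc cntD zc.
  case lz : (low q v z).
    rewrite (@cnt_const _ z _ true); first by move: (cnt _ _ _); lia.
    move=> w hw; rewrite (_ : w = z + (absz (w - z)%R)%:Z); last lia.
    by apply: mono => //; lia.
  rewrite (_ : (k.+1 - c)%N = (1 + (k - c))%N); last by rewrite /c; lia.
  rewrite cntD {2}/cnt big_ord1 addr0 lz (@cnt_const _ b c false).
    by have := cnt_bound (low q v) (z + 1%:Z) (k - c); rewrite /c; lia.
  move=> w hw; apply/negbTE/negP => lw; move: lz.
  by rewrite (_ : z = w + (absz (z - w)%R)%:Z) ?mono //; lia.
have [P PE] : exists P : nat, P%:Z = p - b + 1 by exists (absz (p - b + 1)%R); lia.
(* The first e points contain exactly e - P low points of v, a truncated difference, so the deficit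
   at e becomes a deficit of u alone at P. Hence u has a large value up to p and a small one beyond
   p. *)
have lt_cP : (cnt (low p u) b P < P)%N.
  have [eP|Pe] := leqP e P.
    have := cntD (low p u) b e (P - e); rewrite subnKC // => ->.
    have := cnt_bound (low p u) (b + e%:Z) (P - e); lia.
  have := cntD (low p u) b P (e - P); rewrite subnKC; last exact: ltnW.
  have : cnt (low q v) b e = (e - P)%N.
    have := cntD (low q v) b P (e - P); rewrite subnKC; last exact: ltnW.
    move=> ->; rewrite (@cnt_const _ b P false) ?(@cnt_const _ (b + P%:Z) _ true) //.
      by move=> z hz; rewrite lowv; lia.
    by move=> z hz; rewrite lowv; lia.
  by lia.
have [z0 hz0 nz0] := cnt_lt lt_cP.
have Pk : (P <= k.+1)%N by lia.
have [|z1 hz1 lz1] := @cnt_gt0 (low p u) (b + P%:Z) (k.+1 - P).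
  have := cntD (low p u) b P (k.+1 - P); rewrite subnKC //.
  by move: cu; lia.
have Pk' : (P <= k)%N by move: hz1; lia.
have kE : k = (P + (k - P))%N by lia.
have par := om_parabolic b P (k - P); rewrite -kE in par.
rewrite (jet_braid _ _ par) jet_cat.
set y := om b P.-1 ++ _; have yw i : i \in y -> [/\ in_window b k i, i != p & in_window l m i].
  have y1 := allP (om_window b P.-1); have y2 := allP (om_window (b + P%:Z) (k - P)).
  by rewrite mem_cat => /orP[/y1|/y2]; rewrite /in_window => hi; split; lia.
rewrite Dw_mulC_invariant; last first.
  move=> i /yw [h1 h2 h3]; rewrite (D_shuffled gv sv h3) ifF //.
  by move: h1; rewrite /in_window => h1; rewrite /ascent_at !lowv; lia.
(* The factor coming from f S_u has constant term zero, since its word avoids the letter p. The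
   remaining block word has as many letters as the order of vanishing of S_v, so one more order
   makes the jet zero. *)
apply: (jet_order_mul (L := in_window b k) (e := (P * (k - P).+1)%N)).
- apply: (jet_cut (p := p) (k := p)) gu su _ _ _ _.
  + by apply/allP => i /yw [].
  + by apply/allP => i /yw [].
  + by exists z0 => //; lia.
  + by exists z1 => //; lia.
- move=> a wa sa; apply/eqP/negP => /negP/eqP nz.
  have wa' : all (in_window b k.+1) a by apply: sub_all wa => i; rewrite /in_window; lia.
  have wal : all (in_window l m) a by apply: sub_all wa => i; apply: wl.
  have := jet_size gv sv wal wa' nz.
  have -> : prefix_sum (<= q) b k.+1 = ('C((k - P).+2, 2) + P * (k - P).+1)%N.
    rewrite -(sum_minn P (k - P).+1) addnS -kE; apply: eq_bigr => d _.
    by have := cnt_le q b d; have := ltn_ord d; move: (cnt _ _ _); ifs; lia.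
  have -> : prefix_sum (low q v) b k.+1 = 'C((k - P).+2, 2).
    rewrite -(sum_sub P (k - P).+1) addnS -kE; apply: eq_bigr => d _; have hd := ltn_ord d.
    have [dP|Pd] := leqP d P.
      rewrite (@cnt_const _ b d false) /=; first lia.
      by move=> z hz; rewrite lowv; lia.
    have := cntD (low q v) b P (d - P); rewrite subnKC => [->|]; last exact: ltnW.
    rewrite (@cnt_const _ b P false) ?(@cnt_const _ (b + P%:Z) _ true) //.
      by move=> z hz; rewrite lowv; lia.
    by move=> z hz; rewrite lowv; lia.
  by lia.
- apply: sub_all (block_word_window b P (k - P).+1) => i; rewrite /in_window; lia.
by rewrite size_block_word.
Qed.

End Shuffles.

(** * Pairs without matched points *)

Lemma rainbow_clan (p q : int) : clan_of (<= p) (<= q) (rainbow p q).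
Proof.
split.
- move=> x y; rewrite /rainbow; case: ifP => // h1; case: ifP => // h2 [<-]; split; first lia.
  by rewrite !ifF; [congr Mate; lia|lia|lia].
- move=> [x [y [z [w [h1 h2 h3]]]]]; rewrite /rainbow.
  by do 2 (case: ifP => // _; case: ifP => // _ [?]); lia.
move=> z; rewrite /rainbow; split=> /= h1 h2.
- by exists (p + q + 1 - z); [rewrite !ifF //; lia|lia].
- by exists (p + q + 1 - z); [rewrite !ifF //; lia|lia].
- by rewrite ifT //; lia.
- by rewrite ifF ?ifT //; lia.
Qed.

(* Boolean hypotheses about types are irrelevant to the arithmetic side
   conditions and would make the preprocessing of lia exponential. *)
Ltac ilia := repeat match goal with X : int -> bool, H : _ |- _ =>
  match type of H with context [X _] => clear H end end; lia.

Lemma hecke_word_keep_sign a g z s : matching g -> all (fun i => (i != z) && (i + 1 != z)) a ->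
  g z = Sign s -> hecke_word a g z = Sign s.
Proof.
move=> mg; elim: a => //= i a IH /andP[/andP[h1 h2] wa] e.
by apply: hecke_keep_sign; [exact: matching_hecke_word|lia|lia|apply: IH].
Qed.

Lemma hecke_word_keep_mate a g (b r c : int) : matching g -> all (fun i => (b < i) && (i + 1 < r)) a ->
  g b = Mate c -> b < c < r -> exists2 c', b < c' < r & hecke_word a g b = Mate c'.
Proof.
move=> mg; elim: a => [|i a IH] /=; first by move=> _ e h; exists c.
move=> /andP[/andP[h1 h2] wa] e h; have [c' hc' e'] := IH wa e h.
have [|||->|->] := @hecke_keep_mate i (hecke_word a g) b c' _ _ _ e'; try lia.
- exact: matching_hecke_word.
- by exists c'.
by exists (simpleZ i c') => //; sz i c'; lia.
Qed.

(** Otherwise, as only signs lie between them, the arc of b would pass over c and the arc of c over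
    b, and the two would cross. *)
Lemma clan_adjacent_mate A B g (b c : int) : clan_of A B g -> A b && B b -> ~~ (A c || B c) -> b < c ->
  (forall z, b < z < c -> A z (+) B z) -> g b = Mate c.
Proof.
move=> cl /andP[Ab Bb]; rewrite negb_or => /andP[Ac Bc] bc sg; have [mg ng _] := cl.
have [e eb be] := clan_initial cl Ab Bb; have [d dc cd] := clan_final cl Ac Bc.
have nosign z w : g z = Mate w -> ~ (b < z < c).
  move=> ez hz; have := sg z hz; case Az : (A z); case Bz : (B z) => //= _.
    by rewrite (clan_plus cl Az (negbT Bz)) in ez.
  by rewrite (clan_minus cl (negbT Az) Bz) in ez.
have [_ ed] := mg _ _ dc; have [_ ee] := mg _ _ eb.
have ne := nosign _ _ ee; have nd := nosign _ _ ed.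
have [//|ec] := eqVneq e c; first by move=> <-.
have db : d <> b by move=> h; move: ed ec; rewrite h eb => -[->]; rewrite eqxx.
by case: ng; exists d, b, c, e; split=> //; lia.
Qed.

Section Configurations.

Variables (m : nat) (l p q : int).

Notation R := {mpoly int[m.+1]}.
Notation D := (@D m l).
Notation Dw := (@Dw m l).
Notation jet := (@jet m l).
Notation S := (@schub m l).
Notation Om := (rainbow p q).

Implicit Types (H : R) (g : preclan) (A B : int -> bool) (a : seq int).

(** A state of the parallel run of divided differences and Hecke generators. The permutations are
    hidden, since the types [A] and [B] decide how a letter acts. *)
Definition config A B H g : Prop := exists u v,
  [/\ in_group m l u /\ in_group m l v, shuffled p u /\ shuffled q v,
      low p u = A /\ low q v = B, H = S u * S v & clan_of A B g].

Lemma config_clan A B H g : config A B H g -> clan_of A B g.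
Proof. by move=> [u [v []]]. Qed.

Lemma config_trivial A B H g i : in_window l m i -> config A B H g ->
  ~~ ascent_at A i -> ~~ ascent_at B i -> D i H = 0 /\ hecke_gen i g = g.
Proof.
move=> hi [u [v [[gu gv] [su sv] [<- <-] -> c]]] nA nB; split; last exact: clan_trivial c nA nB.
rewrite D_mulC_invariant.
  by rewrite (D_shuffled gu su hi) (negbTE nA) mul0r.
by rewrite (D_shuffled gv sv hi) (negbTE nB).
Qed.

Lemma config_stepA A B H g i : in_window l m i -> config A B H g ->
  ascent_at A i -> ~~ ascent_at B i -> config (A \o simpleZ i) B (D i H) (hecke_gen i g).
Proof.
move=> hi [u [v [[gu gv] [su sv] [<- <-] -> c]]] nA nB; exists (u \o simpleZ i), v; split=> //.
- by split=> //; exact: in_group_simple.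
- by split=> //; exact: shuffled_ascent.
- by rewrite D_mulC_invariant ?(D_shuffled gu su hi) ?nA // (D_shuffled gv sv hi) (negbTE nB).
exact: clan_stepA.
Qed.

Lemma config_stepB A B H g i : in_window l m i -> config A B H g ->
  ~~ ascent_at A i -> ascent_at B i -> config A (B \o simpleZ i) (D i H) (hecke_gen i g).
Proof.
move=> hi [u [v [[gu gv] [su sv] [<- <-] -> c]]] nA nB; exists u, (v \o simpleZ i); split=> //.
- by split=> //; exact: in_group_simple.
- by split=> //; exact: shuffled_ascent.
- rewrite mulrC D_mulC_invariant ?(D_shuffled gv sv hi) ?nB 1?mulrC //.
  by rewrite (D_shuffled gu su hi) (negbTE nA).
exact: clan_stepB.
Qed.

Lemma config_move A B H g i : in_window l m i -> config A B H g ->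
    A i = A (i + 1) /\ ascent_at B i \/ B i = B (i + 1) /\ ascent_at A i ->
  config (A \o simpleZ i) (B \o simpleZ i) (D i H) (hecke_gen i g).
Proof.
move=> hi c [[e nB]|[e nA]].
  rewrite [X in config X](comp_simpleZ_same e); apply: config_stepB => //.
  by rewrite /ascent_at e; case: (A _).
rewrite [X in config _ X](comp_simpleZ_same e); apply: config_stepA => //.
by rewrite /ascent_at e; case: (B _).
Qed.

Lemma config_pair A B H g i : in_window l m i -> config A B H g ->
    A i (+) B i -> A (i + 1) (+) B (i + 1) -> A i != A (i + 1) ->
  exists A' B', [/\ config A' B' (D i H) (hecke_gen i g), A' i && B' i, ~~ (A' (i + 1) || B' (i + 1)) &
    forall z, z <> i -> z <> i + 1 -> A' z = A z /\ B' z = B z].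
Proof.
move=> hi c; case Ai : (A i); case Bi : (B i); case Aj : (A (i + 1)); case Bj : (B (i + 1)) => //= _ _ _.
  exists A, (B \o simpleZ i); rewrite /= simpleZl simpleZr Ai Aj Bi Bj; split=> //.
    by apply: config_stepB => //; rewrite /ascent_at ?Ai ?Bi ?Bj.
  by move=> z h1 h2; rewrite simpleZ_other.
exists (A \o simpleZ i), B; rewrite /= simpleZl simpleZr Ai Aj Bi Bj; split=> //.
  by apply: config_stepA => //; rewrite /ascent_at ?Ai ?Aj ?Bi.
by move=> z h1 h2; rewrite simpleZ_other.
Qed.

(** A final point is exchanged with the signs to its right one by one, each letter being effective;
    [run_left] does the same for an initial point. *)
Lemma run_right (d : nat) (j : int) A B H g : (forall i, in_window j d i -> in_window l m i) ->
    config A B H g -> ~~ (A j || B j) -> (forall z, j < z <= j + d%:Z -> A z (+) B z) ->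
  exists A' B', [/\ config A' B' (Dw (dn j d) H) (hecke_word (dn j d) g), ~~ (A' (j + d%:Z) || B' (j + d%:Z)),
    forall z, j <= z < j + d%:Z -> A' z (+) B' z &
    forall z, ~~ (j <= z <= j + d%:Z) -> A' z = A z /\ B' z = B z].
Proof.
elim: d j A B H g => [|d IH] j A B H g hw c nj sg.
  by exists A, B; rewrite addr0; split=> // z; lia.
have hi : in_window l m j by apply: hw; rewrite /in_window; lia.
have sj : A (j + 1) (+) B (j + 1) by apply: sg; lia.
have c1 : config (A \o simpleZ j) (B \o simpleZ j) (D j H) (hecke_gen j g).
  apply: config_move => //; move: sj nj; rewrite /ascent_at.
  by case: (A j); case: (B j); case: (A (j + 1)); case: (B (j + 1)) => //= _ _; [right|left].
have [|||A' [B' [c' n' s' o']]] := IH (j + 1) _ _ _ _ _ c1.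
- by move=> i hi'; apply: hw; move: hi'; rewrite /in_window; lia.
- by rewrite /= simpleZr.
- by move=> z hz; rewrite /= simpleZ_other; [apply: sg| |]; lia.
exists A', B'; rewrite dnSr /hecke_word foldr_rcons Dw_rcons.
rewrite (_ : j + d.+1%:Z = j + 1 + d%:Z); last lia.
split=> // z hz.
  have [->|ne] := eqVneq z j; last by apply: s'; lia.
  by have [|-> ->] := o' j; [lia|rewrite /= simpleZl].
by have [|-> ->] := o' z; [lia|rewrite /= simpleZ_other //; lia].
Qed.

Lemma run_left (d : nat) (j : int) A B H g : (forall i, in_window j d i -> in_window l m i) ->
    config A B H g -> A (j + d%:Z) && B (j + d%:Z) -> (forall z, j <= z < j + d%:Z -> A z (+) B z) ->
  exists A' B', [/\ config A' B' (Dw (up j d) H) (hecke_word (up j d) g), A' j && B' j,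
    forall z, j < z <= j + d%:Z -> A' z (+) B' z &
    forall z, ~~ (j <= z <= j + d%:Z) -> A' z = A z /\ B' z = B z].
Proof.
elim: d A B H g => [|d IH] A B H g hw c nj sg.
  by exists A, B; rewrite addr0 in nj; split=> // z; lia.
have hi : in_window l m (j + d%:Z) by apply: hw; rewrite /in_window; lia.
have sj : A (j + d%:Z) (+) B (j + d%:Z) by apply: sg; lia.
have jE : j + d.+1%:Z = j + d%:Z + 1 by lia.
move: nj sg; rewrite jE => nj sg.
have c1 : config (A \o simpleZ (j + d%:Z)) (B \o simpleZ (j + d%:Z)) (D (j + d%:Z) H) (hecke_gen (j + d%:Z) g).
  apply: config_move => //; move: sj nj; rewrite /ascent_at.
  by case: (A (j + d%:Z)); case: (B (j + d%:Z)); case: (A (_ + 1)); case: (B (_ + 1)) => //= _ _; [left|right].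
have [|||A' [B' [c' n' s' o']]] := IH _ _ _ _ _ c1.
- by move=> i hi'; apply: hw; move: hi'; rewrite /in_window; lia.
- by rewrite /= simpleZl.
- by move=> z hz; rewrite /= simpleZ_other; [apply: sg| |]; lia.
exists A', B'; rewrite upSr /hecke_word foldr_rcons Dw_rcons.
split=> // z hz.
  have [->|ne] := eqVneq z (j + d%:Z + 1); last by apply: s'; lia.
  by have [|-> ->] := o' (j + d%:Z + 1); [lia|rewrite /= simpleZr].
by have [|-> ->] := o' z; [lia|rewrite /= simpleZ_other //; lia].
Qed.

(** The first clause handles words that lose a letter: if a word of N letters acted on the clan like
    a shorter one, it could not reach the rainbow, in accordance with its zero jet. *)
Definition good (N : nat) H g a : Prop :=
  [/\ hecke_word a g = Om -> (N <= size a)%N, size a = N -> hecke_word a g = Om -> jet a H = 1 &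
      size a = N -> hecke_word a g <> Om -> jet a H = 0].

Lemma good_braid N H g a a' : braid_eq a a' -> matching g -> good N H g a' -> good N H g a.
Proof.
by move=> e mg; rewrite /good (hecke_word_braid e mg) (jet_braid _ _ e) (braid_size e).
Qed.

Lemma good_zero N H g a : hecke_word a g <> Om -> jet a H = 0 -> good N H g a.
Proof. by move=> h j; split. Qed.

Lemma good_shorter N H g a a' : jet a H = 0 -> hecke_word a g = hecke_word a' g ->
  (size a' < size a)%N -> good N H g a' -> good N H g a.
Proof.
move=> j e s [h1 _ _]; split=> //; rewrite e; first by move/h1; lia.
by move=> sN /h1; lia.
Qed.

Lemma good_drop N H g x y i : D i (Dw y H) = 0 -> hecke_gen i (hecke_word y g) = hecke_word y g ->
  good N H g (x ++ y) -> good N H g (x ++ i :: y).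
Proof.
move=> d e; apply: good_shorter; last by rewrite !size_cat /=; lia.
  by rewrite jet_cat /= d jet0.
by rewrite !hecke_word_cat /= -/(hecke_word y g) e.
Qed.

Lemma good_cat N N' H g x y : good N' (Dw y H) (hecke_word y g) x -> N = (N' + size y)%N ->
  good N H g (x ++ y).
Proof.
move=> [h1 h2 h3] ->; rewrite /good jet_cat hecke_word_cat size_cat; split.
- by move/h1; rewrite leq_add2r.
- by move/addIn; apply: h2.
by move/addIn; apply: h3.
Qed.

Definition matchless (b : int) (k : nat) A B : Prop :=
  [/\ forall z, z < b -> A z && B z, forall z, b + k%:Z <= z -> ~~ (A z || B z) &
      forall z, b <= z < b + k%:Z -> A z (+) B z].

Lemma config_cut A B H g a (k : int) : config A B H g -> all (in_window l m) a -> all (predC1 k) a ->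
    (exists2 z, z <= k & ~~ A z) /\ (exists2 z, k < z & A z) \/
    (exists2 z, z <= k & ~~ B z) /\ (exists2 z, k < z & B z) ->
  jet a H = 0.
Proof.
move=> [u [v [[gu gv] [su sv] [<- <-] -> _]]] wa ca [[h1 h2]|[h1 h2]].
  by rewrite mulrC (jet_cut (p := p) (k := k)).
by rewrite (jet_cut (p := q) (k := k)).
Qed.

Lemma config_cnt A B H g (b : int) (k : nat) : config A B H g ->
    l - 1 <= p <= l + m%:Z -> l - 1 <= q <= l + m%:Z -> l <= b -> b + k%:Z <= l + m%:Z + 1 ->
    (forall z, z < b -> A z && B z) -> (forall z, b + k%:Z <= z -> ~~ (A z || B z)) ->
  (cnt A b k)%:Z = p - b + 1 /\ (cnt B b k)%:Z = q - b + 1.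
Proof.
move=> [u [v [[gu gv] [su sv] [<- <-] _ _]]] hp hq lb br lo hi; split.
  by apply: (cnt_subwindow gu) => // z hz; [case/andP: (lo z hz)|case/norP: (hi z hz)].
by apply: (cnt_subwindow gv) => // z hz; [case/andP: (lo z hz)|case/norP: (hi z hz)].
Qed.

Lemma config_vanish A B H g (b : int) (k e : nat) : config A B H g -> l <= b -> b + k%:Z <= l + m%:Z ->
    b - 1 <= p <= b + k%:Z -> b - 1 <= q <= b + k%:Z -> p + q + 1 = b + b + k%:Z ->
    (forall z, z < b -> A z && B z) -> (forall z, b + k.+1%:Z <= z -> ~~ (A z || B z)) ->
    (e <= k.+1)%N -> (cnt A b e + cnt B b e < e)%N ->
  forall a, all (in_window b k) a -> jet a H = 0.
Proof.
move=> [u [v [[gu gv] [su sv] [<- <-] -> _]]] lb bm hp hq pq lo hi ek ce a wa.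
by apply: (unbalanced_vanish (p := p) (q := q) (b := b) (k := k) (e := e)) => // z hz;
  [case/andP: (lo z hz)|case/andP: (lo z hz)|case/norP: (hi z hz)|case/norP: (hi z hz)].
Qed.

Lemma config_flat A B H g : config A B H g -> (forall i, ~~ ascent_at A i) ->
  (forall i, ~~ ascent_at B i) -> H = 1 /\ g = Om.
Proof.
move=> [u [v [[gu gv] [su sv] [<- <-] -> cl]]] nA nB.
have uE := shuffled_id gu su nA; have vE := shuffled_id gv sv nB; subst u v.
rewrite schub_id mulr1; split=> //; apply: clan_unique cl _; exact: rainbow_clan.
Qed.

Lemma config_equal A B H g i : in_window l m i -> config A B H g ->
    A i (+) B i -> A (i + 1) (+) B (i + 1) -> A i = A (i + 1) ->
  D i H = 0 /\ hecke_gen i g = g.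
Proof.
move=> hi cf si sj e; apply: config_trivial hi cf _ _; move: si sj; rewrite /ascent_at e;
  by case: (A _); case: (B i); case: (B (i + 1)).
Qed.

Lemma rainbow_sign_out g z s a : matching g ->
  g z = Sign s -> all (fun i => (i != z) && (i + 1 != z)) a ->
  z <= p /\ z <= q \/ p < z /\ q < z -> hecke_word a g <> Om.
Proof.
move=> mg gz wa hz /(congr1 (fun f => f z)).
rewrite (hecke_word_keep_sign mg wa gz) /rainbow !ifF //; lia.
Qed.

Lemma config_sign A B H g z : config A B H g -> A z (+) B z -> exists s, g z = Sign s.
Proof.
move=> /config_clan cl; case Az : (A z); case Bz : (B z) => //= _.
  by exists true; apply: clan_plus cl _ _; rewrite ?Az ?Bz.
by exists false; apply: clan_minus cl _ _; rewrite ?Az ?Bz.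
Qed.

Lemma matchless_flat (b : int) (k : nat) A B H g a : matchless b k A B -> config A B H g ->
    (forall z, b <= z < b + k%:Z -> ~~ A z) \/ (forall z, b <= z < b + k%:Z -> ~~ B z) ->
  good 0 H g a.
Proof.
move=> [lo hi sg] cf h.
have nAB i : ~~ ascent_at A i /\ ~~ ascent_at B i.
  have hl z : z < b -> A z /\ B z by move=> /lo /andP.
  have hh z : b + k%:Z <= z -> ~~ A z /\ ~~ B z by move=> /hi /norP.
  have [i1|i1] := ltP i b; first by have [h1 h2] := hl _ i1; rewrite /ascent_at h1 h2.
  have [j1|j1] := leP (b + k%:Z) (i + 1).
    by have [h1 h2] := hh _ j1; rewrite /ascent_at (negbTE h1) (negbTE h2) !andbF.
  have si : A i (+) B i by apply: sg; lia.
  have sj : A (i + 1) (+) B (i + 1) by apply: sg; lia.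
  move: si sj; rewrite /ascent_at.
  case: h => h; have := h i; have := h (i + 1); case: (A i); case: (B i); case: (A (i + 1)); case: (B (i + 1)) => //=; lia.
have [-> ->] := config_flat cf (fun i => (nAB i).1) (fun i => (nAB i).2).
split=> //; case: a => //= _; last by rewrite /jet /= eps1.
Qed.

(* In the normal form a2 ++ up b k2 ++ dn be k1, the right factor pairs the signs
   at be and be + 1 and moves the final point to the end r of the window. If the
   next factor moves the initial point to b, the window shrinks by both ends;
   otherwise a sign or an arc ends at a wrong place and the jet vanishes. *)
Lemma matchless_good (P Q : nat) (b : int) A B H g : p = b + P%:Z - 1 -> q = b + Q%:Z - 1 ->
    l <= b -> b + (P + Q)%N%:Z - 1 <= l + m%:Z -> matchless b (P + Q) A B -> config A B H g ->
  forall a, all (in_window b (P + Q).-1) a -> good (P * Q) H g a.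
Proof.
elim: P Q b A B H g => [|P IH] Q b A B H g hp hq lb br ml cf a.
  have [lo hi _] := ml; have [|||cA _] := config_cnt cf _ _ lb _ lo hi; try lia.
  move=> _; rewrite mul0n; by apply: (matchless_flat _ ml cf); left; apply: cnt_empty; lia.
case: Q hq br ml => [|Q] hq br ml.
  rewrite muln0; have [lo hi _] := ml; have [|||_ cB] := config_cnt cf _ _ lb _ lo hi; try lia.
  by move=> _; apply: (matchless_flat _ ml cf); right; apply: cnt_empty; lia.
(* The inner induction on length serves the words in which a letter has no effect. *)
have [N] := ubnP (size a); elim: N a => // N IHa a sN.
rewrite addnS /= addSn => wa; have [mg _ _] := config_clan cf.
have [lo hi sg] := ml.
have wl i : in_window b (P + Q).+1 i -> in_window l m i by rewrite /in_window; ilia.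
have wlw x : all (in_window b (P + Q).+1) x -> all (in_window l m) x.
  by move=> h; apply: sub_all h.
have [sq|[a2 [k2 [k1 [w2 hk2 hk1 e]]]]] := split_both wa.
  have [a' [s' w'] e'] := hecke_word_squareful sq mg.
  apply: (good_shorter (a' := a')) => //; first exact: jet_squareful.
  by apply: IHa; [ilia|rewrite addnS addSn; apply: w'].
apply: (good_braid e mg).
move: sN wa; rewrite (braid_size e) (braid_all _ e) => sN wa {e a}.
have drop x i y : (size (x ++ i :: y) < N.+1)%N -> all (in_window b (P + Q).+1) (x ++ i :: y) ->
    D i (Dw y H) = 0 -> hecke_gen i (hecke_word y g) = hecke_word y g ->
    good (P.+1 * Q.+1) H g (x ++ i :: y).
  rewrite size_cat all_cat /= => sx /and3P[wx _ wy] h1 h2; apply: good_drop => //.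
  by apply: IHa; rewrite ?size_cat ?addnS ?addSn ?all_cat ?wx //; ilia.
move: sN wa; have [r rE] : exists r : int, r = b + (P + Q).+1%:Z by exists (b + (P + Q).+1%:Z).
have [be beE] : exists be : int, be = r - k1%:Z by exists (r - k1%:Z).
rewrite -rE -beE => sN wa.
have hi' z : r < z -> ~~ (A z || B z) by move=> hz; apply: hi; ilia.
have sg' z : b <= z <= r -> A z (+) B z by move=> hz; apply: sg; ilia.
have [cA cB] : (cnt A b (P + Q).+2)%:Z = p - b + 1 /\ (cnt B b (P + Q).+2)%:Z = q - b + 1.
  by apply: (config_cnt cf) => //; [ilia|ilia|ilia|move=> z hz; apply: hi'; ilia].
(* For k1 = 0 the letter r - 1 does not occur and the sign at r stays, but r exceeds p and q and the
   rainbow has an arc there. *)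
have [k10|k1p] := posnP k1.
  have [s gs] := config_sign cf (sg' r ltac:(ilia)).
  have wr : all (fun i => (b <= i) && (i + 1 < r)) (a2 ++ up b k2).
    rewrite all_cat; apply/andP; split; last by apply/allP => i; rewrite mem_up; ilia.
    by apply: sub_all w2 => i; rewrite /in_window; ilia.
  rewrite k10 cats0; apply: good_zero.
    apply: (rainbow_sign_out mg gs); last by ilia.
    by apply: sub_all wr => i; ilia.
  apply: (config_cut (k := r - 1) cf).
  - by apply: wlw; apply: sub_all wr => i; rewrite /in_window; ilia.
  - by apply: sub_all wr => i /=; ilia.
  have sr := sg' r ltac:(ilia).
  move: cA cB; rewrite !(cntS _ b (P + Q).+1) -rE; case Ar : (A r) sr; case Br : (B r) => //= _ cA cB.
    left; split; last by exists r => //; ilia.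
    have [|z hz nz] := @cnt_lt A b (P + Q).+1; first ilia.
    by exists z => //; ilia.
  right; split; last by exists r => //; ilia.
  have [|z hz nz] := @cnt_lt B b (P + Q).+1; first ilia.
  by exists z => //; ilia.
have dnE : dn be k1 = rcons (dn (be + 1) k1.-1) be by rewrite -dnSr prednK.
have hbe : in_window l m be by apply: wl; rewrite /in_window; ilia.
have sbe : A be (+) B be by apply: sg'; ilia.
have sbe' : A (be + 1) (+) B (be + 1) by apply: sg'; ilia.
(* Equal signs at be and be + 1: the letter kills the polynomial and fixes the clan. Opposite signs
   become an arc. *)
have [eqA|neA] := eqVneq (A be) (A (be + 1)).
  have [h1 h2] := config_equal hbe cf sbe sbe' eqA.
  by move: sN wa; rewrite dnE -cats1 catA => sN wa; apply: drop.
have [A1 [B1 [c1 p1 n1 o1]]] := config_pair hbe cf sbe sbe' neA.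
have [|||A2 [B2 [c2 n2 s2 o2]]] := run_right (d := k1.-1) (j := be + 1) _ c1.
- by move=> i; rewrite /in_window => hi1; apply: wl; rewrite /in_window; move: hi1; ilia.
- exact: n1.
- move=> z hz; have [|| -> ->] := o1 z; [ilia|ilia|apply: sg'].
  by ilia.
move: c2; rewrite -Dw_rcons -[hecke_word _ (hecke_gen _ _)](foldr_rcons hecke_gen) -dnE.
set y := dn be k1 => c2; rewrite -/y in sN wa *.
have f1 : A2 be && B2 be by have [|-> ->] := o2 be; [ilia|].
have f2 : ~~ (A2 r || B2 r) by move: n2; rewrite (_ : be + 1 + _ = r) //; ilia.
have f3 z : b <= z < r -> z <> be -> A2 z (+) B2 z.
  move=> hz nz; have [lt|ge] := ltP be z; first by apply: s2; ilia.
  have [|-> ->] := o2 z; first ilia.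
  by have [||-> ->] := o1 z; [ilia|ilia|apply: sg'; ilia].
have bbe : b <= be < r by ilia.
have f4 z : z < b -> A2 z && B2 z.
  move=> hz; have [|-> ->] := o2 z; first ilia.
  by have [||-> ->] := o1 z; [ilia|ilia|apply: lo].
have f5 z : r < z -> ~~ (A2 z || B2 z).
  move=> hz; have [|-> ->] := o2 z; first by ilia.
  by have [||-> ->] := o1 z; [ilia|ilia|apply: hi'].
have {c1 A1 B1 p1 n1 o1 n2 s2 o2 neA sbe sbe'} sy : size y = k1 by rewrite size_dn.
have bk1 : be + k1%:Z = r by ilia.
have mg2 : matching (hecke_word y g) by exact: matching_hecke_word.
have wa2 : all (in_window l m) a2 by apply: sub_all w2 => i hi2; apply: wl; move: hi2; rewrite /in_window; ilia.
have [cbe|cbe] := eqVneq (b + k2%:Z) be.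
  have [|||A3 [B3 [c3 p3 s3 o3]]] := run_left (d := k2) (j := b) _ c2.
  - by move=> i; rewrite /in_window => hi1; apply: wl; rewrite /in_window; ilia.
  - by rewrite cbe.
  - by move=> z hz; apply: f3; ilia.
  (* Now k1 + k2 = r - b = P + Q + 1, the difference between (P + 1)(Q + 1) and P Q. *)
  apply: (good_cat (N' := P * Q + k2)); last by rewrite sy; ilia.
  apply: (good_cat (N' := P * Q)); last by rewrite size_up.
  apply: IH c3 _ w2 => //; try ilia.
  split=> z hz.
  - have [->//|ne] := eqVneq z b.
    by have [|-> ->] := o3 z; [ilia|apply: f4; ilia].
  - have [|-> ->] := o3 z; first ilia.
    by have [->//|ne] := eqVneq z r; apply: f5; ilia.
  have [le|gt] := leP z be; first by apply: s3; ilia.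
  by have [|-> ->] := o3 z; [ilia|apply: f3; ilia].
(* For k2 = 0 and be > b the sign at b is never touched, although b is at most p and q and the
   rainbow has an arc there. *)
case: k2 hk2 sN wa cbe => [|k] hk sN wa cbe.
  rewrite cats0; rewrite addr0 in cbe.
  have sb : A2 b (+) B2 b by apply: f3; ilia.
  have [s gs] := config_sign c2 sb.
  apply: good_zero.
    rewrite hecke_word_cat; apply: (rainbow_sign_out mg2 gs); last by ilia.
    by apply: sub_all w2 => i; rewrite /in_window; ilia.
  rewrite jet_cat; apply: (config_cut (k := b) c2) => //.
    by apply: sub_all w2 => i; rewrite /in_window /=; ilia.
  move: f1 => /andP[f1A f1B]; have bb : b < be by ilia.
  by case Ab : (A2 b) sb; case Bb : (B2 b) => //= _; [right|left]; split;
    [exists b; rewrite ?Bb|exists be|exists b; rewrite ?Ab|exists be].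
have E x : (x ++ up b k.+1) ++ y = (x ++ up b k) ++ (b + k%:Z) :: y.
  by rewrite upSr -cats1 -!catA.
rewrite E in sN wa *.
have hk' : in_window l m (b + k%:Z) by apply: wl; rewrite /in_window; ilia.
(* At be the letter meets an initial point on its left, where neither type can ascend, so it has no
   effect. *)
have [ebe|nbe] := eqVneq (b + k%:Z) be.
  move: f1 => /andP[f1A f1B].
  have [||h1 h2] := config_trivial hk' c2; try by rewrite /ascent_at ebe ?f1A ?f1B.
  exact: drop.
have sk : A2 (b + k%:Z) (+) B2 (b + k%:Z) by apply: f3; ilia.
have sk' : A2 (b + k%:Z + 1) (+) B2 (b + k%:Z + 1) by apply: f3; ilia.
have [eqA|neA] := eqVneq (A2 (b + k%:Z)) (A2 (b + k%:Z + 1)).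
  by have [h1 h2] := config_equal hk' c2 sk sk' eqA; apply: drop.
have [A3 [B3 [c3 p3 n3 o3]]] := config_pair hk' c2 sk sk' neA.
(* If the second pairing happens to the right of be, its initial point travels left until it meets
   the initial point at be; the letter be then finds two initial points and has no effect. *)
have [lt|gt] := ltP be (b + k%:Z).
  have [k0 k0E] : exists k0 : nat, k0%:Z = be - b by exists (absz (be - b)%R); ilia.
  have [d dE] : exists d : nat, d = (k - k0.+1)%N by exists (k - k0.+1)%N.
  have kE : k = (k0 + d.+1)%N by ilia.
  have E2 : (a2 ++ up b k) ++ (b + k%:Z) :: y =
      (a2 ++ up b k0) ++ be :: (up (be + 1) d ++ (b + k%:Z) :: y).
    rewrite {1}kE upD (_ : b + k0%:Z = be); last by ilia.
    by rewrite -add1n upD /up /= addr0 -!catA.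
  rewrite E2 in sN wa *.
  have [|||A4 [B4 [c4 p4 s4 o4]]] := run_left (d := d) (j := be + 1) _ c3.
  - by move=> i; rewrite /in_window => hi1; apply: wl; rewrite /in_window; ilia.
  - by rewrite (_ : be + 1 + d%:Z = b + k%:Z) //; ilia.
  - move=> z hz; have [||-> ->] := o3 z; try by ilia.
    by apply: f3; ilia.
  have /andP[q4 q4'] : A4 be && B4 be.
    by have [|-> ->] := o4 be; [ilia|have [||-> ->] := o3 be; [ilia|ilia|]].
  have [||h1 h2] := config_trivial hbe c4; try by rewrite /ascent_at ?q4 ?q4'.
  by apply: drop => //; rewrite ?Dw_cat ?hecke_word_cat.
(* If it happens to the left of be, the new arc joins b to b + k + 1. The letters of [a2] cannot
   bring its right end to r, where the rainbow wants it. *)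
have [|||A4 [B4 [c4 p4 s4 o4]]] := run_left (d := k) (j := b) _ c3.
- by move=> i; rewrite /in_window => hi1; apply: wl; rewrite /in_window; ilia.
- exact: p3.
- move=> z hz; have [||-> ->] := o3 z; try ilia.
  by apply: f3; ilia.
have e4 z : b + k%:Z < z -> A4 z = A3 z /\ B4 z = B3 z by move=> hz; apply: o4; ilia.
have n4 : ~~ (A4 (b + k%:Z + 1) || B4 (b + k%:Z + 1)) by have [|-> ->] := e4 (b + k%:Z + 1); [ilia|].
have g4 z : b + k%:Z + 1 < z -> A4 z = A2 z /\ B4 z = B2 z.
  by move=> hz; have [|-> ->] := e4 z; [ilia|apply: o3; ilia].
have l4 z : z < b -> A4 z && B4 z.
  by move=> hz; have [|-> ->] := o4 z; [ilia|have [||-> ->] := o3 z; [ilia|ilia|apply: f4]].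
have mt := clan_adjacent_mate (config_clan c4) p4 n4.
have {}mt : hecke_word (up b k) (hecke_gen (b + k%:Z) (hecke_word y g)) b = Mate (b + k%:Z + 1).
  by apply: mt => [|z hz]; [ilia|apply: s4; ilia].
rewrite -catA; apply: good_zero.
  move=> /(congr1 (fun f => f b)); rewrite !hecke_word_cat /=.
  have [|||c' hc' ->] := @hecke_word_keep_mate a2 _ b r _ _ _ mt _.
  - by have [] := config_clan c4.
  - by apply: sub_all w2 => i; rewrite /in_window; ilia.
  - by ilia.
  by rewrite /rainbow !ifF; [move=> [h]; move: hc'; rewrite h; ilia|ilia|ilia].
rewrite jet_cat.
(* The first k + 1 points of the inner window are k signs and one final point; a sign counts once
   and a final point not at all, which gives the deficit. *)
rewrite Dw_cat /=; apply: (config_vanish (b := b + 1) (k := (P + Q).-1) (e := k.+1) c4) => //; try ilia.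
- move=> z hz; have [->//|ne] := eqVneq z b; by apply: l4; ilia.
- move=> z hz; have [|-> ->] := g4 z; first by ilia.
  by have [->//|ne] := eqVneq z r; apply: f5; ilia.
rewrite !cntS (_ : b + 1 + k%:Z = b + k%:Z + 1); last by ilia.
move: n4; rewrite negb_or => /andP[/negbTE -> /negbTE ->].
rewrite !addn0 cnt_signs // => z hz; apply: s4; ilia.
Qed.

End Configurations.

(** * Arbitrary pairs *)

Section Unwinding.

Variables (m : nat) (l p q : int).
Hypotheses (pq : p + q + 1 = l + l + m%:Z) (lp : l - 1 <= p <= l + m%:Z) (lq : l - 1 <= q <= l + m%:Z).

Notation R := {mpoly int[m.+1]}.
Notation D := (@D m l).
Notation Dw := (@Dw m l).
Notation S := (@schub m l).
Notation config := (@config m l p q).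

Implicit Types (H : R) (g : preclan) (A B : int -> bool) (a : seq int) (u v : int -> int).

Definition rainbow_outside g : Prop :=
  forall z, ~~ (l <= z <= l + m%:Z) -> g z = Mate (l + l + m%:Z - z).

Lemma matchless_clan A B : matchless l m.+1 A B ->
  exists2 g, clan_of A B g & rainbow_outside g.
Proof.
move=> [lo hi sg].
pose g : preclan := fun z => if l <= z <= l + m%:Z then Sign (A z) else Mate (l + l + m%:Z - z).
exists g; last by move=> z /negbTE hz; rewrite /g hz.
split.
- move=> a b; rewrite /g; case: ifP => // h [<-]; split; first lia.
  by rewrite ifF; [congr Mate; lia|lia].
- move=> [a [b [c [d [h1 h2 h3]]]]]; rewrite /g; case: ifP => // _ [?]; case: ifP => // _ [?]; lia.
move=> z; have lo' := lo z; have hi' := hi z; have sg' := sg z.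
rewrite /initial /final /g; case: ifPn => hz.
  have := sg' ltac:(lia); case: (A z); case: (B z) => //= _; split=> //.
have [lt|ge] := ltP z l.
  have /andP[-> ->] := lo' lt; split=> // _ _; exists (l + l + m%:Z - z) => //; ilia.
have /norP[/negbTE -> /negbTE ->] := hi' ltac:(lia).
by split=> // _ _; exists (l + l + m%:Z - z) => //; ilia.
Qed.

Lemma rainbow_outside_hecke i g : matching g -> in_window l m i -> rainbow_outside g ->
  rainbow_outside (hecke_gen i g).
Proof.
move=> mg; rewrite /in_window => hi og z hz.
have [||->|->] := @hecke_keep_mate i g z _ mg _ _ (og z hz); try lia; first by [].
by rewrite simpleZ_other //; lia.
Qed.

Lemma low_outside c u z : in_group m l u -> l - 1 <= c <= l + m%:Z ->
  (z < l -> low c u z) /\ (l + m%:Z < z -> ~~ low c u z).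
Proof.
by move=> gu hc; split=> hz; rewrite /low (in_group_fix gu) //; lia.
Qed.

Lemma cnt_total u v : in_group m l u -> in_group m l v ->
  (cnt (low p u) l m.+1 + cnt (low q v) l m.+1 = m.+1)%N.
Proof. by move=> gu gv; have := cnt_group gu lp; have := cnt_group gv lq; lia. Qed.

(** An initial point counts twice, a sign once, a final point not at all: every prefix has at least
    as many initial as final points. *)
Definition ballot A B : Prop := forall e, (e <= m.+1)%N -> (e <= cnt A l e + cnt B l e)%N.

Lemma cnt_xor A B (b : int) k : (forall z, b <= z < b + k%:Z -> ~~ (A z && B z)) ->
  cnt (fun z => A z (+) B z) b k = (cnt A b k + cnt B b k)%N.
Proof.
elim: k => [|k IH] h; first by rewrite /cnt !big_ord0.
have := h (b + k%:Z); rewrite !cntS IH => [|z hz]; last by apply: h; lia.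
by case: (A _); case: (B _) => //=; lia.
Qed.

(** An initial point would be followed by initial points up to the end. The last one counts twice in
    a total of m + 1, so the first m points would violate the ballot condition. Without initial
    points the total forces each point to count exactly once. *)
Lemma ballot_matchless u v : in_group m l u -> in_group m l v -> ballot (low p u) (low q v) ->
    (forall i, in_window l m i -> low p u i -> low q v i -> low p u (i + 1) && low q v (i + 1)) ->
  matchless l m.+1 (low p u) (low q v).
Proof.
move=> gu gv bal stuck.
have noopen z : l <= z < l + m.+1%:Z -> ~~ (low p u z && low q v z).
  move=> hz; apply/negP => oz.
  have H (d : nat) : z + d%:Z <= l + m%:Z -> low p u (z + d%:Z) && low q v (z + d%:Z).
    elim: d => [|d IH] hd; first by rewrite addr0.
    have /andP[h1 h2] := IH ltac:(lia); rewrite (_ : z + d.+1%:Z = z + d%:Z + 1); last lia.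
    by apply: stuck => //; rewrite /in_window; lia.
  have := H (absz (l + m%:Z - z)%R) ltac:(lia).
  rewrite (_ : z + _ = l + m%:Z); last lia.
  move=> /andP[h1 h2]; have := cnt_total gu gv; have := bal m (leqnSn m).
  by rewrite !cntS h1 h2; lia.
split.
- by move=> z hz; apply/andP; split; [apply: (low_outside z gu lp).1|apply: (low_outside z gv lq).1].
- move=> z hz; rewrite negb_or; apply/andP.
  by split; [apply: (low_outside z gu lp).2|apply: (low_outside z gv lq).2]; lia.
move=> z; apply: (@cnt_full (fun z => low p u z (+) low q v z)).
by rewrite cnt_xor // cnt_total.
Qed.

Lemma ballot_sym A B : ballot A B -> ballot B A.
Proof. by move=> h e he; rewrite addnC; apply: h. Qed.

(** Only the prefix ending at i loses a point. There i counted twice, so the condition for the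
    prefix before it leaves one to spare. *)
Lemma ballot_swap A B i : in_window l m i -> A i -> B i -> ~~ A (i + 1) -> ballot A B ->
  ballot (A \o simpleZ i) B.
Proof.
rewrite /in_window => hi Ai Bi Aj bal e he; have := bal e he.
have := @cnt_swap A l e i ltac:(lia).
rewrite Ai (negbTE Aj); case: eqP => ee; last by rewrite addr0 => -[->].
have e1 : e = e.-1.+1 by lia.
have cS (C : int -> bool) : C i -> cnt C l e = (cnt C l e.-1).+1.
  by move=> Ci; rewrite {1}e1 cntS (_ : l + e.-1%:Z = i) ?Ci ?addn1 //; lia.
have := bal e.-1 ltac:(lia); rewrite (cS _ Ai) (cS _ Bi).
by move: (cnt _ _ _) (cnt _ _ _) (cnt _ _ _); clear -e1; lia.
Qed.

Lemma unshuffle c u i : in_group m l u -> shuffled c u -> in_window l m i ->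
    low c u i -> ~~ low c u (i + 1) ->
  [/\ in_group m l (u \o simpleZ i), shuffled c (u \o simpleZ i),
    ascent_at (low c u \o simpleZ i) i,
    D i (S (u \o simpleZ i)) = S u &
    prefix_sum (low c u) l m.+1 = (prefix_sum (low c u \o simpleZ i) l m.+1).+1].
Proof.
move=> gu su hi ui uj; have gu' := in_group_simple gu hi.
have su' : shuffled c (u \o simpleZ i) by apply: shuffled_swap => //; rewrite ui (negbTE uj).
have as' : ascent_at (low c u \o simpleZ i) i by rewrite /ascent_at /= simpleZl simpleZr ui uj.
split=> //.
  rewrite (D_shuffled gu' su' hi) ifT //; congr S.
  by apply: functional_extensionality => z /=; rewrite simpleZK.
move: hi; rewrite /in_window => hi.
have := @prefix_sum_swap (low c u) l m.+1 i ltac:(lia) ltac:(lia); rewrite ui (negbTE uj).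
by move: (prefix_sum _ _ _) (prefix_sum _ _ _); lia.
Qed.

Lemma comp_simpleZK (A : int -> bool) i : (A \o simpleZ i) \o simpleZ i = A.
Proof. by apply: functional_extensionality => z /=; rewrite simpleZK. Qed.

Lemma prefix_sum_signs A B (b : int) k : (forall z, b <= z < b + k%:Z -> A z (+) B z) ->
  (prefix_sum A b k + prefix_sum B b k = 'C(k.+1, 2))%N.
Proof.
move=> h; rewrite /prefix_sum -big_split /= -bin2_sum big_mkord; apply: eq_bigr => e _.
by apply: cnt_signs => z hz; apply: h; have := ltn_ord e; lia.
Qed.

(** The binomial coefficient is the joint prefix sum of a pair with only signs; each letter of x
    raises the sum by one. *)
Definition unwinds u v x H g : Prop := exists A B,
  [/\ config A B H g /\ matchless l m.+1 A B, all (in_window l m) x,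
      config (low p u) (low q v) (S u * S v) (hecke_word x g) /\ Dw x H = S u * S v,
      rainbow_outside (hecke_word x g) &
      (size x + 'C(m.+2, 2) = prefix_sum (low p u) l m.+1 + prefix_sum (low q v) l m.+1)%N].

Lemma unwinds_step u v u' v' x H g i : unwinds u' v' x H g -> in_window l m i ->
    config (low p u) (low q v) (D i (S u' * S v')) (hecke_gen i (hecke_word x g)) ->
    D i (S u' * S v') = S u * S v ->
    (prefix_sum (low p u) l m.+1 + prefix_sum (low q v) l m.+1 =
      (prefix_sum (low p u') l m.+1 + prefix_sum (low q v') l m.+1).+1)%N ->
  unwinds u v (i :: x) H g.
Proof.
move=> [A [B [[c ml] wx [c' e] ro sz]]] hi ci ei ps; exists A, B; split=> //=.
- by rewrite hi.
- by rewrite e -ei.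
- by apply: rainbow_outside_hecke => //; have [] := config_clan c'.
by rewrite ps -sz.
Qed.

Lemma unwind u v : in_group m l u -> in_group m l v -> shuffled p u -> shuffled q v ->
    ballot (low p u) (low q v) ->
  exists x H g, unwinds u v x H g.
Proof.
have [N] := ubnP (prefix_sum (low p u) l m.+1 + prefix_sum (low q v) l m.+1)%N.
elim: N u v => // N IH u v hN gu gv su sv bal.
(* An initial point whose right neighbour is not initial can be undone: one of u and v has a low
   point at i but not at i + 1, and moving that point to i + 1 is a step backwards. *)
have [[i hi [/andP[Ai Bi] nj]]|stuck] := pselect (exists2 i, in_window l m i &
    low p u i && low q v i /\ ~~ (low p u (i + 1) && low q v (i + 1))); last first.
  have ml : matchless l m.+1 (low p u) (low q v).
    apply: ballot_matchless => // i hi Ai Bi; apply/negP => /negP nj; apply: stuck.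
    by exists i => //; rewrite Ai Bi.
  have [g cg og] := matchless_clan ml.
  have cf : config (low p u) (low q v) (S u * S v) g by exists u, v.
  exists [::], (S u * S v), g, (low p u), (low q v); split=> //.
  by have [_ _ sg] := ml; rewrite (prefix_sum_signs sg).
have [Aj|Aj] := boolP (low p u (i + 1)).
  have Bj : ~~ low q v (i + 1) by move: nj; rewrite Aj.
  have [gv' sv' asv dv ps] := unshuffle gv sv hi Bi Bj.
  have [||x [H [g un]]] := IH u (v \o simpleZ i) _ gu gv' su sv'.
  - by move: hN; rewrite ps; move: (prefix_sum _ _ _) (prefix_sum _ _ _); lia.
  - by apply: ballot_sym; apply: (@ballot_swap (low q v)) => //; apply: ballot_sym.
  exists (i :: x), H, g; have [A [B [_ _ [c' _] _ _]]] := un.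
  have na : ~~ ascent_at (low p u) i by rewrite /ascent_at Ai.
  have st := config_stepB hi c' na asv; rewrite (comp_simpleZK (low q v)) in st.
  have e : D i (S u * S (v \o simpleZ i)) = S u * S v.
    by rewrite mulrC D_mulC_invariant ?dv 1?mulrC // (D_shuffled gu su hi) (negbTE na).
  by apply: (unwinds_step un) => //; rewrite ps addnS.
have [gu' su' asu du ps] := unshuffle gu su hi Ai Aj.
have [||x [H [g un]]] := IH (u \o simpleZ i) v _ gu' gv su' sv.
- by move: hN; rewrite ps; move: (prefix_sum _ _ _) (prefix_sum _ _ _); lia.
- exact: (@ballot_swap (low p u)).
exists (i :: x), H, g; have [A [B [_ _ [c' _] _ _]]] := un.
have nb : ~~ ascent_at (low q v) i by rewrite /ascent_at Bi.
have st := config_stepA hi c' asu nb; rewrite (comp_simpleZK (low p u)) in st.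
have e : D i (S (u \o simpleZ i) * S v) = S u * S v.
  by rewrite D_mulC_invariant ?du // (D_shuffled gv sv hi) (negbTE nb).
by apply: (unwinds_step un) => //; rewrite ps addSn.
Qed.

End Unwinding.

(** * Degrees and change of window *)

Lemma mpoly_morphism_eq (n : nat) (R : comNzRingType) (f g : {rmorphism {mpoly int[n]} -> R}) :
  (forall k, f 'X_k = g 'X_k) -> f =1 g.
Proof.
move=> h t; elim/mpolyind: t => [|c k t _ _ IH]; first by rewrite !rmorph0.
rewrite !rmorphD IH -mul_mpolyC !rmorphM; congr (_ * _ + _).
  have -> : c%:MP = 1 *~ c :> {mpoly int[n]}.
    by rewrite -[c in LHS](intz c) -[_%:MP]/(mpolyC n _) raddfMz /= mpolyC1.
  by rewrite !rmorphMz !rmorph1.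
rewrite mpolyXE_id !rmorph_prod; apply: eq_bigr => d _.
by rewrite !rmorphXn h.
Qed.

Section Duality.

Variables (m : nat) (l : int).

Notation jet := (@jet m l).
Notation S := (@schub m l).

Lemma jet_schub a w : in_group m l w -> all (in_window l m) a -> reduced a ->
  jet a (S w) = (`[< word_perm a = w >])%:R.
Proof.
elim/last_ind: a w => [|a i IH] w gw.
  move=> _ _; case: asboolP => /= [<-|ne]; first by rewrite schub_id /jet /= eps1.
  by apply: eps_schub => // e; apply: ne.
rewrite all_rcons => /andP[hi wa] ra; have lt := reduced_last ra.
rewrite jet_rcons; have [gt|le] := ltP (w (i + 1)) (w i).
  rewrite schub_descent // IH //; last exact: reduced_belast ra; last exact: in_group_simple.
  congr ((nat_of_bool _)%:R); apply/asboolP/asboolP => [e|<-]; rewrite ?word_perm_rcons ?e;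
    by apply: functional_extensionality => z /=; rewrite simpleZK.
rewrite schub_ascent ?jet0 //.
  case: asboolP => // e; move: le; rewrite -e word_perm_rcons /= simpleZl simpleZr; lia.
by have /in_group_inj/(_ i (i + 1)) := gw; lia.
Qed.

End Duality.

Section ScaledInclusion.

Variables (m m' : nat) (l l' : int) (c : int).
Hypotheses (hl : l' <= l) (hr : l + m%:Z <= l' + m'%:Z).

(* The substitution X z := c * X z between the polynomial rings of two nested
   windows: c = 1 is the inclusion, c = 2 detects degrees. *)
Definition rescale (f : {mpoly int[m.+1]}) : {mpoly int[m'.+1]} :=
  f \mPo [tuple X m' l' (l + d%:Z) *~ c | d < m.+1].

Lemma rescale_sub f g : rescale (f - g) = rescale f - rescale g.
Proof. exact: comp_mpolyB. Qed.

Lemma rescale_mul f g : rescale (f * g) = rescale f * rescale g.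
Proof. exact: rmorphM. Qed.

Lemma rescale1 : rescale 1 = 1.
Proof. exact: comp_mpoly1. Qed.

HB.instance Definition _ := GRing.isZmodMorphism.Build _ _ rescale rescale_sub.

HB.instance Definition _ := GRing.isMonoidMorphism.Build _ _ rescale (conj rescale1 rescale_mul).

Lemma rescaleX z : l <= z <= l + m%:Z -> rescale (X m l z) = X m' l' z *~ c.
Proof.
move=> hz; rewrite /rescale comp_mpolyXU -tnth_nth tnth_mktuple /pos inordK; last lia.
by congr (X _ _ _ *~ _); lia.
Qed.

Lemma rescale_window i : in_window l m i -> in_window l' m' i.
Proof. by rewrite /in_window; lia. Qed.

Lemma rescale_sw i f : in_window l m i -> rescale (@sw m l i f) = @sw m' l' i (rescale f).
Proof.
move=> hi; have hi' := rescale_window hi.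
apply: (mpoly_morphism_eq (f := rescale \o @sw m l i) (g := @sw m' l' i \o rescale)) => k /=.
have hk := ltn_ord k; rewrite -(pos_ord l k) -/(X m l _).
rewrite swX //; last by lia.
rewrite rescaleX; last by move: hi; rewrite /in_window; sz i (l + k%:Z); lia.
rewrite rescaleX; last by lia.
by rewrite rmorphMz /= swX //; lia.
Qed.

Lemma rescale_D i f : in_window l m i -> rescale (@D m l i f) *~ c = @D m' l' i (rescale f).
Proof.
move=> hi; have hi' := rescale_window hi; apply/esym/D_unique => //.
rewrite -rescale_sw // -rescale_sub -D_spec rescale_mul rescale_sub !rescaleX;
  try by move: hi; rewrite /in_window; lia.
by rewrite -mulrzBl mulrzAl mulrzAr.
Qed.

Lemma rescale_eps f : eps (rescale f) = eps f.
Proof.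
have h : forall k, (@meval m'.+1 int (fun=> 0) \o rescale) 'X_k = meval (fun=> 0) 'X_k.
  move=> k /=; have hk := ltn_ord k; rewrite -(pos_ord l k) -/(X m l _) rescaleX; last lia.
  by rewrite raddfMz /= !mevalXU mul0rz.
exact: (mpoly_morphism_eq h).
Qed.

Lemma rescale_Dw a f : all (in_window l m) a ->
  @Dw m' l' a (rescale f) = rescale (@Dw m l a f) *~ (c ^+ size a).
Proof.
elim: a => [|i a IH] /=; first by rewrite expr0.
move=> /andP[hi wa]; rewrite IH // raddfMz /= -rescale_D // exprS.
by rewrite mulrzA.
Qed.

Lemma rescale_jet a f : all (in_window l m) a ->
  @jet m' l' a (rescale f) = @jet m l a f * c ^+ size a.
Proof.
move=> wa; rewrite /jet rescale_Dw // -[LHS]/(@jet m' l' [::] _) jet_mulz; congr (_ * _).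
exact: rescale_eps.
Qed.

End ScaledInclusion.

(** * Homogeneity of Schubert polynomials and of their products *)

Section Degree.

Variables (m : nat) (l : int).

Notation R := {mpoly int[m.+1]}.
Notation jet := (@jet m l).
Notation S := (@schub m l).
Notation double := (@rescale m m l l 2).

(** Doubling the variables multiplies degree r by 2^r; this is homogeneity of degree e - d, written
    without subtraction. *)
Definition homogeneous (d e : nat) (f : R) : Prop := double f *~ (2 ^+ d) = f *~ (2 ^+ e).

Lemma homogeneous_mul d e d' e' f g : homogeneous d e f -> homogeneous d' e' g ->
  homogeneous (d + d') (e + e') (f * g).
Proof.
rewrite /homogeneous rescale_mul !exprD !mulrzA => h h'.
by rewrite -[in LHS]mulrzAl -[LHS]mulrzAr h h' mulrzAr mulrzAl.
Qed.

Lemma homogeneous_jet d e f a : homogeneous d e f -> all (in_window l m) a -> jet a f <> 0 ->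
  (size a + d)%N = e.
Proof.
move=> h wa nz; have := congr1 (jet a) h.
rewrite !jet_mulz rescale_jet // -mulrA -exprD => /(mulfI (introN eqP nz)).
exact: (@ieexprIn int 2).
Qed.

(** The degree of the staircase is the length of the longest word, and each divided difference along
    the complement word lowers it by one. *)
Lemma homogeneous_schub w : in_group m l w -> exists d, homogeneous d (size (om l m)) (S w).
Proof.
move=> gw; have [c [nc ec]] := complement_exists gw; exists (size c).
rewrite (schubE gw (nf_reduced nc) ec) /homogeneous.
rewrite -rescale_Dw ?(nf_window nc) //.
have -> : double (staircase m l l m) = staircase m l l m *~ (2 ^+ size (om l m)).
  suff H b k : l <= b -> b + k%:Z <= l + m%:Z ->
      double (staircase m l b k) = staircase m l b k *~ (2 ^+ size (om l k)) by apply: H; lia.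
  elim: k b => [|k IH] b hb hk; first by rewrite rescale1.
  rewrite size_omS addnC exprD mulrzA /= rescale_mul IH; try lia.
  rewrite rmorphXn /= rescaleX; try lia.
  have E e (x : R) : (x *~ 2) ^+ e = x ^+ e *~ 2 ^+ e.
    by elim: e => [|e IHe] //; rewrite !exprS IHe mulrzAr mulrzAl mulrzA.
  by rewrite E mulrzAr mulrzAl.
by elim: (c) (2 ^+ _) => //= i c' IH k; rewrite IH raddfMz.
Qed.

Lemma jet_schub_mul a w x b y : in_group m l w -> in_group m l x ->
    all (in_window l m) a -> reduced b -> reduced y -> word_perm b = w -> word_perm y = x ->
    all (in_window l m) b -> all (in_window l m) y ->
    jet a (S w * S x) <> 0 ->
  size a = (size b + size y)%N.
Proof.
move=> gw gx wa rb ry eb ey wb wy nz.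
have [d hd] := homogeneous_schub gw; have [e he] := homogeneous_schub gx.
have h := homogeneous_jet (homogeneous_mul hd he) wa nz.
(* The jet of S_w along b and that of S_x along y are 1, which identifies the two degrees with the
   lengths of these words. *)
have := homogeneous_jet hd wb; rewrite jet_schub // asboolT // => /(_ (fun h => ltac:(done))).
have := homogeneous_jet he wy; rewrite jet_schub // asboolT // => /(_ (fun h => ltac:(done))).
lia.
Qed.

End Degree.

(** * The rule for pairs in a balanced window *)

Section Verdict.

Variables (m : nat) (l p q : int).
Hypotheses (pq : p + q + 1 = l + l + m%:Z) (lp : l - 1 <= p <= l + m%:Z) (lq : l - 1 <= q <= l + m%:Z).

Notation jet := (@jet m l).
Notation S := (@schub m l).

Lemma prefix_sum_le (c : int) (k C : nat) : c = l + C%:Z - 1 ->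
  prefix_sum (<= c) l k = (\sum_(e < k.+1) minn e C)%N.
Proof.
by move=> cE; apply: eq_bigr => e _; have := cnt_le c l e; move: (cnt _ _ _); ifs; lia.
Qed.

Lemma prefix_sum_length c a : all (in_window l m) a -> reduced a -> shuffled c (word_perm a) ->
  (size a + prefix_sum (low c (word_perm a)) l m.+1 = prefix_sum (<= c) l m.+1)%N.
Proof.
move=> wa ra sa; have ga : in_group m l (word_perm a) by exists a.
apply: (jet_size ga sa wa); first by apply: sub_all wa => i; rewrite /in_window; lia.
by rewrite jet_schub // asboolT.
Qed.

Lemma product_verdict a b : all (in_window l m) a -> all (in_window l m) b ->
    reduced a -> reduced b -> shuffled p (word_perm a) -> shuffled q (word_perm b) ->
    ballot m l (low p (word_perm a)) (low q (word_perm b)) ->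
  exists2 g, clan_of (low p (word_perm a)) (low q (word_perm b)) g /\ rainbow_outside m l g &
    forall c, all (in_window l m) c -> size c = (size a + size b)%N ->
      jet c (S (word_perm a) * S (word_perm b)) = (`[< hecke_word c g = rainbow p q >])%:R.
Proof.
move=> wa wb ra rb sa sb bal.
have ga : in_group m l (word_perm a) by exists a.
have gb : in_group m l (word_perm b) by exists b.
have [x [H [g [A [B [[cf ml] wx [cf' e] ro sz]]]]]] := unwind pq lp lq ga gb sa sb bal.
exists (hecke_word x g); first by split=> //; apply: config_clan cf'.
move=> c wc sc.
have [P PE] : exists P : nat, P%:Z = p - l + 1 by exists (absz (p - l + 1)%R); lia.
have [Q QE] : exists Q : nat, Q%:Z = q - l + 1 by exists (absz (q - l + 1)%R); lia.
have mE : m.+1 = (P + Q)%N by lia.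
have [] : good l p q (P * Q) H g (c ++ x).
  apply: (matchless_good (b := l) (A := A) (B := B)) => //; try lia.
    by rewrite -mE.
  by rewrite -mE all_cat wc wx.
have := prefix_sum_length wa ra sa; have := prefix_sum_length wb rb sb.
rewrite (@prefix_sum_le p _ P); last lia; rewrite (@prefix_sum_le q _ Q); last lia.
have -> : (\sum_(e < m.+2) minn e Q = 'C(Q.+1, 2) + P * Q)%N by rewrite mE sum_minn.
have -> : (\sum_(e < m.+2) minn e P = 'C(P.+1, 2) + P * Q)%N by rewrite mE addnC sum_minn mulnC.
(* The prefix sums of the two identities and of the pair with only signs differ by P Q; together
   with the length formulas this gives size c + size x = P Q. *)
have bin : ('C(m.+2, 2) = 'C(P.+1, 2) + 'C(Q.+1, 2) + P * Q)%N.
  rewrite mE; elim: (P) => [|P' IH]; first by rewrite add0n mul0n addn0.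
  by rewrite addSn binS IH (binS P'.+1) !bin1; lia.
move: sz; rewrite bin size_cat hecke_word_cat jet_cat e => sz sb' sa' _ h1 h0.
have sN : (size c + size x = P * Q)%N.
  by rewrite sc; move: sz sb' sa'; move: (prefix_sum _ _ _) (prefix_sum _ _ _) ('C(_, _)) ('C(_, _)); lia.
by case: asboolP => h; [apply: h1|apply: h0].
Qed.

End Verdict.

(** * The Chow ring *)

Section Permutations.

Variable m : nat.

Implicit Types (s t w : 'S_m.+1).

Lemma permZ_ord w (k : 'I_m.+1) : permZ w k.+1%:Z = (w k).+1%:Z.
Proof. by rewrite /permZ (valK k). Qed.

Lemma permZ_fix w z : ~~ (1 <= z <= 1 + m%:Z) -> permZ w z = z.
Proof.
case: z => [[|k]|k] //= h; rewrite /permZ insubF //.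
by apply/negbTE; move: h; apply: contraNN => h; lia.
Qed.

Lemma window_ord z : 1 <= z <= 1 + m%:Z -> exists k : 'I_m.+1, z = k.+1%:Z.
Proof.
move=> hz; have h : (absz (z - 1)%R < m.+1)%N by lia.
by exists (Ordinal h) => /=; lia.
Qed.

Lemma permZ_mul s t : permZ (s * t)%g = permZ t \o permZ s.
Proof.
apply: functional_extensionality => z /=.
have [/window_ord [k ->]|h] := boolP (1 <= z <= 1 + m%:Z).
  by rewrite !permZ_ord permM.
by rewrite !permZ_fix // permZ_fix.
Qed.

Lemma permZ1 : permZ (1%g : 'S_m.+1) = id.
Proof.
apply: functional_extensionality => z /=.
have [/window_ord [k ->]|h] := boolP (1 <= z <= 1 + m%:Z); last exact: permZ_fix.
by rewrite permZ_ord perm1.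
Qed.

Lemma permZK w : cancel (permZ w) (permZ w^-1%g).
Proof. by move=> z; rewrite -[LHS]/((_ \o _) z) -permZ_mul mulgV permZ1. Qed.

Lemma permZ_inj : injective (@permZ m.+1).
Proof.
move=> s t e; apply/permP => k; apply/val_inj.
by have := congr1 (fun f => f k.+1%:Z) e; rewrite !permZ_ord => -[].
Qed.

Lemma pos1 (k : 'I_m.+1) : pos m 1 k.+1%:Z = k.
Proof. by rewrite -{2}(pos_ord 1 k); congr pos; lia. Qed.

Lemma permZ_adjacent i : in_window 1 m i ->
  permZ (tperm (pos m 1 i) (pos m 1 (i + 1))) = simpleZ i.
Proof.
rewrite /in_window => hi; apply: functional_extensionality => z.
have [hz|hz] := boolP (1 <= z <= 1 + m%:Z); last by rewrite permZ_fix // simpleZ_other //; lia.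
have [k kz] := window_ord hz; rewrite kz permZ_ord -kz -(pos1 k) -kz.
have val_pos y : 1 <= y <= 1 + m%:Z -> (pos m 1 y).+1%:Z = y by move=> hy; rewrite /pos inordK; lia.
have [h|h|[h1 h2 ->]] := simpleZ_spec i z; try (case: h => -> ->; rewrite ?tpermL ?tpermR val_pos //; lia).
by rewrite tpermD ?val_pos //; apply/eqP => /pos_inj; lia.
Qed.

Lemma permZ_tperm_mul (i j : 'I_m.+1) w : j = i.+1 :> nat ->
  permZ (tperm i j * w)%g = permZ w \o simpleZ i.+1%:Z.
Proof.
move=> ij; rewrite permZ_mul -(@permZ_adjacent i.+1%:Z); last first.
  by rewrite /in_window; have := ltn_ord j; lia.
by rewrite (_ : i.+1%:Z + 1 = j.+1%:Z) ?pos1 //; lia.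
Qed.

Lemma permZ_w0 : permZ (w0 m.+1) = word_perm (om 1 m).
Proof.
apply: functional_extensionality => z; rewrite word_perm_om.
case: ifPn => [/window_ord [k ->]|h]; last exact: permZ_fix.
by rewrite permZ_ord /w0 permE /=; have := ltn_ord k; lia.
Qed.

Lemma in_group_permZ w : in_group m 1 (permZ w).
Proof.
apply: (adjacent_perm_ind (l := 1) (P := fun w => in_group m 1 (permZ w))).
- by rewrite permZ1; apply: in_group_id.
- move=> s t [a wa ea] [b wb eb]; exists (b ++ a); first by rewrite all_cat wb.
  by rewrite permZ_mul word_perm_cat ea eb.
by move=> i hi; rewrite permZ_adjacent //; exists [:: i]; rewrite //= hi.
Qed.

Lemma permZ_onto f : in_group m 1 f -> exists w, f = permZ w.
Proof.
move=> [a wa ->]; elim: a wa => [|i a IH] /=; first by exists 1%g; rewrite permZ1.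
move=> /andP[hi /IH [w ew]]; exists (w * tperm (pos m 1 i) (pos m 1 (i + 1)))%g.
by rewrite permZ_mul permZ_adjacent // -ew.
Qed.

(** The inverse permutation increases on the values up to p and on those beyond p, so within each of
    these classes the order of the values is that of their positions. *)
Lemma inverse_grassmannian_shuffled p w : inverse_grassmannian p w -> shuffled p (permZ w).
Proof.
move=> ig x y xy; rewrite /low => e; rewrite ltNge; apply/negP => le.
have mono z (d : nat) : z + d%:Z <= p \/ p < z -> permZ w^-1%g z <= permZ w^-1%g (z + d%:Z).
  elim: d => [|d IH] h; first by rewrite addr0.
  apply: le_trans (IH _) _; first lia.
  have := ig (z + d%:Z); rewrite (_ : z + d%:Z + 1 = z + d.+1%:Z); last lia.
  by move=> /(_ ltac:(lia)); apply: ltW.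
have := mono (permZ w y) (absz (permZ w x - permZ w y)%R).
rewrite (_ : permZ w y + _ = permZ w x); last lia.
by rewrite !permZK => /(_ ltac:(lia)); lia.
Qed.

Definition sch w : {mpoly int[m.+1]} := schub m 1 (permZ w).

Lemma sch_family : is_schubert_family sch.
Proof.
split.
  rewrite /sch permZ_w0 schub_w0.
  suff H (k : nat) (b : nat) : (b + k = m)%N ->
      staircase m 1 b.+1%:Z k = \prod_(i < m.+1 | (b <= i)%N) 'X_i ^+ (m.+1 - i.+1).
    by rewrite (H m 0%N).
  elim: k b => [|k IH] b bk.
    rewrite addn0 in bk; rewrite /= (bigD1 ord_max) /=; last by rewrite bk.
    rewrite subnn expr0 big1 ?mulr1 // => i /andP[h /eqP ne]; case: ne.
    by apply/val_inj => /=; have := ltn_ord i; lia.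
  have hb : (b < m.+1)%N by lia.
  rewrite (bigD1 (Ordinal hb)) //= -/(X m 1 _).
  rewrite (_ : b.+1%:Z + 1 = b.+2%:Z); last lia.
  rewrite IH; last lia.
  rewrite (_ : (m.+1 - b.+1)%N = k.+1); last lia.
  congr (_ ^+ _ * _); first by rewrite /X -(pos1 (Ordinal hb)).
  by apply: eq_bigl => i; rewrite -(inj_eq val_inj) /=; lia.
move=> w i j ij lt; rewrite /sch permZ_tperm_mul //.
have hi : in_window 1 m i.+1%:Z by rewrite /in_window; have := ltn_ord j; lia.
have ij' : i.+1%:Z + 1 = j.+1%:Z by lia.
rewrite -schub_descent //; [|exact: in_group_permZ|by rewrite ij' !permZ_ord; lia].
have := D_spec 1 i.+1%:Z (schub m 1 (permZ w)).
by rewrite sw.unlock /X /tp hi ij' !pos1.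
Qed.

(** The complement word leads from w_0 to any permutation, and each equation determines the next
    polynomial because x_i - x_(i+1) can be cancelled. *)
Lemma family_unique (S : 'S_m.+1 -> {mpoly int[m.+1]}) : is_schubert_family S -> S = sch.
Proof.
move=> [S0 SD]; have [T0 TD] := sch_family; apply: functional_extensionality => w.
have [c [nc ec]] := complement_exists (in_group_permZ w).
have wc := nf_window nc; have {nc} rc := reduced_rev (nf_reduced nc).
elim: c w wc rc ec => [|i c IH] w /=.
  move=> _ _; rewrite -permZ_w0 => /permZ_inj ->; by rewrite S0 T0.
move=> /andP[hi wc] rc ec; rewrite rev_cons in rc.
have hi' := hi; rewrite /in_window in hi'.
have [k kE] : exists k : 'I_m.+1, i = k.+1%:Z by apply: window_ord; lia.
have [k' kE'] : exists k : 'I_m.+1, i + 1 = k.+1%:Z by apply: window_ord; lia.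
have kk : k' = k.+1 :> nat by lia.
pose w' := (tperm k k' * w)%g.
have ww : w = (tperm k k' * w')%g by rewrite mulgA tperm2 mul1g.
have ec' : permZ w' \o word_perm c = word_perm (om 1 m).
  by rewrite -ec permZ_tperm_mul // -kE.
have e' z : permZ w' z = word_perm (om 1 m) (word_perm (rev c) z).
  by rewrite -ec' /= word_permVK.
have lt : (w' k' < w' k)%N.
  suff: (w' k').+1%:Z < (w' k).+1%:Z by lia.
  have := reduced_last rc; rewrite -!permZ_ord -kE -kE' !e' !word_perm_om.
  by rewrite !window_perm ?all_rev // !ifT; lia.
rewrite ww; apply: (mulfI (X_neq hi)); rewrite /X kE' kE !pos1.
by rewrite SD // TD // IH //; exact: reduced_belast rc.
Qed.

Lemma schubertE : @schubert m.+1 = sch.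
Proof.
apply: family_unique; apply: (epsilon_spec (inhabits (fun=> 0)) (@is_schubert_family m.+1)).
by exists sch; apply: sch_family.
Qed.

End Permutations.

(** * Structure constants of the Chow ring as jets *)

Section Chow.

Local Open Scope quotient_scope.

Variable m : nat.

Implicit Types (u v w : 'S_m.+1) (c : 'S_m.+1 -> int).

(** An elementary symmetric polynomial of positive degree is killed by every D_i and has constant
    term zero, so it has no jets; [jet_ideal] extends this to the ideal. *)
Lemma coinvariant_jet l (f : {mpoly int[m.+1]}) a : coinvariant_ideal f -> @jet m l a f = 0.
Proof.
move=> /asboolP[h ->]; rewrite jet_sum big1 // => i _.
apply: (jet_ideal (L := predT)); rewrite ?all_predT // => {}a _.
have ms : mesym m.+1 int i.+1 \is symmetric by apply: mesym_sym.
elim/last_ind: a => [|a d IH]; last first.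
  by rewrite jet_rcons D_invariant ?jet0 // sw.unlock; apply: (issymP _ ms).
rewrite -[LHS]/(meval (fun=> 0) _) mesymE raddf_sum /= big1 // => s /eqP cs.
have [k ks] : exists k, k \in s by apply/set0Pn; rewrite -card_gt0 cs.
by rewrite mevalX (bigD1 k) //= mnmE ks mul0r.
Qed.

Notation jet := (@jet m 1).

Lemma Chow_eq (f g : {mpoly int[m.+1]}) :
  \pi_({ideal_quot (coinvariant_idealr m.+1)}) f = \pi_({ideal_quot (coinvariant_idealr m.+1)}) g <->
  coinvariant_ideal (f - g).
Proof.
split=> [/eqP|h]; first by rewrite -Quotient.idealrBE.
by apply/eqP; rewrite -Quotient.idealrBE.
Qed.

Lemma sigma_expand u v c : sigma u * sigma v = \sum_w sigma w *~ c w <->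
  coinvariant_ideal (sch u * sch v - \sum_w sch w *~ c w).
Proof.
have -> : sigma u * sigma v = \pi_({ideal_quot (coinvariant_idealr m.+1)}) (sch u * sch v) :> Chow m.+1.
  by rewrite rmorphM /sigma schubertE.
have -> : \sum_w sigma w *~ c w =
    \pi_({ideal_quot (coinvariant_idealr m.+1)}) (\sum_w sch w *~ c w) :> Chow m.+1.
  by rewrite raddf_sum; apply: eq_bigr => w _; rewrite raddfMz /sigma schubertE.
exact: Chow_eq.
Qed.

Lemma word_exists w : exists a, [/\ all (in_window 1 m) a, reduced a & word_perm a = permZ w].
Proof.
have [a wa ->] := in_group_permZ w; have [b nb <-] := nf_exists wa.
by exists b; split=> //; [apply: nf_window nb|apply: nf_reduced nb].
Qed.

Lemma jet_sum_sch a c w : all (in_window 1 m) a -> reduced a -> word_perm a = permZ w ->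
  jet a (\sum_w sch w *~ c w) = c w.
Proof.
move=> wa ra ew; rewrite jet_sum (bigD1 w) //= big1 ?addr0 => [|x xw].
  by rewrite jet_mulz jet_schub ?asboolT ?mul1r //; exact: in_group_permZ.
rewrite jet_mulz jet_schub //; last exact: in_group_permZ.
by case: asboolP => [|_]; rewrite ?mul0r // ew => /permZ_inj e; rewrite e eqxx in xw.
Qed.

(** Jets along reduced words read off the coefficients by duality. Conversely, words with a square
    have zero jets, so the reduced ones suffice for the ideal membership test [jet_coinvariant]. *)
Lemma sigma_expandP u v c : sigma u * sigma v = \sum_w sigma w *~ c w <->
  forall a w, all (in_window 1 m) a -> reduced a -> word_perm a = permZ w ->
    c w = jet a (sch u * sch v).
Proof.
rewrite sigma_expand; split=> [h a w wa ra ew|h].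
  have := coinvariant_jet 1 a h; rewrite jet_sub (jet_sum_sch _ wa ra ew).
  by move=> /eqP; rewrite subr_eq0 => /eqP.
apply: (jet_coinvariant (l := 1)) => a wa.
have [sq|[b nb eb]] := nf_or_squareful wa; first exact: jet_squareful.
rewrite (jet_braid _ _ eb); have wb := nf_window nb; have rb := nf_reduced nb.
have [|w ew] := @permZ_onto m (word_perm b); first by exists b.
by rewrite jet_sub (jet_sum_sch _ wb rb ew) (h b w) // subrr.
Qed.

Lemma schubert_coeffP u v : sigma u * sigma v = \sum_w sigma w *~ schubert_coeff u v w.
Proof.
apply: (epsilon_spec (inhabits (fun=> 0)) (fun c => sigma u * sigma v = \sum_w sigma w *~ c w)).
have ex w : exists k : int, forall a, all (in_window 1 m) a -> reduced a -> word_perm a = permZ w ->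
    k = jet a (sch u * sch v).
  have [a [wa ra ea]] := word_exists w; exists (jet a (sch u * sch v)) => b wb rb eb.
  by apply: jet_braid; apply: matsumoto => //; rewrite ea.
exists (fun w => epsilon (inhabits 0) (fun k : int => forall a, all (in_window 1 m) a -> reduced a ->
  word_perm a = permZ w -> k = jet a (sch u * sch v))).
apply/sigma_expandP => a w wa ra ea.
exact: (epsilon_spec (inhabits 0) _ (ex w)).
Qed.

End Chow.

(** * From the window of S_n to a larger one *)

Section Ambient.

Variables (m M : nat) (L : int).
Hypotheses (hL : L <= 1) (hM : 1 + m%:Z <= L + M%:Z).

Lemma all_window_widen a : all (in_window 1 m) a -> all (in_window L M) a.
Proof. by apply: sub_all => i; rewrite /in_window; lia. Qed.

Lemma in_group_widen f : in_group m 1 f -> in_group M L f.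
Proof. by move=> [a wa ->]; exists a => //; apply: all_window_widen. Qed.

(** The two polynomials differ in general, because the larger window adds variables to the left of
    1. Duality gives them the same jets along words of the small window, which is enough for
    products by [jet_ideal]. *)
Lemma jet_stable_schub (w : 'S_m.+1) a : all (in_window 1 m) a ->
  jet L a (@rescale m M 1 L 1 (sch w) - schub M L (permZ w)) = 0.
Proof.
move=> wa; have wa' := all_window_widen wa; have gw := in_group_permZ w.
rewrite jet_sub rescale_jet // expr1n mulr1.
have [sq|[b nb eb]] := nf_or_squareful wa; first by rewrite !jet_squareful.
rewrite !(jet_braid _ _ eb); have wb := nf_window nb; have rb := nf_reduced nb.
by rewrite !jet_schub ?subrr //; [exact: in_group_widen|exact: all_window_widen].
Qed.

Lemma jet_stable_product (u v : 'S_m.+1) a : all (in_window 1 m) a ->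
  jet 1 a (sch u * sch v) = jet L a (schub M L (permZ u) * schub M L (permZ v)).
Proof.
move=> wa; have := rescale_jet 1 hL hM (sch u * sch v) wa.
rewrite expr1n mulr1 => <-; rewrite rescale_mul.
have := @jet_stable_schub v; have := @jet_stable_schub u.
move: (@rescale _ _ _ _ _ (sch u)) (@rescale _ _ _ _ _ (sch v)) => f g.
move: (schub _ _ (permZ u)) (schub _ _ (permZ v)) => f' g' hu hv.
have -> : f * g = g * (f - f') + f' * (g - g') + f' * g' by ring.
by rewrite !jet_add (jet_ideal (L := in_window 1 m) hu) // (jet_ideal (L := in_window 1 m) hv) // !add0r.
Qed.

End Ambient.

(** The initial points left of x count twice, which settles every prefix of at most 2(x - l) points.
    A longer prefix reaches y, beyond which all points are final, so it already has the full count m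
    + 1. *)
Lemma ballot_by_margins (m : nat) l p q (x y : int) u v :
    l - 1 <= p <= l + m%:Z -> l - 1 <= q <= l + m%:Z -> p + q + 1 = l + l + m%:Z ->
    in_group m l u -> in_group m l v ->
    (forall z, z < x -> low p u z && low q v z) ->
    (forall z, y <= z -> ~~ (low p u z || low q v z)) ->
    l <= x -> y - l <= (x - l) + (x - l) ->
  ballot m l (low p u) (low q v).
Proof.
move=> hp hq pq gu gv lo hi lx xy e he.
have full c : l + c%:Z <= x -> cnt (low p u) l c = c /\ cnt (low q v) l c = c.
  by move=> hc; split; apply: (@cnt_const _ _ _ true) => z hz; case/andP: (lo z ltac:(lia)).
have [le|gt] := leP (l + e%:Z) x; first by have [-> ->] := full e le; lia.
have [c cE] : exists c : nat, c%:Z = x - l by exists (absz (x - l)%R); lia.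
have [le|{}gt] := leP (e%:Z) (c%:Z + c%:Z).
  have [h1 h2] := full c ltac:(lia).
  by rewrite (_ : e = (c + (e - c))%N) ?cntD ?h1 ?h2; lia.
have := cnt_total pq hp hq gu gv; rewrite {1 2}(_ : m.+1 = (e + (m.+1 - e))%N); last lia.
rewrite !cntD (@cnt_const (low p u) (l + e%:Z) _ false) ?(@cnt_const (low q v) (l + e%:Z) _ false) /=.
- by lia.
- by move=> z hz; have /norP[_ /negbTE] := hi z ltac:(lia).
- by move=> z hz; have /norP[/negbTE] := hi z ltac:(lia).
Qed.

Lemma gammaP (m n : nat) l p q (u v : 'S_n) g :
    p + q + 1 = l + l + m%:Z -> l - 1 <= p <= l + m%:Z -> l - 1 <= q <= l + m%:Z ->
    in_group m l (permZ u) -> in_group m l (permZ v) ->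
    clan_of (low p (permZ u)) (low q (permZ v)) g -> rainbow_outside m l g ->
  gamma p q u v = g.
Proof.
move=> pq lp lq gu gv cg rg.
have to_clan h : is_gamma p q u v h -> clan_of (low p (permZ u)) (low q (permZ v)) h.
  move=> [[mh _] nh th]; split=> // z; rewrite /low; have [t1 t2 t3 t4] := th z.
  by split=> h1 h2; [apply: t1|apply: t2|apply: t3|apply: t4]; rewrite // ltNge.
apply: (clan_unique _ cg); apply: to_clan.
apply: (epsilon_spec (inhabits (rainbow p q)) (is_gamma p q u v)); exists g.
have [mg ng tg] := cg; split=> //; last first.
  move=> i; have [t1 t2 t3 t4] := tg i; rewrite !ltNge.
  by split=> h1 h2; [apply: t1|apply: t2|apply: t3|apply: t4].
split=> //; exists l, (l + m%:Z).
(* A plus is low for u only, a minus for v only, and matched points cancel; so zeta is the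
   difference of the two counts of low points. *)
have -> : zeta g l (l + m%:Z) = p - q.
  have H (k : nat) : \sum_(d < k) entry_weight (g (l + d%:Z)) =
      (cnt (low p (permZ u)) l k)%:Z - (cnt (low q (permZ v)) l k)%:Z.
    elim: k => [|k IH]; first by rewrite /cnt !big_ord0.
    rewrite big_ord_recr IH !cntS /=; have := clan_theta (l + k%:Z) cg.
    have [t1 t2 t3 t4] := tg (l + k%:Z).
    case Az : (low p _ _) t1 t2 t3 t4; case Bz : (low q _ _) => //= t1 t2 t3 t4 _.
    + by have [b -> _] := t1 isT isT; rewrite /=; lia.
    + by rewrite t3 //=; lia.
    + by rewrite t4 //=; lia.
    + by have [b -> _] := t2 isT isT; rewrite /=; lia.
  rewrite /zeta H (_ : absz _ = m.+1); last lia.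
  by have := cnt_group gu lp; have := cnt_group gv lq; lia.
split; [|lia|lia].
by move=> k hk; rewrite rg; [congr Mate; lia|lia].
Qed.

Lemma coeff_rule (m : nat) (p q : int) (u v : 'S_m.+1) b c a :
    inverse_grassmannian p u -> inverse_grassmannian q v ->
    all (in_window 1 m) b -> all (in_window 1 m) c -> all (in_window 1 m) a ->
    reduced b -> reduced c -> word_perm b = permZ u -> word_perm c = permZ v ->
    size a = (size b + size c)%N ->
  jet 1 a (sch u * sch v) = (`[< hecke_word a (gamma p q u v) = rainbow p q >])%:R /\
  matching (gamma p q u v).
Proof.
move=> /inverse_grassmannian_shuffled su /inverse_grassmannian_shuffled sv wb wc wa rb rc eb ec sa.
(* The window from - B to p + q + 1 + B is symmetric under z -> p + q + 1 - z. With the margins x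
   and y used below, the inequality of [ballot_by_margins] requires B to be at least m + 3 |p| + 3
   |q|. *)
have [B BE] : exists B : int, B = m%:Z + 1 + 3 * `|p| + 3 * `|q|.
  by exists (m%:Z + 1 + 3 * `|p| + 3 * `|q|).
have [L LE] : exists L : int, L = - B by exists (- B).
have [M ME] : exists M : nat, L + M%:Z = p + q + 1 + B.
  by exists (absz (p + q + 1 + B - L)%R); lia.
have hL : L <= 1 by lia.
have hM : 1 + m%:Z <= L + M%:Z by lia.
have lp : L - 1 <= p <= L + M%:Z by lia.
have lq : L - 1 <= q <= L + M%:Z by lia.
have pq : p + q + 1 = L + L + M%:Z by lia.
have gu := in_group_widen hL hM (in_group_permZ u).
have gv := in_group_widen hL hM (in_group_permZ v).
have fixl (w : 'S_m.+1) z : z < 1 -> permZ w z = z by move=> hz; apply: permZ_fix; lia.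
have fixr (w : 'S_m.+1) z : 1 + m%:Z < z -> permZ w z = z by move=> hz; apply: permZ_fix; lia.
have bal : ballot M L (low p (permZ u)) (low q (permZ v)).
  apply: (ballot_by_margins (x := 1 - `|p| - `|q|) (y := m%:Z + 2 + `|p| + `|q|)) => //; try lia.
    by move=> z hz; rewrite /low !fixl; lia.
  by move=> z hz; rewrite /low !fixr; lia.
move: su sv gu gv bal; rewrite -eb -ec => su sv gu gv bal.
have [||g [cg rg] vg] := product_verdict pq lp lq _ _ rb rc su sv bal.
- exact: (all_window_widen hL hM).
- exact: (all_window_widen hL hM).
have gE : gamma p q u v = g.
  by apply: (gammaP pq lp lq) => //; rewrite -?eb -?ec.
rewrite gE; split; last by case: cg.
rewrite (jet_stable_product hL hM) // -eb -ec vg //; exact: (all_window_widen hL hM).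
Qed.

Theorem theorem1p1 (n : nat) (p q : int) (u v : 'S_n) (n_ge1 : (1 <= n)%N)
    (u_ig : inverse_grassmannian p u) (v_ig : inverse_grassmannian q v) :
  [/\ multiplicity_free (sigma u * sigma v),
      sigma u * sigma v = \sum_(w : 'S_n) sigma w *~ schubert_coeff u v w &
      forall w : 'S_n,
        let P := coxeter_length (permZ w) =
                   (coxeter_length (permZ u) + coxeter_length (permZ v))%N /\
                 hecke_act (permZ w) (gamma p q u v) =1 rainbow p q in
        (schubert_coeff u v w = 1 <-> P) /\ (~ P -> schubert_coeff u v w = 0)].
Proof.
case: n u v n_ge1 u_ig v_ig => // m u v _ u_ig v_ig.
have exp := schubert_coeffP u v; have /sigma_expandP coef := exp.
have [b [wb rb eb]] := word_exists u; have [c [wc rc ec]] := word_exists v.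
have rule (w : 'S_m.+1) : let P := coxeter_length (permZ w) =
                   (coxeter_length (permZ u) + coxeter_length (permZ v))%N /\
                 hecke_act (permZ w) (gamma p q u v) =1 rainbow p q in
    P /\ schubert_coeff u v w = 1 \/ ~ P /\ schubert_coeff u v w = 0.
  have [a [wa ra ea]] := word_exists w.
  rewrite /= (coef a w) // -ea -eb -ec !coxeter_length_reduced //.
  have [sz|sz] := eqVneq (size a) (size b + size c)%N; last first.
    right; split=> [[e]|]; first by rewrite e eqxx in sz.
    have [//|nz] := pselect (jet 1 a (sch u * sch v) = 0); move/eqP: sz => []; move: nz.
    by apply: jet_schub_mul => //; apply: in_group_permZ.
  have [-> mg] := coeff_rule u_ig v_ig wb wc wa rb rc eb ec sz.
  (* The reduced word chosen inside [hecke_act] is braid equivalent to a, and gamma_{u,v} is a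
     matching, so both words act alike. *)
  have -> : hecke_act (word_perm a) (gamma p q u v) = hecke_word a (gamma p q u v).
    have [d rd] := reduced_word_exists a.
    have := epsilon_spec (inhabits [::]) _ (ex_intro _ _ rd); rewrite /hecke_act.
    move: (epsilon _ _) => e /reduced_wordP[ee re].
    by apply: hecke_word_braid => //; apply: matsumoto.
  case: asboolP => h; [left|right]; split=> //; first by split=> // z; rewrite h.
  by move=> [_ e]; case: h; apply: functional_extensionality.
split=> //.
  by exists (schubert_coeff u v); split=> // w; have [[_]|[_]] := rule w; [right|left].
by move=> w P; have [[hP ->]|[hP ->]] := rule w.
Qed.
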